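(* Let $A\in\mathbb{N}_{\geq 0}^{m\times n}$, $b\in\mathbb{N}_{>0}^m$, $c\in\mathbb{Z}^n$, the finite set $S\subseteq\mathbb{R}^n_{\ge0}\setminus\{0\}$, the cone $C$ generated by $S$, and $N$ be as in the context. Given a strongly combinatorial and strongly polynomial-time sign oracle $\mathcal{A}$ for $S$ running in $T_\mathcal{A}$ time, there is a strongly polynomial FPTAS for the problem $\max\{c^Tx: Ax\le b,\ x\in C\}$ running in $\mathcal{O}\left(\frac{1}{\varepsilon^2}\cdot m\log m\cdot(N+T_\mathcal{A})+T_\mathcal{A}^2\right)$ time.
   Context: Setting: $A\in\mathbb{N}_{\geq 0}^{m\times n}$ has non-negative integer entries and at least one positive entry in each row and each column; $b\in\mathbb{N}_{>0}^m$; $c\in\mathbb{Z}^n$ has entries of arbitrary sign; $N$ is the number of non-zero entries of $A$. $S=\{x^{(1)},\dots,x^{(k)}\}$ is a finite set of non-zero vectors in $\mathbb{R}^n_{\ge0}$ and $C=\{\sum_l\alpha_lx^{(l)}:\alpha_l\ge0\}$ the cone it generates, accessed only through an oracle (the cone is assumed well-described). A sign oracle for $S$ receives $d\in\mathbb{R}^n$ and returns $x^{(l)}\in S$ with $\operatorname{sgn}(d^Tx^{(l)})=\operatorname{sgn}(d^Tx^{(l^* )})$, where $x^{(l^* )}$ minimizes $d^Tx^{(i)}$ over $S$; $T_\mathcal{A}\in\Omega(n)$. Strongly combinatorial: the oracle only performs additions, subtractions, multiplications by constants and comparisons on values depending on its input. An FPTAS receives an instance and $\varepsilon\in(0,1)$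 and outputs a feasible $x$ with $c^Tx\ge(1-\varepsilon)$ times the optimum, in time polynomial in the encoding size and $1/\varepsilon$; strongly polynomial means the number of operations is independent of the magnitudes of the numbers in the input. *)

(* Defs.v *)
From mathcomp Require Import all_boot all_order all_algebra.
From mathcomp Require Import classical_sets reals exp.

Set Implicit Arguments.
Unset Strict Implicit.
Unset Printing Implicit Defensive.

Import Order.TTheory GRing.Theory Num.Theory.
Local Open Scope ring_scope.

(** * Model of computation

  A RAM with two kinds of cells: natural numbers (sizes, indices, control) and
  numbers of a value domain [V] (the reals, for the actual running time).  The
  only natural-number operations are literals, addition and truncated
  subtraction; no instruction turns a value into a natural number, so the
  number of steps can only depend on numerical data through comparisons.
  There are finitely many named registers and arrays in any given program;
  arrays are unbounded and are indexed by registers.  The input is read-only,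
  the work memory is initially zero. *)

Inductive arith := Add | Sub | Mul | Div.

Inductive test :=
  | ILt of nat & nat          (* I[i] < I[j] *)
  | RLt of nat & nat.         (* V[i] < V[j] *)

Inductive cmd :=
  | Skip
  | ILit of nat & nat         (* I[i] := k *)
  | IAdd of nat & nat & nat   (* I[i] := I[j] + I[k] *)
  | ISub of nat & nat & nat   (* I[i] := I[j] - I[k], truncated *)
  | IInp of nat & nat & nat   (* I[i] := a-th input index array, at I[j] *)
  | ILoad of nat & nat & nat  (* I[i] := a-th work index array, at I[j] *)
  | IStore of nat & nat & nat (* a-th work index array, at I[i], := I[j] *)
  | RLit of nat & nat         (* V[i] := k *)
  | RArith of arith & nat & nat & nat (* V[i] := V[j] op V[k] *)
  | RInp of nat & nat & nat   (* V[i] := a-th input value array, at I[j] *)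
  | RLoad of nat & nat & nat  (* V[i] := a-th work value array, at I[j] *)
  | RStore of nat & nat & nat (* a-th work value array, at I[i], := V[j] *)
  | Seq of cmd & cmd
  | If of test & cmd & cmd
  | While of test & cmd.

(* An operation returning [None] is forbidden: the execution is then stuck. *)
Record domain := Domain {
  dval :> Type;
  dlit : nat -> dval;
  dop : arith -> dval -> dval -> option dval;
  dlt : dval -> dval -> bool }.

Record input (V : Type) := Input {
  inp_i : nat -> nat -> nat;
  inp_r : nat -> nat -> V }.

Record state (V : Type) := State {
  ireg : nat -> nat;
  iarr : nat -> nat -> nat;
  rreg : nat -> V;
  rarr : nat -> nat -> V }.

Definition upd (T : Type) (f : nat -> T) (i : nat) (v : T) : nat -> T :=
  fun j => if j == i then v else f j.

Section Semantics.
Variable V : domain.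
Implicit Types s : state V.

Definition set_ireg s i v := State (upd (ireg s) i v) (iarr s) (rreg s) (rarr s).
Definition set_rreg s i v := State (ireg s) (iarr s) (upd (rreg s) i v) (rarr s).
Definition set_iarr s a i v :=
  State (ireg s) (upd (iarr s) a (upd (iarr s a) i v)) (rreg s) (rarr s).
Definition set_rarr s a i v :=
  State (ireg s) (iarr s) (rreg s) (upd (rarr s) a (upd (rarr s a) i v)).

Definition init : state V :=
  State (fun=> 0%N) (fun _ _ => 0%N) (fun=> dlit V 0) (fun _ _ => dlit V 0).

Definition holds s (b : test) : bool :=
  match b with
  | ILt i j => (ireg s i < ireg s j)%N
  | RLt i j => dlt (rreg s i) (rreg s j)
  end.

Variable inp : input V.

Definition step (p : cmd) s : option (state V) :=
  match p with
  | Skip => Some s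
  | ILit i k => Some (set_ireg s i k)
  | IAdd i j k => Some (set_ireg s i (ireg s j + ireg s k)%N)
  | ISub i j k => Some (set_ireg s i (ireg s j - ireg s k)%N)
  | IInp i a j => Some (set_ireg s i (inp_i inp a (ireg s j)))
  | ILoad i a j => Some (set_ireg s i (iarr s a (ireg s j)))
  | IStore a i j => Some (set_iarr s a (ireg s i) (ireg s j))
  | RLit i k => Some (set_rreg s i (dlit V k))
  | RArith o i j k => omap (set_rreg s i) (dop o (rreg s j) (rreg s k))
  | RInp i a j => Some (set_rreg s i (inp_r inp a (ireg s j)))
  | RLoad i a j => Some (set_rreg s i (rarr s a (ireg s j)))
  | RStore a i j => Some (set_rarr s a (ireg s i) (rreg s j))
  | Seq _ _ | If _ _ _ | While _ _ => None
  end.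

(* [exec p s s' t]: started in [s], [p] halts in [s'] after [t] operations
   (one per elementary instruction and one per test). *)
Inductive exec : cmd -> state V -> state V -> nat -> Prop :=
  | ExecStep p s s' : step p s = Some s' -> exec p s s' 1
  | ExecSeq p q s1 s2 s3 t u :
      exec p s1 s2 t -> exec q s2 s3 u -> exec (Seq p q) s1 s3 (t + u)
  | ExecIf b p q s s' t :
      exec (if holds s b then p else q) s s' t -> exec (If b p q) s s' t.+1
  | ExecWhileF b p s : ~~ holds s b -> exec (While b p) s s 1
  | ExecWhileT b p s1 s2 s3 t u :
      holds s1 b -> exec p s1 s2 t -> exec (While b p) s2 s3 u ->
      exec (While b p) s1 s3 (t + u).+1.

End Semantics.

Section RealMachines.
Variable R : realType.

Definition real_op (o : arith) (x y : R) : R :=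
  match o with Add => x + y | Sub => x - y | Mul => x * y | Div => x / y end.

Definition realD : domain :=
  @Domain R (fun k => k%:R) (fun o x y => Some (real_op o x y))
    (fun x y => x < y).

(* Reals with a mark recording whether they were computed from the marked part
   of the input.  Marked values may be added, subtracted, compared, and
   multiplied or divided by unmarked values (constants), nothing else. *)
Definition linear_op (o : arith) (dx dy : bool) : bool :=
  match o with
  | Add | Sub => true
  | Mul => ~~ (dx && dy)
  | Div => ~~ dy
  end.

Definition markedD : domain :=
  @Domain (R * bool)%type (fun k => (k%:R, false))
    (fun o x y => if linear_op o x.2 y.2
                  then Some (real_op o x.1 y.1, x.2 || y.2) else None)
    (fun x y => x.1 < y.1).

(** * Generating sets and sign oracles *)

(* A generating set S together with the data through which it is described to
   the oracle (e.g. the adjacency arrays of a graph).  Asymptotic statements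
   range over a class of such instances. *)
Record instance := Instance {
  dim : nat;
  gens : seq 'cV[R]_dim;
  idesc : seq (seq nat);
  rdesc : seq (seq R) }.

Definition desc_size (I : instance) : nat :=
  (dim I + sumn (shape (idesc I)) + sumn (shape (rdesc I)))%N.

Definition nonneg_nonzero (I : instance) : Prop :=
  forall x, x \in gens I -> (forall j, 0 <= x j 0) /\ x != 0.

Definition dot n (u v : 'cV[R]_n) : R := \sum_j u j 0 * v j 0.

Definition vec_seq n (T : Type) (u : 'cV[T]_n) : seq T :=
  [seq u j 0 | j <- enum 'I_n].

Definition arrays (T : Type) (x0 : T) (ss : seq (seq T)) : nat -> nat -> T :=
  fun a j => nth x0 (nth [::] ss a) j.

Definition oracle_input (V : domain) (var cst : R -> V)
    (I : instance) (d : 'cV[R]_(dim I)) : input V :=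
  Input (arrays 0%N ([:: dim I] :: idesc I))
        (arrays (dlit V 0) (map var (vec_seq d) :: map (map cst) (rdesc I))).

(* The output vector is left in the work value array number 0. *)
Definition output n (s : state R) (x : 'cV[R]_n) : Prop :=
  forall j : 'I_n, rarr s 0 j = x j 0.

Definition sign_answer n (S : seq 'cV[R]_n) (d x : 'cV[R]_n) : Prop :=
  x \in S /\
  exists xmin, [/\ xmin \in S, forall z, z \in S -> dot d xmin <= dot d z
                 & Num.sg (dot d x) = Num.sg (dot d xmin)].

Definition sign_oracle (F : set instance) (p : cmd) (T : instance -> nat) : Prop :=
  forall I, F I -> forall d : 'cV[R]_(dim I),
  exists s x t,
    [/\ exec (V := realD) (oracle_input (V := realD) id id d) p (init realD) s t,
        (t <= T I)%N, output s x & sign_answer (gens I) d x].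

Definition strongly_combinatorial (F : set instance) (p : cmd) : Prop :=
  forall I, F I -> forall d : 'cV[R]_(dim I),
  exists s t,
    exec (V := markedD)
      (oracle_input (V := markedD) (fun r => (r, true)) (fun r => (r, false)) d)
      p (init markedD) s t.

Definition strongly_polynomial (F : set instance) (T : instance -> nat) : Prop :=
  exists k, forall I, F I -> (T I <= k * desc_size I ^ k)%N.

Definition Omega_dim (F : set instance) (T : instance -> nat) : Prop :=
  exists2 k : R, 0 < k & forall I, F I -> k * (dim I)%:R <= (T I)%:R.

(** * The packing problem max c^T x, A x <= b, x in the cone of S *)

Definition cone n (S : seq 'cV[R]_n) : set 'cV[R]_n :=
  [set x | exists2 a : nat -> R, (forall l, 0 <= a l) &
             x = \sum_(l < size S) a l *: S`_l].

Section Packing.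
Variables (m n : nat) (A : 'M[nat]_(m, n)) (b : 'cV[nat]_m) (c : 'cV[int]_n).

Definition packing_data : Prop :=
  [/\ forall i, exists j, (0 < A i j)%N,
      forall j, exists i, (0 < A i j)%N
    & forall i, (0 < b i ord0)%N].

Definition support : pred ('I_m * 'I_n) := [pred e | A e.1 e.2 != 0%N].
Definition nnz : nat := #|support|.

Definition objective (x : 'cV[R]_n) : R := dot (map_mx intr c) x.

Definition feasible (S : seq 'cV[R]_n) : set 'cV[R]_n :=
  [set x | cone S x /\
           forall i, (map_mx (GRing.natmul 1) A *m x) i 0 <= (b i 0)%:R].

(* The feasible set is a polytope containing 0, so this is a maximum. *)
Definition optimum (S : seq 'cV[R]_n) : R :=
  sup [set objective x | x in feasible S].

End Packing.

(* [A] is given by its non-zero entries (row, column and value arrays). *)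
Definition packing_input (I : instance) m (A : 'M[nat]_(m, dim I))
    (b : 'cV[nat]_m) (c : 'cV[int]_(dim I)) (eps : R) : input R :=
  let es := enum (support A) in
  Input (arrays 0%N ([:: m; dim I; nnz A] :: [seq val e.1 | e <- es]
           :: [seq val e.2 | e <- es] :: idesc I))
        (arrays 0 ([seq (A e.1 e.2)%:R | e <- es]
           :: [seq k%:R | k <- vec_seq b] :: [seq k%:~R | k <- vec_seq c]
           :: [:: eps] :: rdesc I)).

(* Number of numbers in the input, irrespective of their magnitudes. *)
Definition input_size (I : instance) m (A : 'M[nat]_(m, dim I)) : nat :=
  (m + nnz A + desc_size I)%N.

Definition strongly_polynomial_fptas (F : set instance) (p : cmd) : Prop :=
  exists k : nat, forall I, F I ->
  forall m (A : 'M[nat]_(m, dim I)) (b : 'cV[nat]_m) (c : 'cV[int]_(dim I)) eps,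
  packing_data A b -> 0 < eps < 1 ->
  exists s x t,
    [/\ exec (V := realD) (packing_input A b c eps) p (init realD) s t,
        output s x,
        feasible A b (gens I) x,
        (1 - eps) * optimum A b c (gens I) <= objective c x
      & t%:R <= k%:R * ((input_size A)%:R + eps^-1) ^+ k].

(* Running time in O(g). *)
Definition fptas_runs_in (F : set instance) (p : cmd)
    (g : forall I m, 'M[nat]_(m, dim I) -> R -> R) : Prop :=
  exists K : R, forall I, F I ->
  forall m (A : 'M[nat]_(m, dim I)) (b : 'cV[nat]_m) (c : 'cV[int]_(dim I)) eps,
  packing_data A b -> 0 < eps < 1 ->
  exists s t,
    exec (V := realD) (packing_input A b c eps) p (init realD) s t /\
    t%:R <= K * g I m A eps.

End RealMachines.

(* Main.v *)
Require Import Defs.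
From mathcomp Require Import all_boot all_order all_algebra.
From mathcomp Require Import classical_sets reals sequences exp.
From mathcomp Require Import zify ring lra.
Import Order.TTheory GRing.Theory Num.Theory.
Import Defs.
Local Open Scope ring_scope.

Set Implicit Arguments.
Unset Strict Implicit.
Unset Printing Implicit Defensive.

(**
  Multiplicative weights (Garg and Koenemann).  Weights [y_i], initially
  [1 / b_i], define the ratio [y^T A g / c^T g] of a generator [g].  A push
  adds to the current point the largest multiple of an almost ratio-minimal
  [g] that respects [b] by itself, and multiplies [y_i] by [1 + e * d_i],
  where [d_i <= 1] is the relative load it puts on row [i].  By weak duality
  the minimum ratio times the optimum is at most [\sum_i b_i * y_i], so this
  potential grows at most like [exp (e * (1 + e) * c^T x / optimum)], while
  [b_i * y_i >= exp (e * (1 - e) * z_i)] for the total relative load [z_i].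
  Once some load reaches [log m / e^2], rescaling by the maximum load gives a
  point that is feasible and nearly optimal.

  An almost minimal [g] is found by one call to the sign oracle on
  [A^T y - (1 + e) * mu * c], for a lower bound [mu] on the minimum ratio: if
  the sign is not negative then [mu] can be increased by the factor [1 + e].
  Since some [d_i] equals 1 in each push, and the ratios grow by at most
  [exp (e * max_i z_i)], there are [O(m * log m / e^2)] calls in total.

  The first [mu] is the exact minimum ratio [l0] for [y_i = 1 / b_i], found by
  Megiddo's parametric search: the oracle is run on [A^T y - l * c] with [l]
  infinitesimally larger than [l0], on values that are affine in [l]; a
  comparison of two of them amounts to comparing [l0] with a number, which
  takes one ordinary call.
*)

(** * Executions *)

(** The oracle is a given program and the machine has no procedure calls, so it is compiled into the
    algorithm: its cells are renamed, and each call finds zeroed memory at a cost that does not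
    depend on earlier calls. One translation, to pairs, serves both kinds of call: an ordinary call
    is its germ at the single point 0, the parametric search its germ to the right of [l0].

    The two hypotheses on the oracle concern different runs. [sign_oracle] gives answers and a time
    bound for real runs, [strongly_combinatorial] only says that marked runs do not get stuck. They
    are joined by forgetting marks and by determinism. The marked runs for all [l] near [l0] are
    then glued into a single run on pairs.

    The code works with [eps / 3] because the analysis loses a factor [1 - 3 * e]. The square of the
    oracle time arises since each step of the search may cost one ordinary call. The delicate case
    of the time bound is [m = 1], where [ln m] vanishes and everything must fit into that square.
    There the number of non-zero entries is at most the dimension, which the lower bound on the
    oracle time controls. *)

Section Executions.
Variable V : domain.
Implicit Types (inp : input V) (s : state V) (p q : cmd).

Lemma exec_inv inp p s s' t : exec inp p s s' t ->
  match p with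
  | Seq p1 p2 => exists s1 t1 t2,
      [/\ exec inp p1 s s1 t1, exec inp p2 s1 s' t2 & t = (t1 + t2)%N]
  | If b p1 p2 => exists2 u,
      exec inp (if holds s b then p1 else p2) s s' u & t = u.+1
  | While b p1 =>
      if holds s b then exists s1 t1 t2,
        [/\ exec inp p1 s s1 t1, exec inp (While b p1) s1 s' t2
          & t = (t1 + t2).+1]
      else s' = s /\ t = 1%N
  | _ => step inp p s = Some s' /\ t = 1%N
  end.
Proof.
case=> {p s s' t}.
- by case=> // *; split.
- by move=> p q s1 s2 s3 t u *; exists s2, t, u.
- by move=> b p q s s' t; exists t.
- by move=> b p s /negbTE ->.
- by move=> b p s1 s2 s3 t u -> *; exists s2, t, u.
Qed.

Lemma exec_gt0 inp p s s' t : exec inp p s s' t -> (0 < t)%N.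
Proof. by elim=> // {}p q s1 s2 s3 u v _ u0 _ _; rewrite ltn_addr. Qed.

(** Identifies the run promised by [sign_oracle] with the one obtained from
    [strongly_combinatorial], so that its time bound and its answer carry over. *)
Lemma exec_det inp p s s1 t1 s2 t2 :
  exec inp p s s1 t1 -> exec inp p s s2 t2 -> s1 = s2 /\ t1 = t2.
Proof.
move=> e1; elim: e1 s2 t2 => {p s s1 t1}.
- move=> p s s1 st s2 t2 /exec_inv.
  by case: p st => //= *; repeat match goal with
    | H : _ /\ _ |- _ => case: H => ? ->
    end; split=> //; congruence.
- move=> p q s1 s2 s3 t u _ IH1 _ IH2 s4 t4 /exec_inv[s5 [t5 [t6 [e1 e2 ->]]]].
  by case: (IH1 _ _ e1) e2 => <- <- /IH2[-> ->].
- move=> b p q s s' t _ IH s2 t2 /exec_inv[u e ->].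
  by case: (IH _ _ e) => -> ->.
- by move=> b p s /negbTE h s2 t2 /exec_inv; rewrite h => -[-> ->].
- move=> b p s1 s2 s3 t u h _ IH1 _ IH2 s4 t4 /exec_inv.
  rewrite h => -[s5 [t5 [t6 [e1 e2 ->]]]].
  by case: (IH1 _ _ e1) e2 => <- <- /IH2[-> ->].
Qed.

End Executions.

Fixpoint writes_ireg p i : bool :=
  match p with
  | ILit k _ | IAdd k _ _ | ISub k _ _ | IInp k _ _ | ILoad k _ _ => i == k
  | Seq p q | If _ p q => writes_ireg p i || writes_ireg q i
  | While _ p => writes_ireg p i
  | _ => false
  end.

Fixpoint writes_rreg p i : bool :=
  match p with
  | RLit k _ | RArith _ k _ _ | RInp k _ _ | RLoad k _ _ => i == k
  | Seq p q | If _ p q => writes_rreg p i || writes_rreg q i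
  | While _ p => writes_rreg p i
  | _ => false
  end.

Fixpoint writes_iarr p a : bool :=
  match p with
  | IStore k _ _ => a == k
  | Seq p q | If _ p q => writes_iarr p a || writes_iarr q a
  | While _ p => writes_iarr p a
  | _ => false
  end.

Fixpoint writes_rarr p a : bool :=
  match p with
  | RStore k _ _ => a == k
  | Seq p q | If _ p q => writes_rarr p a || writes_rarr q a
  | While _ p => writes_rarr p a
  | _ => false
  end.

(** On concrete code this computes, so frame conditions are closed by evaluation. For the embedded
    oracle, whose write set is unknown, it expresses bounds such as membership in a residue
    class. *)
Fixpoint writes_in (fi fr fia fra : pred nat) p : bool :=
  match p with
  | ILit k _ | IAdd k _ _ | ISub k _ _ | IInp k _ _ | ILoad k _ _ => fi k
  | RLit k _ | RArith _ k _ _ | RInp k _ _ | RLoad k _ _ => fr k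
  | IStore k _ _ => fia k
  | RStore k _ _ => fra k
  | Seq p q | If _ p q => writes_in fi fr fia fra p && writes_in fi fr fia fra q
  | While _ p => writes_in fi fr fia fra p
  | Skip => true
  end.

Definition same_outside (V : Type) (fi fr fia fra : pred nat) (s s' : state V) : Prop :=
  [/\ forall i, ~~ fi i -> ireg s' i = ireg s i,
      forall i, ~~ fr i -> rreg s' i = rreg s i,
      forall a, ~~ fia a -> iarr s' a = iarr s a
    & forall a, ~~ fra a -> rarr s' a = rarr s a].

Lemma same_outside_trans (V : Type) fi fr fia fra (s1 s2 s3 : state V) :
  same_outside fi fr fia fra s1 s2 -> same_outside fi fr fia fra s2 s3 ->
  same_outside fi fr fia fra s1 s3.
Proof.
by case=> a1 a2 a3 a4 [b1 b2 b3 b4]; split=> i w;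
  rewrite ?b1 ?b2 ?b3 ?b4 // ?a1 ?a2 ?a3 ?a4.
Qed.

Lemma exec_writes_in (V : domain) (inp : input V) fi fr fia fra p s s' t :
  writes_in fi fr fia fra p -> exec inp p s s' t -> same_outside fi fr fia fra s s'.
Proof.
move=> w e; elim: e w => {p s s' t}.
- have updN (T : Type) (f : pred nat) (g : nat -> T) k v a :
      f k -> ~~ f a -> upd g k v a = g a.
    by rewrite /upd; case: eqP => // -> ->.
  move=> p s s'; rewrite /same_outside; case: p => //=;
    try by move=> *; match goal with H : Some _ = Some _ |- _ =>
      case: H => <- end; split=> //= a; apply: updN.
  by move=> o i j k; case: dop => //= v [<-] w; split=> //= a; apply: updN.
- move=> p q s1 s2 s3 t u _ IH1 _ IH2 /= /andP[/IH1 w1 /IH2 w2].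
  exact: same_outside_trans w1 w2.
- by move=> b p q s s' t _ IH /= /andP[w1 w2]; apply: IH; case: ifP.
- by [].
- move=> b p s1 s2 s3 t u _ _ IH1 _ IH2 w.
  by apply: same_outside_trans (IH1 w) (IH2 w).
Qed.

Lemma writes_in_sub (fi fr fia fra : pred nat) p :
  (forall i, writes_ireg p i -> fi i) -> (forall i, writes_rreg p i -> fr i) ->
  (forall i, writes_iarr p i -> fia i) -> (forall i, writes_rarr p i -> fra i) ->
  writes_in fi fr fia fra p.
Proof.
elim: p => //=; try by move=> *; match goal with
  H : forall i, is_true (i == _) -> _ |- _ => exact: H end.
- by move=> p IHp q IHq *; apply/andP; split; [apply: IHp | apply: IHq] => i w;
  match goal with H : forall i, _ -> is_true (?f i) |- is_true (?f _) =>
    by apply: H; rewrite w ?orbT end.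
- by move=> b p IHp q IHq *; apply/andP; split; [apply: IHp | apply: IHq] => i w;
  match goal with H : forall i, _ -> is_true (?f i) |- is_true (?f _) =>
    by apply: H; rewrite w ?orbT end.
Qed.

Definition frame (V : Type) p (s s' : state V) : Prop :=
  same_outside (writes_ireg p) (writes_rreg p) (writes_iarr p) (writes_rarr p) s s'.

Lemma frame_trans (V : Type) p (s1 s2 s3 : state V) :
  frame p s1 s2 -> frame p s2 s3 -> frame p s1 s3.
Proof. exact: same_outside_trans. Qed.

Lemma exec_frame (V : domain) (inp : input V) p s s' t :
  exec inp p s s' t -> frame p s s'.
Proof. by apply: exec_writes_in; apply: writes_in_sub. Qed.

(** * Timed total correctness *)

Section Termination.
Variable V : domain.
Variable inp : input V.
Implicit Types (s : state V) (p q : cmd) (Q : state V -> Prop).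

(** Total correctness with an upper bound on the time: branches of different lengths can be merged
    by weakening. *)
Definition wp p t Q s := exists s' u, [/\ exec inp p s s' u, (u <= t)%N & Q s'].

Lemma wp_weaken p t t' Q Q' s :
  (t <= t')%N -> (forall s', Q s' -> Q' s') -> wp p t Q s -> wp p t' Q' s.
Proof.
move=> tt' QQ' [s' [u [e ut Qs]]]; exists s', u; split=> //; last exact: QQ'.
exact: leq_trans tt'.
Qed.

Lemma wp_le p t t' Q s : (t <= t')%N -> wp p t Q s -> wp p t' Q s.
Proof. by move=> le; apply: wp_weaken. Qed.

Lemma wp_frame p t Q s : wp p t Q s -> wp p t (fun s' => Q s' /\ frame p s s') s.
Proof.
by move=> [s' [u [e ut Qs]]]; exists s', u; split=> //; split=> //;
  apply: exec_frame e.
Qed.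

Lemma wp_seq p q t u Q s : wp p t (wp q u Q) s -> wp (Seq p q) (t + u) Q s.
Proof.
move=> [s1 [t1 [e1 le1 [s2 [t2 [e2 le2 Qs]]]]]].
by exists s2, (t1 + t2)%N; split=> //; [apply: ExecSeq e1 e2 | apply: leq_add].
Qed.

Lemma wp_if b p q t Q s :
  wp (if holds s b then p else q) t Q s -> wp (If b p q) t.+1 Q s.
Proof. by move=> [s1 [t1 [e1 le1 Qs]]]; exists s1, t1.+1; split=> //; apply: ExecIf. Qed.

(** Termination is read off the invariant, which cannot hold after more than [B] rounds; no separate
    variant is required. The potential argument for the main loop yields its bound in exactly this
    form. *)
Lemma wp_while b p c B (Inv : nat -> state V -> Prop) s :
  (forall k s', Inv k s' -> (k <= B)%N) ->
  (forall k s', Inv k s' -> holds s' b -> wp p c (Inv k.+1) s') ->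
  Inv 0%N s ->
  wp (While b p) (B * c.+1).+1 (fun s' => ~~ holds s' b /\ exists k, Inv k s') s.
Proof.
move=> bnd body inv0.
suff H d k s1 : (B <= d + k)%N -> Inv k s1 ->
    wp (While b p) (d * c.+1).+1
      (fun s' => ~~ holds s' b /\ exists k, Inv k s') s1.
  by apply: (H B 0%N) => //; rewrite addn0.
elim: d k s1 => [|d IH] k s1 Bd inv1; have [h|h] := boolP (holds s1 b);
  try by exists s1, 1%N; split=> //; [apply: ExecWhileF | split=> //; exists k].
  have [s2 [u [_ _ /bnd]]] := body _ _ inv1 h.
  by rewrite ltnNge Bd.
have [s2 [u [e1 le1 inv2]]] := body _ _ inv1 h.
have [|s3 [v [e2 le2 Q3]]] := IH k.+1 s2 _ inv2; first by rewrite addnS.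
exists s3, (u + v).+1; split=> //; first exact: ExecWhileT e1 e2.
by rewrite mulSn; lia.
Qed.

Definition For idx bnd one body :=
  Seq (ILit idx 0) (While (ILt idx bnd) (Seq body (IAdd idx idx one))).

(** The invariant is stated after the increment, and the body may assume [frame p s s'], so
    invariants need not repeat what the loop leaves unchanged. The cost [c.+2] includes the
    increment and the test. *)
Lemma wp_for idx bnd one body nb c (Inv : nat -> state V -> Prop) s :
  let p := For idx bnd one body in
  ~~ writes_ireg body idx -> ~~ writes_ireg p bnd -> ~~ writes_ireg p one ->
  ireg s one = 1%N -> ireg s bnd = nb ->
  Inv 0%N (set_ireg s idx 0) ->
  (forall k s', (k < nb)%N -> Inv k s' -> frame p s s' -> ireg s' idx = k ->
     wp body c (fun s'' => Inv k.+1 (set_ireg s'' idx k.+1)) s') ->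
  wp p (2 + nb * c.+2) (fun s' => Inv nb s' /\ frame p s s') s.
Proof.
move=> p wbi wpb wp1 one1 bndE inv0 hbody.
apply: wp_frame; rewrite -[2%N]/(1 + 1)%N -addnA; apply: wp_seq.
exists (set_ireg s idx 0), 1%N; split=> //; first exact: ExecStep.
pose J k s' := [/\ (k <= nb)%N, Inv k s', ireg s' idx = k & frame p s s'].
have J0 : J 0%N (set_ireg s idx 0).
  split=> //=; first by rewrite /upd eqxx.
  split=> //= i; rewrite !negb_or => /andP[/negbTE i1 _].
  by rewrite /upd i1.
have := @wp_while (ILt idx bnd) (Seq body (IAdd idx idx one)) c.+1 nb J _ _ _ J0.
move=> H; apply: wp_weaken (H _ _); [by rewrite add1n| |by move=> k s' [] |].
- move=> s' [h [k [le1 inv k1 fr]]]; move: h; rewrite /= k1.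
  have [/(_ _ wpb) -> _ _ _] := fr; rewrite bndE -leqNgt => nbk.
  by have <- : k = nb by apply/eqP; rewrite eqn_leq le1.
move=> k s' [le1 inv k1 fr]; rewrite /= k1.
have [/(_ _ wpb) ss _ _ _] := fr; rewrite ss bndE => kn.
rewrite -addn1; apply: wp_seq.
have [s2 [u [e2 le2 inv2]]] := hbody _ _ kn inv fr k1.
exists s2, u; split=> //; exists (set_ireg s2 idx k.+1), 1%N; split=> //.
  apply: ExecStep => /=; congr (Some (set_ireg _ _ _)).
  have [f1 _ _ _] := exec_frame e2.
  rewrite f1 // k1 f1; last by move: wp1; rewrite /= !negb_or => /and3P[].
  by have [/(_ _ wp1) -> _ _ _] := fr; rewrite one1 addn1.
split=> //=; first by rewrite /upd eqxx.
apply: frame_trans fr _; have [f1 f2 f3 f4] := exec_frame e2.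
split=> i /=; rewrite ?orbF => w; [|exact: f2|exact: f3|exact: f4].
by move: w; rewrite !negb_or => /and3P[/negbTE i1 w2 _]; rewrite /upd i1 f1.
Qed.

Definition blk (l : seq cmd) := foldr Seq Skip l.

Definition run1 s p := odflt s (step inp p s).
Definition run s (l : seq cmd) := foldl run1 s l.

Lemma exec_blk (l : seq cmd) s :
  (forall s' i, (i < size l)%N -> step inp (nth Skip l i) s') ->
  exec inp (blk l) s (run s l) (size l).+1.
Proof.
elim: l s => [|p l IH] s H; first exact: ExecStep.
rewrite /blk /= -/blk -add1n; apply: (@ExecSeq _ _ _ _ _ (run1 s p)).
  by apply: ExecStep; have := H s 0%N isT; rewrite /run1 /=; case: step.
by apply: IH => s' i; apply: (H s' i.+1).
Qed.

End Termination.

Arguments blk : simpl never.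

Definition straight p : bool :=
  match p with Seq _ _ | If _ _ _ | While _ _ => false | _ => true end.

(** No operation of [realD] is forbidden, so a straight-line block never gets stuck and its final
    state is computed by [run]. The strict inequality pays for the closing [Skip]. *)
Lemma wp_blk (R : realType) (inp : input (realD R)) l t Q s :
  all straight l -> (size l < t)%N -> Q (run inp s l) -> wp inp (blk l) t Q s.
Proof.
move=> sl lt Qs; exists (run inp s l), (size l).+1; split=> //.
apply: exec_blk => s' i /((all_nthP Skip sl) i).
by case: nth.
Qed.
(** * Simulation of an oracle on affine values *)

Definition pair_op (R : realType) (o : arith) (x y : R * R) : R * R :=
  match o with
  | Add => (x.1 + y.1, x.2 + y.2)
  | Sub => (x.1 - y.1, x.2 - y.2)
  | Mul => (x.1 * y.1, x.1 * y.2 + x.2 * y.1)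
  | Div => (x.1 / y.1, x.2 / y.1)
  end.

(* The pair [(p, q)] stands for the affine function [l |-> p + q * l]; an
   inequality [p + q * l < p' + q' * l] is decided by [tst] from the
   coefficients of the equivalent inequality [(q - q') * l < p' - p].  [Mul]
   and [Div] are only meaningful when the linear term vanishes, which is what
   being strongly combinatorial guarantees. *)
Definition pairD (R : realType) (tst : R -> R -> bool) : domain :=
  @Domain (R * R)%type (fun k => (k%:R, 0)) (fun o x y => Some (pair_op o x y))
    (fun x y => tst (x.2 - y.2) (y.1 - x.1)).

(* Registers and arrays are split into classes modulo 3: class 0 belongs to the
   packing algorithm, and class [o] (1 or 2) to the copy number [o] of the
   oracle.  The arrays of a copy are shifted by [base]; all the cells from [hi]
   on are still zero, so that setting [base := hi] provides a zeroed memory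
   for the next call. *)
Definition base (o : nat) := o.
Definition hi (o : nat) := (o + 3)%N.
Definition tmp (o : nat) := (o + 6)%N.
Definition flag (o : nat) := (o + 9)%N.
Definition ri (o i : nat) := (o + 3 * (10 + i))%N.
Definition du (o : nat) := o.
Definition dv (o : nat) := (o + 3)%N.
Definition t1 (o : nat) := (o + 6)%N.
Definition t2 (o : nat) := (o + 9)%N.
Definition rp (o i : nat) := (o + 3 * (10 + i.*2))%N.
Definition rq (o i : nat) := (o + 3 * (11 + i.*2))%N.
Definition ia (o a : nat) := (o + 3 * a)%N.
Definition pa (o a : nat) := (o + 3 * a.*2)%N.
Definition qa (o a : nat) := (o + 3 * a.*2.+1)%N.

(** With [nsE1] and [nsE2], rewrite rules that settle every comparison of addresses inside one copy,
    so that a read after an update simplifies by rewriting. *)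
Lemma nsE0 (o : nat) :
  ((t1 o == t2 o) = false) * ((t2 o == t1 o) = false) *
  ((du o == dv o) = false) * ((dv o == du o) = false) *
  ((base o == hi o) = false) * ((hi o == base o) = false) *
  ((base o == tmp o) = false) * ((hi o == tmp o) = false) *
  ((tmp o == base o) = false) * ((tmp o == hi o) = false) *
  ((base o == flag o) = false) * ((hi o == flag o) = false) *
  ((flag o == base o) = false) * ((flag o == hi o) = false).
Proof.
rewrite /ri /rp /rq /pa /qa /ia /base /hi /tmp /flag /du /dv /t1 /t2.
repeat split; lia.
Qed.

Lemma nsE1 (o i : nat) :
  ((ri o i == base o) = false) * ((base o == ri o i) = false) *
  ((ri o i == hi o) = false) * ((hi o == ri o i) = false) *
  ((ri o i == tmp o) = false) * ((tmp o == ri o i) = false) *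
  ((ri o i == flag o) = false) * ((flag o == ri o i) = false) *
  ((rp o i == t1 o) = false) * ((t1 o == rp o i) = false) *
  ((rp o i == t2 o) = false) * ((t2 o == rp o i) = false) *
  ((rq o i == t1 o) = false) * ((t1 o == rq o i) = false) *
  ((rq o i == t2 o) = false) * ((t2 o == rq o i) = false) *
  ((rp o i == du o) = false) * ((du o == rp o i) = false) *
  ((rq o i == du o) = false) * ((du o == rq o i) = false) *
  ((rp o i == dv o) = false) * ((dv o == rp o i) = false) *
  ((rq o i == dv o) = false) * ((dv o == rq o i) = false).
Proof.
rewrite /ri /rp /rq /pa /qa /ia /base /hi /tmp /flag /du /dv /t1 /t2.
repeat split; lia.
Qed.

Lemma nsE2 (o i j : nat) :
  ((ri o i == ri o j) = (i == j)) * ((rp o i == rp o j) = (i == j)) *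
  ((rq o i == rq o j) = (i == j)) * ((rp o i == rq o j) = false) *
  ((rq o i == rp o j) = false) * ((pa o i == qa o j) = false) *
  ((qa o i == pa o j) = false) * ((ia o i == ia o j) = (i == j)) *
  ((pa o i == pa o j) = (i == j)) * ((qa o i == qa o j) = (i == j)).
Proof.
rewrite /ri /rp /rq /pa /qa /ia /base /hi /tmp /flag /du /dv /t1 /t2.
repeat split; lia.
Qed.

Definition nsE := (nsE0, nsE1, nsE2).

(** Residues modulo 3 separate a copy from the algorithm and from the other copy at once, without
    comparing individual addresses. *)
Lemma class_modE o i :
  (ri o i = o %[mod 3]) * (rp o i = o %[mod 3]) * (rq o i = o %[mod 3]) *
  (ia o i = o %[mod 3]) * (pa o i = o %[mod 3]) * (qa o i = o %[mod 3]) *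
  (base o = o %[mod 3]) * (hi o = o %[mod 3]) * (tmp o = o %[mod 3]) *
  (flag o = o %[mod 3]) * (du o = o %[mod 3]) * (dv o = o %[mod 3]) *
  (t1 o = o %[mod 3]) * (t2 o = o %[mod 3]).
Proof.
rewrite /ri /rp /rq /pa /qa /ia /base /hi /tmp /flag /du /dv /t1 /t2.
repeat split; lia.
Qed.
Definition i_one := 3%N.
Definition i_n := 6%N.

Definition class (o : nat) : pred nat := fun k => k == o %[mod 3].

Notation confined o := (writes_in (class o) (class o) (class o) (class o)).
Notation agree_but o := (same_outside (class o) (class o) (class o) (class o)).

(** A program names finitely many registers, and these alone are cleared one by one before a call.
    Arrays are unbounded and are renewed by shifting [base] instead. *)
Fixpoint regs_below (B : nat) p : bool :=
  match p with
  | Skip => true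
  | ILit i _ | RLit i _ => (i < B)%N
  | IAdd i j k | ISub i j k | RArith _ i j k => [&& (i < B)%N, (j < B)%N & (k < B)%N]
  | IInp i _ j | ILoad i _ j | IStore _ i j | RInp i _ j | RLoad i _ j
  | RStore _ i j => (i < B)%N && (j < B)%N
  | Seq p q => regs_below B p && regs_below B q
  | If (ILt i j) p q | If (RLt i j) p q =>
      [&& (i < B)%N, (j < B)%N, regs_below B p & regs_below B q]
  | While (ILt i j) p | While (RLt i j) p =>
      [&& (i < B)%N, (j < B)%N & regs_below B p]
  end.

Lemma regs_below_mono B B' p : (B <= B')%N -> regs_below B p -> regs_below B' p.
Proof.
move=> BB; elim: p => //=; try by move=> *; lia.
- by case=> i j *; lia.
- by case=> i j *; lia.
Qed.

Lemma regs_below_ex p : exists B, regs_below B p.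
Proof.
elim: p => /=; try by exists 0%N.
- by move=> i _; exists i.+1.
- by move=> i j k; exists (i + j + k).+1; lia.
- by move=> i j k; exists (i + j + k).+1; lia.
- by move=> i _ j; exists (i + j).+1; lia.
- by move=> i _ j; exists (i + j).+1; lia.
- by move=> _ i j; exists (i + j).+1; lia.
- by move=> i _; exists i.+1.
- by move=> _ i j k; exists (i + j + k).+1; lia.
- by move=> i _ j; exists (i + j).+1; lia.
- by move=> i _ j; exists (i + j).+1; lia.
- by move=> _ i j; exists (i + j).+1; lia.
- move=> p [B1 h1] q [B2 h2]; exists (B1 + B2)%N.
  by apply/andP; split; [apply: regs_below_mono h1 | apply: regs_below_mono h2]; lia.
- move=> b p [B1 h1] q [B2 h2]; case: b => i j; exists (B1 + B2 + i + j).+1;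
  by apply/and4P; split; try lia; [apply: regs_below_mono h1 | apply: regs_below_mono h2]; lia.
- move=> b p [B1 h1]; case: b => i j; exists (B1 + i + j).+1;
  by apply/and3P; split; try lia; apply: regs_below_mono h1; lia.
Qed.

Definition compare o cmp i j :=
  Seq (blk [:: RArith Sub (du o) (rq o i) (rq o j);
               RArith Sub (dv o) (rp o j) (rp o i)]) cmp.

(* Copy number [o] of [p] on pairs: [D1] and [D2] are the work arrays holding
   the two components of the direction, and [cmp] decides
   [V[du] * l < V[dv]] into [I[flag]]. *)
Fixpoint tr o D1 D2 cmp p : cmd :=
  match p with
  | Skip => Skip
  | ILit i k => blk [:: ILit (ri o i) k]
  | IAdd i j k => blk [:: IAdd (ri o i) (ri o j) (ri o k)]
  | ISub i j k => blk [:: ISub (ri o i) (ri o j) (ri o k)]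
  | IInp i 0 j => If (ILt (ri o j) i_one) (blk [:: IAdd (ri o i) i_n 0])
                                          (blk [:: ILit (ri o i) 0])
  | IInp i a.+1 j => blk [:: IInp (ri o i) a.+3 (ri o j)]
  | ILoad i a j => blk [:: IAdd (tmp o) (base o) (ri o j);
                           ILoad (ri o i) (ia o a) (tmp o)]
  | IStore a i j => blk [:: IAdd (tmp o) (base o) (ri o i);
                            IStore (ia o a) (tmp o) (ri o j);
                            IAdd (hi o) (hi o) (ri o i); IAdd (hi o) (hi o) i_one]
  | RLit i k => blk [:: RLit (rp o i) k; RLit (rq o i) 0]
  | RArith Add i j k => blk [:: RArith Add (rp o i) (rp o j) (rp o k);
                                RArith Add (rq o i) (rq o j) (rq o k)]
  | RArith Sub i j k => blk [:: RArith Sub (rp o i) (rp o j) (rp o k);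
                                RArith Sub (rq o i) (rq o j) (rq o k)]
  | RArith Mul i j k => blk [:: RArith Mul (t1 o) (rp o j) (rq o k);
                                RArith Mul (t2 o) (rq o j) (rp o k);
                                RArith Mul (rp o i) (rp o j) (rp o k);
                                RArith Add (rq o i) (t1 o) (t2 o)]
  | RArith Div i j k => blk [:: RArith Div (rq o i) (rq o j) (rp o k);
                                RArith Div (rp o i) (rp o j) (rp o k)]
  | RInp i 0 j => blk [:: RLoad (rp o i) D1 (ri o j); RLoad (rq o i) D2 (ri o j)]
  | RInp i a.+1 j => blk [:: RInp (rp o i) a.+4 (ri o j); RLit (rq o i) 0]
  | RLoad i a j => blk [:: IAdd (tmp o) (base o) (ri o j);
                           RLoad (rp o i) (pa o a) (tmp o);
                           RLoad (rq o i) (qa o a) (tmp o)]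
  | RStore a i j => blk [:: IAdd (tmp o) (base o) (ri o i);
                            RStore (pa o a) (tmp o) (rp o j);
                            RStore (qa o a) (tmp o) (rq o j);
                            IAdd (hi o) (hi o) (ri o i); IAdd (hi o) (hi o) i_one]
  | Seq p q => Seq (tr o D1 D2 cmp p) (tr o D1 D2 cmp q)
  | If (ILt i j) p q =>
      If (ILt (ri o i) (ri o j)) (tr o D1 D2 cmp p) (tr o D1 D2 cmp q)
  | If (RLt i j) p q =>
      Seq (compare o cmp i j)
          (If (ILt 0 (flag o)) (tr o D1 D2 cmp p) (tr o D1 D2 cmp q))
  | While (ILt i j) p => While (ILt (ri o i) (ri o j)) (tr o D1 D2 cmp p)
  | While (RLt i j) p =>
      Seq (compare o cmp i j)
          (While (ILt 0 (flag o)) (Seq (tr o D1 D2 cmp p) (compare o cmp i j)))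
  end.

Section Simulation.
Variables (R : realType) (tst : R -> R -> bool) (o : nat).
Variables (inp : input (realD R)) (oin : input (pairD tst)).
Variables (D1 D2 nn : nat) (cmp : cmd) (kappa B : nat).
(** Abstract because the two copies need different environments: agreement outside class 1 with the
    calling state for copy 1, and [searching] for copy 2, whose comparisons run copy 1 and overwrite
    scratch cells of the algorithm. *)
Variable Env : state R -> Prop.

Hypothesis o_bound : (0 < o < 3)%N.
(** Array 0 of the oracle holds the dimension alone, which the translation takes from [i_n]. The
    later description arrays are shifted past the three index arrays and four value arrays that
    begin the packing input. *)
Hypothesis inp_dim : forall j, inp_i oin 0 j = if j is 0 then nn else 0%N.
Hypothesis inp_idesc : forall a j, inp_i oin a.+1 j = inp_i inp a.+3 j.
Hypothesis inp_rdesc : forall a j, inp_r oin a.+1 j = (inp_r inp a.+4 j, 0).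
Hypothesis Env_class0 : forall s, Env s ->
  [/\ ireg s 0 = 0%N, ireg s i_one = 1%N, ireg s i_n = nn
    & forall j, (rarr s D1 j, rarr s D2 j) = inp_r oin 0 j].
Hypothesis Env_agree : forall s s',
  agree_but o s s' -> Env s -> Env s'.

(** A comparison may alter cells of other classes, but of its own copy it may change only the
    flag. *)
Definition own (s s' : state R) : Prop :=
  [/\ forall i, i = o %[mod 3] -> i != flag o -> ireg s' i = ireg s i,
      forall i, i = o %[mod 3] -> rreg s' i = rreg s i,
      forall i, i = o %[mod 3] -> iarr s' i = iarr s i
    & forall i, i = o %[mod 3] -> rarr s' i = rarr s i].

Hypothesis cmpP : forall s, Env s -> wp inp cmp kappa (fun s' =>
  [/\ Env s', own s s' & ireg s' (flag o) = tst (rreg s (du o)) (rreg s (dv o))]) s.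

Definition fresh (s : state R) : Prop := forall a j, (ireg s (hi o) <= j)%N ->
  [/\ iarr s (ia o a) j = 0%N, rarr s (pa o a) j = 0 & rarr s (qa o a) j = 0].

Record sim (S : state (R * R)) (s : state R) : Prop := Sim {
  sim_i : forall i, (i < B)%N -> ireg s (ri o i) = ireg S i;
  sim_p : forall i, (i < B)%N -> rreg s (rp o i) = (rreg S i).1;
  sim_q : forall i, (i < B)%N -> rreg s (rq o i) = (rreg S i).2;
  sim_ia : forall a j, iarr s (ia o a) (ireg s (base o) + j) = iarr S a j;
  sim_pa : forall a j, rarr s (pa o a) (ireg s (base o) + j) = (rarr S a j).1;
  sim_qa : forall a j, rarr s (qa o a) (ireg s (base o) + j) = (rarr S a j).2;
  sim_base : (ireg s (base o) <= ireg s (hi o))%N;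
  sim_fresh : fresh s }.

Lemma wp_own l t Q s : all straight l -> confined o (blk l) -> (size l < t)%N ->
  Env s -> (Env (run inp s l) -> Q (run inp s l)) -> wp inp (blk l) t Q s.
Proof.
move=> sl cl lt Es H; have [|s' [u [e ut ss]]] := @wp_blk _ inp l t (eq (run inp s l)) s sl lt.
  by [].
exists s', u; split=> //; rewrite -ss; apply: H; rewrite ss.
exact: Env_agree (exec_writes_in cl e) Es.
Qed.

Lemma i_one_ns : ((i_one == hi o) = false) * ((i_one == tmp o) = false).
Proof. by rewrite /i_one /hi /tmp; split; lia. Qed.

(** Seven steps: the longest block has five instructions and a [Skip], and reading the dimension
    adds one test. *)
Lemma tr_step p S S' s : straight p -> regs_below B p -> step oin p S = Some S' ->
  Env s -> sim S s ->
  wp inp (tr o D1 D2 cmp p) 7 (fun s' => Env s' /\ sim S' s') s.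
Proof.
move=> sp bp st Es [si sP sQ sia spa sqa sb sf].
have [e0 e1 en eD] := Env_class0 Es.
have own_blk l S1 : all straight l -> confined o (blk l) -> (size l < 6)%N ->
    sim S1 (run inp s l) ->
    wp inp (blk l) 6 (fun s' => Env s' /\ sim S1 s') s.
  by move=> sl cl zl h; apply: wp_own.
have up l S1 : wp inp (blk l) 6 (fun s' => Env s' /\ sim S1 s') s ->
    wp inp (blk l) 7 (fun s' => Env s' /\ sim S1 s') s by apply: wp_weaken.
have fr a j : (ireg s (hi o) <= j)%N -> [/\ iarr s (ia o a) j = 0%N,
   rarr s (pa o a) j = 0 & rarr s (qa o a) j = 0] by apply: sf.
pose rules := (nsE0, nsE1, nsE2, i_one_ns, @eqxx).
(* Each store raises [hi] by the stored index plus one. As [base <= hi], the new [hi] lies beyond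
   the written cell, and no maximum has to be computed. *)
have freshD i j : (ireg s (hi o) + ireg s (ri o i) + 1 <= j)%N ->
    (ireg s (hi o) <= j)%N /\ (j == ireg s (base o) + ireg s (ri o i))%N = false.
  by move: sb; clear; lia.
case: p sp bp st => //=;
 [by move=> _ _ [<-]; exists s, 1%N; split=> //; exact: ExecStep
 | move=> i k _ Bi | move=> i j k _ /and3P[Bi Bj Bk]
 | move=> i j k _ /and3P[Bi Bj Bk] | move=> i [|a] j _ /andP[Bi Bj]
 | move=> i a j _ /andP[Bi Bj] | move=> a i j _ /andP[Bi Bj]
 | move=> i k _ Bi | move=> op i j k _ /and3P[Bi Bj Bk]
 | move=> i [|a] j _ /andP[Bi Bj] | move=> i a j _ /andP[Bi Bj]
 | move=> a i j _ /andP[Bi Bj] ] => -[<-] {S'}; do ?case: op;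
 try (apply: up; apply: own_blk => //; first by rewrite /blk /= /class ?class_modE ?eqxx).
all: try (constructor; rewrite /fresh /= /upd; intros; rewrite ?rules /= ?rules /= ?e1;
  repeat match goal with
  | H : is_true ((if _ then _ else _) <= _)%N |- _ => move: H
  | H : is_true (_ <= _)%N |- _ => move: H end; rewrite ?rules /= ?rules /= ?e1; intros).
all: rewrite ?eqn_add2l ?si ?sP ?sQ ?sia ?spa ?sqa //.
all: try by [case: (_ == _) | lia | apply: fr].
- apply: wp_if; rewrite /= e1 si // inp_dim.
  case: (ireg S j) => [|k] /=; apply: own_blk => //;
    try by rewrite /blk /= /class ?class_modE ?eqxx.
  + constructor; rewrite /fresh /= /upd; intros; rewrite ?rules /= ?e0 ?en ?addn0
      ?si ?sP ?sQ //.
    by apply: fr; move: H; rewrite !rules.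
  + constructor; rewrite /fresh /= /upd; intros; rewrite ?rules /=
      ?si ?sP ?sQ //.
    by apply: fr; move: H; rewrite !rules.
- by case: (_ =P a) => _; rewrite ?eqn_add2l sia.
- match goal with H : is_true (_ <= j0)%N |- _ =>
    have [h1 h2] := freshD i j0 H end; have [] := fr a0 j0 h1.
  by rewrite si // in h2; case: (_ =P a) => // ->; rewrite h2.
- by rewrite -eD; case: (_ == _).
- by rewrite -eD; case: (_ == _).
- by rewrite inp_rdesc; case: (_ == _).
- by rewrite inp_rdesc; case: (_ == _).
- by case: (_ =P a) => _; rewrite ?eqn_add2l spa; do ?case: ifP.
- by case: (_ =P a) => _; rewrite ?eqn_add2l sqa; do ?case: ifP.
- match goal with H : is_true (_ <= j0)%N |- _ =>
    have [h1 h2] := freshD i j0 H end; have [] := fr a0 j0 h1.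
  by rewrite si // in h2; case: (_ =P a) => // ->; rewrite h2.
Qed.

Lemma own_sim S s s' : own s s' -> sim S s -> sim S s'.
Proof.
case=> f1 f2 f3 f4 [si sP sQ sia spa sqa sb sf].
have eb : ireg s' (base o) = ireg s (base o) by rewrite f1 ?class_modE ?nsE.
have eh : ireg s' (hi o) = ireg s (hi o) by rewrite f1 ?class_modE ?nsE.
constructor=> [i|i|i|a j|a j|a j||a j].
- by move=> iB; rewrite f1 ?class_modE ?nsE // si.
- by move=> iB; rewrite f2 ?class_modE // sP.
- by move=> iB; rewrite f2 ?class_modE // sQ.
- by rewrite eb f3 ?class_modE.
- by rewrite eb f4 ?class_modE.
- by rewrite eb f4 ?class_modE.
- by rewrite eb eh.
- by rewrite eh f3 ?f4 ?class_modE //; apply: sf.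
Qed.

Lemma compare_sim i j S s : (i < B)%N -> (j < B)%N -> Env s -> sim S s ->
  wp inp (compare o cmp i j) (3 + kappa)
    (fun s' => [/\ Env s', sim S s'
       & ireg s' (flag o) = holds (V := pairD tst) S (RLt i j)]) s.
Proof.
move=> Bi Bj Es ss; apply: wp_seq; apply: wp_own => //.
  by rewrite /blk /= /class ?class_modE ?eqxx.
move=> E2; set s2 := run _ _ _ in E2 *.
have s2P : sim S s2.
  case: ss => si sP sQ sia spa sqa sb sf; constructor=> //= k kB;
  by rewrite /upd !nsE /= ?sP ?sQ.
apply: wp_weaken (cmpP E2) => // s3 [E3 o3 fl]; split=> //; first exact: own_sim s2P.
rewrite fl; congr (nat_of_bool _); case: ss => si sP sQ _ _ _ _ _.
by rewrite /= /upd !eqxx !nsE /= !sP ?sQ.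
Qed.

Lemma tr_sim p S S' t s : exec oin p S S' t -> regs_below B p -> Env s -> sim S s ->
  wp inp (tr o D1 D2 cmp p) ((kappa + 7) * t) (fun s' => Env s' /\ sim S' s') s.
Proof.
move=> e; elim: e s => {p S S' t}.
- move=> p S S' st s bp Es ss.
  apply: (@wp_le _ _ _ 7); first lia.
  by apply: (tr_step _ bp st) => //; case: p st {bp}.
- move=> p q S1 S2 S3 t u _ IH1 _ IH2 s /= /andP[bp bq] Es ss.
  rewrite mulnDr; apply: wp_seq; apply: wp_weaken (IH1 _ bp Es ss) => // s2 [E2 ss2].
  exact: IH2.
- move=> [] i j p q S S' t _ IH s /= /and4P[Bi Bj bp bq] Es ss.
    apply: (@wp_le _ _ _ ((kappa + 7) * t).+1); first lia.
    apply: wp_if; rewrite /= !(sim_i ss) //.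
    by move: IH => /=; case: (_ < _)%N => IH; apply: IH.
  apply: (@wp_le _ _ _ ((3 + kappa) + ((kappa + 7) * t).+1)%N); first lia.
  apply: wp_seq; apply: wp_weaken (compare_sim Bi Bj Es ss) => // s2 [E2 ss2 fl].
  apply: wp_if; have [e0 _ _ _] := Env_class0 E2.
  rewrite /= e0 fl lt0b; move: IH; rewrite /=.
  by case: (tst _ _) => IH; apply: IH.
- move=> [] i j p S h s /= /and3P[Bi Bj bp] Es ss.
    exists s, 1%N; split=> //; last by lia.
    by apply: ExecWhileF; rewrite /= !(sim_i ss).
  apply: (@wp_le _ _ _ ((3 + kappa) + 1)%N); first lia.
  apply: wp_seq; apply: wp_weaken (compare_sim Bi Bj Es ss) => // s2 [E2 ss2 fl].
  have [e0 _ _ _] := Env_class0 E2.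
  by exists s2, 1%N; split=> //; apply: ExecWhileF; rewrite /= e0 fl lt0b.
- move=> [] i j p S1 S2 S3 t u h _ IH1 _ IH2 s b Es ss;
  have /= /and3P[Bi Bj bp] := b.
    have [s2 [t2 [e2 le2 [E2 ss2]]]] := IH1 _ bp Es ss.
    have [s3 [t3 [e3 le3 [E3 ss3]]]] := IH2 _ b E2 ss2.
    exists s3, (t2 + t3).+1; split=> //; last by lia.
    by apply: ExecWhileT e2 e3; rewrite /= !(sim_i ss).
  have [s1 [t1 [e1 le1 [E1 ss1 fl]]]] := compare_sim Bi Bj Es ss.
  have [s2 [t2 [e2 le2 [E2 ss2]]]] := IH1 _ bp E1 ss1.
  (* The induction hypothesis runs the translated loop with its leading comparison. That comparison
     is split off and regrouped as the trailing comparison of the current round. *)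
  have [s3 [t3 [/exec_inv[s4 [t4 [t5 [e4 e5 t45]]]] le3 [E3 ss3]]]] := IH2 _ b E2 ss2.
  have [e0 _ _ _] := Env_class0 E1.
  exists s3, (t1 + (t2 + t4 + t5).+1)%N; split=> //; last by lia.
  apply: ExecSeq e1 _; apply: ExecWhileT e5; last exact: ExecSeq e2 e4.
  by rewrite /= e0 fl lt0b.
Qed.

Fixpoint reset k : cmd :=
  if k is k'.+1 then
    Seq (blk [:: ILit (ri o k') 0; RLit (rp o k') 0; RLit (rq o k') 0]) (reset k')
  else blk [:: IAdd (base o) (hi o) 0].

Definition call p := Seq (reset B) (tr o D1 D2 cmp p).

Lemma resetP k s : (k <= B)%N -> Env s -> fresh s ->
  (forall i, (k <= i < B)%N ->
     [/\ ireg s (ri o i) = 0%N, rreg s (rp o i) = 0 & rreg s (rq o i) = 0]) ->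
  wp inp (reset k) (4 * k + 2) (fun s' => Env s' /\ sim (init (pairD tst)) s') s.
Proof.
elim: k s => [|k IH] s kB Es fs z.
  apply: wp_own => //; first by rewrite /blk /= /class ?class_modE ?eqxx.
  have [e0 _ _ _] := Env_class0 Es.
  split=> //; constructor=> [i|i|i|a j|a j|a j||a j]; rewrite /= /upd ?nsE ?eqxx ?e0 ?addn0.
  - by move=> iB; have [] := z i iB.
  - by move=> iB; have [] := z i iB.
  - by move=> iB; have [] := z i iB.
  - by have [] := fs a (ireg s (hi o) + j)%N (leq_addr _ _).
  - by have [] := fs a (ireg s (hi o) + j)%N (leq_addr _ _).
  - by have [] := fs a (ireg s (hi o) + j)%N (leq_addr _ _).
  - by [].
  - by apply: fs.
apply: (@wp_le _ _ _ (4 + (4 * k + 2))); first lia.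
apply: wp_seq; apply: wp_own => //; first by rewrite /blk /= /class ?class_modE ?eqxx.
move=> E2; apply: IH => //; first exact: ltnW.
  by move=> a j; rewrite /= /upd !nsE; apply: fs.
move=> i /andP[]; rewrite leq_eqVlt /= /upd !nsE => /orP[/eqP<-|ki] iB.
  by rewrite !eqxx.
by rewrite (gtn_eqF ki); apply: z; rewrite ki.
Qed.

Lemma callP p S t s : exec oin p (init (pairD tst)) S t -> regs_below B p ->
  Env s -> fresh s ->
  wp inp (call p) (4 * B + 2 + (kappa + 7) * t) (fun s' => [/\ Env s', fresh s' &
    forall j, rarr s' (pa o 0) (ireg s' (base o) + j) = (rarr S 0 j).1]) s.
Proof.
move=> e bp Es fs; apply: wp_seq.
apply: wp_weaken (resetP (leqnn B) Es fs _) => //; last by move=> i; lia.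
move=> s2 [E2 ss2]; apply: wp_weaken (tr_sim e bp E2 ss2) => // s3 [E3 [] *].
by split.
Qed.

End Simulation.

Arguments call : simpl never.

Lemma call_confined o D1 D2 cmp B p :
  confined o cmp -> confined o (call o D1 D2 cmp B p).
Proof.
move=> cc; rewrite /call /=; apply/andP; split.
  elim: B => [|B IH]; rewrite /= /blk /= /class ?class_modE ?eqxx //.
elim: p => //=; try by move=> *; rewrite /blk /= /class ?class_modE ?eqxx.
- by move=> i [|a] j; rewrite /blk /= /class ?class_modE ?eqxx.
- by case=> *; rewrite /blk /= /class ?class_modE ?eqxx.
- by move=> i [|a] j; rewrite /blk /= /class ?class_modE ?eqxx.
- by move=> p -> q ->.
- by move=> [] i j p Hp q Hq; rewrite /= Hp Hq ?cc /blk /= /class ?class_modE ?eqxx.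
- by move=> [] i j p Hp; rewrite /= Hp ?cc /blk /= /class ?class_modE ?eqxx.
Qed.

(** * Germs of executions *)

Lemma upd_rel (T U : Type) (P : T -> U -> Prop) f g i v w :
  (forall j, P (f j) (g j)) -> P v w -> forall j, P (upd f i v j) (upd g i w j).
Proof. by move=> fg vw j; rewrite /upd; case: ifP. Qed.

Lemma upd2_rel (T U : Type) (P : T -> U -> Prop) f g a i v w :
  (forall b j, P (f b j) (g b j)) -> P v w -> forall b j,
  P (upd f a (upd (f a) i v) b j) (upd g a (upd (g a) i w) b j).
Proof. by move=> fg vw b j; rewrite /upd; case: ifP => _ //; case: ifP. Qed.

Section Germs.
Variables (R : realType) (tst : R -> R -> bool) (ev : (R -> Prop) -> Prop).

(** [ev] is a proper filter along which every affine comparison is decided, by [tst]. It is used for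
    evaluation at 0 and for right neighbourhoods of [l0]. *)
Hypothesis ev_mono : forall P Q : R -> Prop, (forall l, P l -> Q l) -> ev P -> ev Q.
Hypothesis ev_and : forall P Q : R -> Prop, ev P -> ev Q -> ev (fun l => P l /\ Q l).
Hypothesis ev_ex : forall P : R -> Prop, ev P -> exists l, P l.
Hypothesis ev_tst : forall u v, ev (fun l => (u * l < v) = tst u v).

(** An unmarked value has no linear term; this is what makes the product and the quotient of pairs
    correct. *)
Definition lies_on (l : R) (x : R * R) (r : R * bool) : Prop :=
  r.1 = x.1 + x.2 * l /\ (~~ r.2 -> x.2 = 0).

Lemma lies_on_op l o x y r r' : lies_on l x r -> lies_on l y r' ->
  linear_op o r.2 r'.2 ->
  lies_on l (pair_op o x y) (real_op o r.1 r'.1, r.2 || r'.2).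
Proof.
case: x y r r' => [p q] [p' q'] [r m] [r' m'] [/= -> h] [/= -> h'].
case: o => /=.
- by split=> /=; [ring | rewrite negb_or => /andP[/h-> /h'->]; rewrite addr0].
- by split=> /=; [ring | rewrite negb_or => /andP[/h-> /h'->]; rewrite subr0].
- rewrite negb_and => mm; split=> /=; last first.
    by rewrite negb_or => /andP[/h-> /h'->]; rewrite mulr0 mul0r addr0.
  by case/orP: mm => [/h->|/h'->]; ring.
- move=> /h' q0; rewrite q0; split=> /=; last first.
    by rewrite negb_or => /andP[/h-> _]; rewrite mul0r.
  by rewrite mul0r addr0 mulrDl mulrAC.
Qed.

Record lies_over (l : R) (S : state (R * R)) (s : state (R * bool)) : Prop :=
  LiesOver {
    lo_i : forall i, ireg s i = ireg S i;
    lo_ia : forall a j, iarr s a j = iarr S a j;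
    lo_r : forall i, lies_on l (rreg S i) (rreg s i);
    lo_ra : forall a j, lies_on l (rarr S a j) (rarr s a j) }.

Variables (pin : input (pairD tst)) (min : R -> input (markedD R)).
Hypothesis min_i : forall l a j, inp_i (min l) a j = inp_i pin a j.
Hypothesis min_r : forall l a j, lies_on l (inp_r pin a j) (inp_r (min l) a j).

Lemma step_lies_over l p S S' s s' : step pin p S = Some S' ->
  step (min l) p s = Some s' -> lies_over l S s -> lies_over l S' s'.
Proof.
move=> st st' [hi hia hr hra].
have upde T := @upd_rel T T eq; have updae T := @upd2_rel T T eq.
case: p st st' => //=.
- by move=> [<-] [<-].
- by move=> i k [<-] [<-]; split=> //=; apply: upde.
- by move=> i j k [<-] [<-]; split=> //=; apply: upde; rewrite ?hi.
- by move=> i j k [<-] [<-]; split=> //=; apply: upde; rewrite ?hi.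
- by move=> i a j [<-] [<-]; split=> //=; apply: upde; rewrite ?hi ?min_i.
- by move=> i a j [<-] [<-]; split=> //=; apply: upde; rewrite ?hi ?hia.
- by move=> a i j [<-] [<-]; split=> //=; rewrite !hi; apply: updae.
- move=> i k [<-] [<-]; split=> //=; apply: upd_rel => //.
  by split=> //=; rewrite mul0r addr0.
- move=> o i j k [<-]; case: ifP => //= lin [<-]; split=> //=.
  by apply: upd_rel => //; apply: lies_on_op.
- by move=> i a j [<-] [<-]; split=> //=; apply: upd_rel; rewrite ?hi.
- by move=> i a j [<-] [<-]; split=> //=; apply: upd_rel; rewrite ?hi.
- by move=> a i j [<-] [<-]; split=> //=; rewrite !hi; apply: upd2_rel.
Qed.

Lemma ev_holds b S :
  ev (fun l => forall s, lies_over l S s ->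
    holds (V := markedD R) s b = holds (V := pairD tst) S b).
Proof.
case: b => i j /=.
  by apply: ev_mono (ev_tst 0 0) => l _ s ss; rewrite !(lo_i ss).
apply: ev_mono (ev_tst ((rreg S i).2 - (rreg S j).2) ((rreg S j).1 - (rreg S i).1)).
move=> l /= <- s ss; have [-> _] := lo_r ss i; have [-> _] := lo_r ss j.
by apply/idP/idP; lra.
Qed.

(* Along the germ all the runs take the same branches, because each test is
   decided by [tst] eventually; hence they are values of a single run on pairs. *)
Lemma germ_exec k p S :
  ev (fun l => exists s s' u, [/\ lies_over l S s, exec (min l) p s s' u & (u <= k)%N]) ->
  exists S' t, [/\ exec pin p S S' t, (t <= k)%N &
    ev (fun l => forall s s' u, lies_over l S s -> exec (min l) p s s' u ->
      lies_over l S' s' /\ u = t)].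
Proof.
(* Induction on the time bound: the run on pairs is still to be constructed, so there is no
   derivation to induct on, and a loop recurs as the same command with a smaller budget. *)
have [n] := ubnP k; elim: n k p S => // n IH k p S; rewrite ltnS => kn hyp.
have k_gt0 : (0 < k)%N.
  have [l [s [s' [u [_ e uk]]]]] := ev_ex hyp.
  exact: leq_trans (exec_gt0 e) uk.
have concl S' t : ev (fun l => forall s s' u, lies_over l S s -> exec (min l) p s s' u ->
      lies_over l S' s' /\ u = t) -> (t <= k)%N.
  move=> /(ev_and hyp)/ev_ex[l [[s [s' [u [ss e uk]]]] /(_ _ _ _ ss e)[_ <-]]].
  exact: uk.
have [sp|] := boolP (straight p).
  have [S' st] : exists S', step pin p S = Some S'.
    by case: p sp {hyp concl} => //= *; eexists; reflexivity.
  exists S', 1%N; split=> //; first exact: ExecStep.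
  apply: ev_mono hyp => l _ s s' u ss /exec_inv e.
  have [st' ->] : step (min l) p s = Some s' /\ u = 1%N by case: p sp e {st concl}.
  by split=> //; apply: step_lies_over st st' ss.
case: p hyp concl => // [p q|b p q|b p] hyp concl _.
- have [||S1 [t1 [e1 le1 ev1]]] := IH k.-1 p S.
  + by rewrite -ltnS prednK.
  + apply: ev_mono hyp => l [s [s' [u [ss /exec_inv[s1 [u1 [u2 [e1 e2 eu]]]] uk]]]].
    by exists s, s1, u1; split=> //; have := exec_gt0 e2; lia.
  have [||S2 [t2 [e2 le2 ev2]]] := IH (k - t1)%N q S1.
  + by have := exec_gt0 e1; lia.
  + apply: ev_mono (ev_and hyp ev1) =>
      l [[s [s' [u [ss /exec_inv[s1 [u1 [u2 [f1 f2 eu]]]] uk]]]] h].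
    have [ss1 eu1] := h _ _ _ ss f1.
    by exists s1, s', u2; split=> //; lia.
  have ev12 : ev (fun l => forall s s' u, lies_over l S s ->
      exec (min l) (Seq p q) s s' u -> lies_over l S2 s' /\ u = (t1 + t2)%N).
    apply: ev_mono (ev_and ev1 ev2) => l [h1 h2] s s' u ss.
    move=> /exec_inv[s1 [u1 [u2 [f1 f2 ->]]]].
    have [ss1 ->] := h1 _ _ _ ss f1; have [ss2 ->] := h2 _ _ _ ss1 f2.
    by [].
  exists S2, (t1 + t2)%N; split; [exact: ExecSeq e1 e2 | exact: concl ev12 | by []].
- have evb := ev_holds b S.
  have [||S1 [t1 [e1 le1 ev1]]] :=
      IH k.-1 (if holds (V := pairD tst) S b then p else q) S.
  + by rewrite -ltnS prednK.
  + apply: ev_mono (ev_and hyp evb) => l [[s [s' [u [ss /exec_inv[u1 e1 eu] uk]]]] h].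
    by exists s, s', u1; rewrite -(h _ ss); split=> //; lia.
  have ev1' : ev (fun l => forall s s' u, lies_over l S s ->
      exec (min l) (If b p q) s s' u -> lies_over l S1 s' /\ u = t1.+1).
    apply: ev_mono (ev_and evb ev1) => l [h1 h2] s s' u ss /exec_inv[u1 f1 ->].
    by rewrite (h1 _ ss) in f1; have [ss1 ->] := h2 _ _ _ ss f1.
  exists S1, t1.+1; split; [exact: ExecIf e1 | exact: concl ev1' | by []].
- have evb := ev_holds b S.
  have [hb|hb] := boolP (holds (V := pairD tst) S b); last first.
    exists S, 1%N; split=> //; first exact: ExecWhileF.
    apply: ev_mono evb => l h s s' u ss /exec_inv.
    by rewrite (h _ ss) (negbTE hb) => -[-> ->].
  have [||S1 [t1 [e1 le1 ev1]]] := IH k.-1 p S.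
  + by rewrite -ltnS prednK.
  + apply: ev_mono (ev_and hyp evb) => l [[s [s' [u [ss /exec_inv + uk]]]] h].
    rewrite (h _ ss) hb => -[s1 [u1 [u2 [f1 f2 eu]]]].
    by exists s, s1, u1; split=> //; lia.
  have [||S2 [t2 [e2 le2 ev2]]] := IH (k - t1.+1)%N (While b p) S1.
  + by lia.
  + apply: ev_mono (ev_and (ev_and hyp evb) ev1) =>
      l [[[s [s' [u [ss /exec_inv + uk]]]] h] h1].
    rewrite (h _ ss) hb => -[s1 [u1 [u2 [f1 f2 eu]]]].
    have [ss1 eu1] := h1 _ _ _ ss f1.
    by exists s1, s', u2; split=> //; lia.
  have ev12 : ev (fun l => forall s s' u, lies_over l S s ->
      exec (min l) (While b p) s s' u -> lies_over l S2 s' /\ u = (t1 + t2).+1).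
    apply: ev_mono (ev_and evb (ev_and ev1 ev2)) => l [h [h1 h2]] s s' u ss /exec_inv.
    rewrite (h _ ss) hb => -[s1 [u1 [u2 [f1 f2 ->]]]].
    have [ss1 ->] := h1 _ _ _ ss f1; have [ss2 ->] := h2 _ _ _ ss1 f2.
    by [].
  exists S2, (t1 + t2).+1; split; [exact: ExecWhileT e1 e2|exact: concl ev12|by []].
Qed.

Lemma init_lies_over l : lies_over l (init (pairD tst)) (init (markedD R)).
Proof. by split=> //= *; split=> //=; rewrite mul0r addr0. Qed.

End Germs.
(** * Oracle calls *)

Lemma nth_mapd (T U : Type) (f : T -> U) x0 s j :
  nth (f x0) (map f s) j = f (nth x0 s j).
Proof.
have [lt|ge] := ltnP j (size s); first exact: nth_map.
by rewrite !nth_default ?size_map.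
Qed.

Lemma arrays_map (T U : Type) (f : T -> U) x0 ss a j :
  arrays (f x0) (map (map f) ss) a j = f (arrays x0 ss a j).
Proof. by rewrite /arrays -(nth_mapd f x0) -(nth_mapd (map f) [::]). Qed.

Lemma size_vec_seq n (T : Type) (u : 'cV[T]_n) : size (vec_seq u) = n.
Proof. by rewrite size_map size_enum_ord. Qed.

Lemma nth_vec_seq n (T : Type) (u : 'cV[T]_n) x0 (j : 'I_n) :
  nth x0 (vec_seq u) j = u j 0.
Proof. by rewrite (nth_map j) ?size_enum_ord ?nth_ord_enum. Qed.

Section DotProduct.
Variables (R : realType) (n : nat).
Implicit Types u v x : 'cV[R]_n.

Lemma dotDl u v x : dot (u + v) x = dot u x + dot v x.
Proof. by rewrite /dot -big_split; apply: eq_bigr => j _; rewrite mxE mulrDl. Qed.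

Lemma dotZl l u x : dot (l *: u) x = l * dot u x.
Proof. by rewrite /dot mulr_sumr; apply: eq_bigr => j _; rewrite mxE mulrA. Qed.

Lemma dotDr u v x : dot x (u + v) = dot x u + dot x v.
Proof. by rewrite /dot -big_split; apply: eq_bigr => j _; rewrite mxE mulrDr. Qed.

Lemma dotZr l u x : dot x (l *: u) = l * dot x u.
Proof. by rewrite /dot mulr_sumr; apply: eq_bigr => j _; rewrite mxE mulrCA. Qed.

Lemma dot0r x : dot x 0 = 0.
Proof. by rewrite /dot big1 // => j _; rewrite mxE mulr0. Qed.

Lemma dot_sumr (I : Type) (r : seq I) (f : I -> 'cV[R]_n) x :
  dot x (\sum_(i <- r) f i) = \sum_(i <- r) dot x (f i).
Proof.
elim: r => [|i r IH]; first by rewrite !big_nil dot0r.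
by rewrite !big_cons dotDr IH.
Qed.

End DotProduct.

Record unmarks (R : realType) (s : state (R * bool)) (r : state R) : Prop := Unmarks {
  un_i : forall i, ireg r i = ireg s i;
  un_ia : forall a j, iarr r a j = iarr s a j;
  un_r : forall i, rreg r i = (rreg s i).1;
  un_ra : forall a j, rarr r a j = (rarr s a j).1 }.

(** Marks only restrict which operations are allowed and never influence values or tests, so erasing
    them turns a marked run into a real run of the same length. *)
Lemma unmark_exec (R : realType) (minp : input (markedD R)) (inp : input (realD R)) p s s' t r :
  (forall a j, inp_i inp a j = inp_i minp a j) ->
  (forall a j, inp_r inp a j = (inp_r minp a j).1) ->
  exec minp p s s' t -> unmarks s r ->
  exists2 r', exec inp p r r' t & unmarks s' r'.
Proof.
move=> Hi Hr e; elim: e r => {p s s' t}.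
- move=> p s s' st r [ui uia ur ura].
  have updri T := @upd_rel T T eq; have updai T := @upd2_rel T T eq.
  have updr := @upd_rel R (R * bool) (fun x y => x = y.1).
  have updar := @upd2_rel R (R * bool) (fun x y => x = y.1).
  suff [r' st' u'] : exists2 r', step inp p r = Some r' & unmarks s' r'.
    by exists r' => //; apply: ExecStep.
  case: p st => //=.
  + by move=> [<-]; exists r.
  + by move=> i k [<-]; eexists; first reflexivity; split=> //=; apply: updri.
  + by move=> i j k [<-]; eexists; first reflexivity; split=> //=; apply: updri; rewrite ?ui.
  + by move=> i j k [<-]; eexists; first reflexivity; split=> //=; apply: updri; rewrite ?ui.
  + by move=> i a j [<-]; eexists; first reflexivity; split=> //=; apply: updri; rewrite ?Hi ?ui.
  + by move=> i a j [<-]; eexists; first reflexivity; split=> //=; apply: updri; rewrite ?ui ?uia.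
  + by move=> a i j [<-]; eexists; first reflexivity; split=> //=; rewrite !ui; apply: updai.
  + by move=> i k [<-]; eexists; first reflexivity; split=> //=; apply: updr.
  + move=> o i j k; case: ifP => //= _ [<-]; eexists; first reflexivity.
    by split=> //=; apply: updr; rewrite ?ur.
  + by move=> i a j [<-]; eexists; first reflexivity; split=> //=; apply: updr; rewrite ?Hr ?ui.
  + by move=> i a j [<-]; eexists; first reflexivity; split=> //=; apply: updr; rewrite ?ui ?ura.
  + by move=> a i j [<-]; eexists; first reflexivity; split=> //=; rewrite !ui; apply: updar.
- move=> p q s1 s2 s3 t u _ IH1 _ IH2 r1 /IH1[r2 e2 /IH2[r3 e3 u3]].
  by exists r3 => //; apply: ExecSeq e2 e3.
- move=> b p q s s' t _ IH r ur; have [r' e' u'] := IH _ ur; exists r' => //.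
  apply: ExecIf; suff -> : holds (V := realD R) r b = holds (V := markedD R) s b by [].
  by case: b {IH e'} => i j /=; rewrite ?(un_i ur) ?(un_r ur).
- move=> b p s h r ur; exists r => //; apply: ExecWhileF.
  by case: b h => i j /=; rewrite ?(un_i ur) ?(un_r ur).
- move=> b p s1 s2 s3 t u h _ IH1 _ IH2 r1 u1.
  have [r2 e2 /IH2[r3 e3 u3]] := IH1 _ u1.
  exists r3 => //; apply: ExecWhileT e2 e3.
  by case: b h {IH1 IH2} => i j /=; rewrite ?(un_i u1) ?(un_r u1).
Qed.

Section Oracle.
Variables (R : realType) (F : set (instance R)) (orc : cmd) (T : instance R -> nat).
Hypothesis horc : sign_oracle F orc T.
Hypothesis hcomb : strongly_combinatorial F orc.
Variables (I : instance R) (FI : F I).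

Local Notation n := (dim I).

Definition marked_input (d : 'cV[R]_n) :=
  oracle_input (V := markedD R) (fun r => (r, true)) (fun r => (r, false)) d.

Lemma marked_oracle (d : 'cV[R]_n) : exists s t (x : 'cV[R]_n),
  [/\ exec (marked_input d) orc (init (markedD R)) s t, (t <= T I)%N,
      forall j : 'I_n, (rarr s 0 j).1 = x j 0 & sign_answer (gens I) d x].
Proof.
have [s [t e]] := hcomb FI d; have [r [x [u [er uT out ans]]]] := horc FI d.
have [|||r' er' ur] := @unmark_exec R _ (oracle_input (V := realD R) id id d)
    orc _ _ _ (init (realD R)) _ _ e.
- by [].
- case=> [|a] j; rewrite /marked_input /= /arrays /= -/(arrays _ _ _ _).
    move: (vec_seq d) => v.
    have [lt|ge] := ltnP j (size v); last by rewrite !nth_default ?size_map.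
    by rewrite !(nth_map 0).
  rewrite [LHS](arrays_map id (0 : R)).
  by rewrite [X in X.1](arrays_map (fun r : R => (r, false)) (0 : R)).
- by split.
have [rr tu] := exec_det er' er.
by exists s, t, x; split=> //; [rewrite tu | move=> j; rewrite -(un_ra ur) rr out].
Qed.

Section Pairs.
Variables (tst : R -> R -> bool) (D1 D2 : nat -> R).
(** The oracle may read its direction beyond the last entry and must find the default value of
    [arrays] there. The work arrays [a_price] and [a_dir] therefore carry the same condition
    throughout. *)
Hypothesis D1_out : forall j, (n <= j)%N -> D1 j = 0.
Hypothesis D2_out : forall j, (n <= j)%N -> D2 j = 0.

Definition pair_input : input (pairD tst) :=
  Input (arrays 0%N ([:: n] :: idesc I))
    (fun a j => if a is a'.+1 then (arrays 0 (rdesc I) a' j, 0) else (D1 j, D2 j)).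

Definition vec (f : nat -> R) : 'cV[R]_n := \col_j f j.

Lemma pair_oracle (ev : (R -> Prop) -> Prop) :
  (forall P Q : R -> Prop, (forall l, P l -> Q l) -> ev P -> ev Q) ->
  (forall P Q : R -> Prop, ev P -> ev Q -> ev (fun l => P l /\ Q l)) ->
  (forall P : R -> Prop, ev P -> exists l, P l) ->
  (forall u v, ev (fun l => (u * l < v) = tst u v)) ->
  exists S t, [/\ exec pair_input orc (init (pairD tst)) S t, (t <= T I)%N &
    ev (fun l => exists2 x, sign_answer (gens I) (vec D1 + l *: vec D2) x &
      forall j : 'I_n, (rarr S 0 j).1 + (rarr S 0 j).2 * l = x j 0)].
Proof.
move=> ev_mono ev_and ev_ex ev_tst.
pose d l := vec D1 + l *: vec D2.
have on l a j : lies_on l (inp_r pair_input a j) (inp_r (marked_input (d l)) a j).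
  case: a => [|a] /=; last first.
    rewrite [X in lies_on _ _ X](arrays_map (fun r : R => (r, false)) (0 : R)).
    by split=> //=; rewrite mul0r addr0.
  rewrite /arrays /=.
  have [lt|ge] := ltnP j (size (vec_seq (d l))); last first.
    rewrite size_vec_seq in ge; rewrite nth_default ?(size_map, size_vec_seq) ?size_enum_ord //.
    by rewrite D1_out ?D2_out //; split=> //=; rewrite mul0r addr0.
  rewrite (nth_map 0) // ; split=> //=; rewrite size_vec_seq in lt.
  by rewrite (nth_vec_seq _ _ (Ordinal lt)) !mxE /= mulrC.
have [|S [t [e tT evS]]] := @germ_exec R tst ev ev_mono ev_and ev_ex ev_tst pair_input
    (fun l => marked_input (d l)) (fun _ _ _ => erefl) on (T I) orc (init (pairD tst)).
  apply: ev_mono (ev_tst 0 0) => l _; have [s [t [x [e tT _ _]]]] := marked_oracle (d l).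
  by exists (init (markedD R)), s, t; split=> //; apply: init_lies_over.
exists S, t; split=> //; apply: ev_mono evS => l h.
have [s [u [x [e' _ out ans]]]] := marked_oracle (d l).
have [ss _] := h _ _ _ (init_lies_over tst l) e'.
by exists x => // j; rewrite -out; have [-> _] := lo_ra ss 0 j.
Qed.

End Pairs.

(** The comparison [u * l < v] at the point [l = 0]. *)
Definition tst0 (u v : R) : bool := 0 < v.

Lemma plain_oracle D1 : (forall j, (n <= j)%N -> D1 j = 0) ->
  exists S t (x : 'cV[R]_n), [/\ exec (pair_input tst0 D1 (fun=> 0)) orc (init (pairD tst0)) S t,
    (t <= T I)%N, sign_answer (gens I) (vec D1) x &
    forall j : 'I_n, (rarr S 0 j).1 = x j 0].
Proof.
move=> D1_out; pose ev (P : R -> Prop) := P 0.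
have [| | | | |S [t [e tT [x ans out]]]] := @pair_oracle tst0 D1 (fun=> 0) D1_out _ ev.
- by [].
- by move=> P Q; apply.
- by [].
- by move=> P; exists 0.
- by move=> u v; rewrite /ev mulr0.
exists S, t, x; split=> //; first by move: ans; rewrite scale0r addr0.
by move=> j; rewrite -out mulr0 addr0.
Qed.

(** Just to the right of [l0], both signs of [u] reduce to the single strict question [l0 < v / u],
    which the negativity of one ordinary answer settles. At [l0] itself a negative [u] would require
    the non-strict version. *)
Definition tst_right (l0 u v : R) : bool :=
  if 0 < u then l0 < v / u else if u < 0 then ~~ (l0 < v / u) else 0 < v.

(* Only right neighbourhoods of [l0] are considered, never [l0] itself: on an
   open interval the answers of the oracle are affine in [l] and take finitely
   many values, hence are constant. *)
Lemma right_oracle D1 D2 l0 xm :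
  (forall j, (n <= j)%N -> D1 j = 0) -> (forall j, (n <= j)%N -> D2 j = 0) ->
  xm \in gens I -> dot (vec D1) xm + l0 * dot (vec D2) xm = 0 -> dot (vec D2) xm < 0 ->
  (forall x, x \in gens I -> 0 <= dot (vec D1) x + l0 * dot (vec D2) x) ->
  exists S t (x : 'cV[R]_n), [/\ exec (pair_input (tst_right l0) D1 D2) orc
                      (init (pairD (tst_right l0))) S t,
    (t <= T I)%N, x \in gens I, forall j : 'I_n, (rarr S 0 j).1 = x j 0
    & dot (vec D1) x + l0 * dot (vec D2) x = 0].
Proof.
move=> D1_out D2_out xmS xm0 xm_neg l0_min.
pose ev (P : R -> Prop) := exists2 e, 0 < e & forall l, l0 < l < l0 + e -> P l.
have [| | | |S [t [e tT [h h0 ansS]]]] :=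
    @pair_oracle (tst_right l0) D1 D2 D1_out D2_out ev.
- by move=> P Q PQ [e e0 H]; exists e => // l /H/PQ.
- move=> P Q [e e0 H] [e' e0' H']; exists (Num.min e e'); first by rewrite lt_min e0.
  move=> l; rewrite -ltrBlDl lt_min => /andP[l1 /andP[l2 l3]].
  by split; [apply: H | apply: H']; rewrite l1 -ltrBlDl.
- by move=> P [e e0 H]; exists (l0 + e / 2); apply: H; lra.
- move=> u v; rewrite /tst_right; case: (ltgtP 0 u) => [u0|u0|<-].
  + case: ltP => [lt|le].
      exists (v / u - l0); first by rewrite subr_gt0.
      move=> l /andP[_ l2]; rewrite addrC subrK in l2.
      by rewrite -ltr_pdivlMl // mulrC l2.
    exists 1 => // l /andP[l1 _]; apply/negbTE; rewrite -leNgt.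
    by rewrite -ler_pdivrMl // mulrC (le_trans le) // ltW.
  + case: ltP => [lt|le] /=.
      exists (v / u - l0); first by rewrite subr_gt0.
      move=> l /andP[_ l2]; rewrite addrC subrK in l2.
      by apply/negbTE; rewrite -leNgt -ler_ndivlMl // mulrC ltW.
    exists 1 => // l /andP[l1 _].
    by rewrite -ltr_ndivrMl // mulrC (le_lt_trans le).
  + by exists 1 => // l _; rewrite mul0r.
pose X l : 'cV[R]_n := \col_j ((rarr S 0 j).1 + (rarr S 0 j).2 * l).
have ansX l : l0 < l < l0 + h -> sign_answer (gens I) (vec D1 + l *: vec D2) (X l).
  move=> /ansS[x ans out]; suff -> : X l = x by [].
  by apply/matrixP => j k; rewrite mxE out ord1.
have Q0 (j : 'I_n) : (rarr S 0 j).2 = 0.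
  apply/eqP; apply: contraT => Qj.
  (* One sample more than there are generators. Starting the denominators at 2 keeps all samples
     strictly inside the interval. *)
  pose ls := [seq l0 + h / i.+2%:R | i <- iota 0 (size (gens I)).+1].
  have Xinj : injective X.
    move=> l l' /matrixP/(_ j 0); rewrite !mxE => /addrI; exact: mulfI.
  have lsu : uniq (map X ls).
    rewrite map_inj_uniq // map_inj_uniq ?iota_uniq // => i i' /addrI.
    by move=> /(mulfI (lt0r_neq0 h0))/invr_inj/eqP; rewrite eqr_nat => /eqP[].
  have : {subset map X ls <= gens I}.
    move=> _ /mapP[l /mapP[i _ ->] ->].
    have [] := ansX (l0 + h / i.+2%:R) => //.
    rewrite ltrDl ltrD2l divr_gt0 //= ltr_pdivrMr // ltr_pMr //.
    by rewrite ltr1n.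
  move=> /(uniq_leq_size lsu); rewrite !size_map size_iota.
  by rewrite ltnn.
pose x := X 0; have XE l : X l = x.
  by apply/matrixP => j k; rewrite !mxE Q0 !mul0r.
(* Past [l0] the generator [xm] has a negative product, so the minimum is negative and hence the
   answer as well. *)
have x_neg l : l0 < l < l0 + h ->
    x \in gens I /\ dot (vec D1) x + l * dot (vec D2) x < 0.
  move=> ll; have := ansX l ll; rewrite XE => -[xS [xmin [_ xminP /esym sgx]]].
  split=> //; rewrite -dotZl -dotDl -sgr_lt0 -sgx sgr_lt0.
  apply: le_lt_trans (xminP _ xmS) _; rewrite dotDl dotZl.
  have /andP[ll0 _] := ll.
  have : l * dot (vec D2) xm < l0 * dot (vec D2) xm by rewrite ltr_nM2r.
  by move: xm0; lra.
have [xS neg2] : x \in gens I /\ dot (vec D1) x + (l0 + h / 2) * dot (vec D2) x < 0.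
  by apply: x_neg; lra.
exists S, t, x; split=> //; first by move=> j; rewrite mxE mulr0 addr0.
apply/eqP; rewrite eq_le l0_min // andbT leNgt; apply/negP.
set g := dot (vec D1) x + _ => g0; set k := dot (vec D2) x in g neg2 g0 *.
have k0 : k < 0.
  rewrite ltNge; apply/negP => k0.
  have : 0 <= h / 2 * k by rewrite mulr_ge0 // divr_ge0 // ltW.
  by move: neg2 g0; rewrite /g mulrDl; lra.
(* The affine function with value [g] at [l0] and slope [k] vanishes at [l0 + g / (- k)]; up to
   there it cannot be negative. The other term keeps the point inside the interval. *)
pose e1 := Num.min (h / 2) (g / (- k)).
have e1_gt0 : 0 < e1 by rewrite lt_min divr_gt0 //= divr_gt0 // oppr_gt0.
have [|_] := x_neg (l0 + e1).
  rewrite ltrDl e1_gt0 ltrD2l /= (le_lt_trans (y := h / 2)) //; last by lra.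
  by rewrite ge_min lexx.
rewrite -/k mulrDl addrA -/g => /lt_geF/negP; apply.
have : e1 <= g / - k by rewrite ge_min lexx orbT.
by rewrite ler_pdivlMr ?oppr_gt0 // mulrN; lra.
Qed.

End Oracle.
(** * Multiplicative weights for packing over a cone *)

Section Cone.
Variables (R : realType) (n : nat) (S : seq 'cV[R]_n).

Lemma cone0 : cone S 0.
Proof. by exists (fun=> 0) => //; rewrite big1 // => l _; rewrite scale0r. Qed.

Lemma coneZ t x : 0 <= t -> cone S x -> cone S (t *: x).
Proof.
move=> t0 [a a0 ->]; exists (fun l => t * a l) => [l|]; first exact: mulr_ge0.
by rewrite scaler_sumr; apply: eq_bigr => l _; rewrite scalerA.
Qed.

Lemma cone_addZ t x g : 0 <= t -> cone S x -> g \in S -> cone S (x + t *: g).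
Proof.
move=> t0 [a a0 ->] gS; exists (fun l => a l + (l == index g S)%:R * t) => [l|].
  by rewrite addr_ge0 ?mulr_ge0.
under [RHS]eq_bigr do rewrite scalerDl.
rewrite big_split /=; congr (_ + _).
have iS : (index g S < size S)%N by rewrite index_mem.
rewrite (bigD1 (Ordinal iS)) //= eqxx mul1r nth_index // big1 ?addr0 // => l li.
suff -> : (l == index g S :> nat) = false by rewrite mul0r scale0r.
by apply: contraNF li => /eqP li; apply/eqP/val_inj.
Qed.

Lemma cone_dot_le d d' x : (forall g, g \in S -> dot d g <= dot d' g) ->
  cone S x -> dot d x <= dot d' x.
Proof.
move=> dd [a a0 ->]; rewrite !dot_sumr ler_sum // => l _.
by rewrite !dotZr ler_wpM2l // dd // mem_nth.
Qed.

End Cone.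

(** Follows from [(1 + u) * (1 - u + u ^+ 2) = 1 + u ^+ 3 >= 1] and [expR (- w) >= 1 - w]. It is the
    source of the factor [1 - eps] in the lower bound on the weights. *)
Lemma expR_sub_sqr_le (R : realType) (u : R) : 0 <= u -> expR (u - u ^+ 2) <= 1 + u.
Proof.
move=> u0; have E := expR_gt0 (u - u ^+ 2).
have h : 1 <= (1 + u) * expR (- (u - u ^+ 2)).
  apply: (@le_trans _ _ ((1 + u) * (1 - (u - u ^+ 2)))); last first.
    by rewrite ler_wpM2l ?expR_ge1Dx // addr_ge0.
  have : 0 <= u ^+ 3 by rewrite exprn_ge0.
  by lra.
rewrite -(ler_pM2l E) mulr1 mulrCA (mulrC (expR _)) -expRD in h.
by rewrite addNr expR0 mulr1 in h.
Qed.

Section Packing.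
Variables (R : realType) (m n : nat) (A : 'M[nat]_(m, n)) (b : 'cV[nat]_m).
Variables (c : 'cV[int]_n) (S : seq 'cV[R]_n).
Hypothesis Ab : packing_data A b.
Hypothesis S_ge0 : forall x, x \in S -> (forall j, 0 <= x j 0) /\ x != 0.

Definition load (x : 'cV[R]_n) (i : 'I_m) : R := \sum_j (A i j)%:R * x j 0.
Definition price (y : nat -> R) : 'cV[R]_n := \col_j \sum_(i < m) (A i j)%:R * y i.
Definition cvec : 'cV[R]_n := map_mx intr c.
Definition cap (i : 'I_m) : R := (b i 0)%:R.
Definition y0 (i : nat) : R := if insub i is Some i' then (cap i')^-1 else 0.

Lemma cap_gt0 i : 0 < cap i.
Proof. by rewrite ltr0n; have [_ _] := Ab; apply. Qed.

Lemma y0E (i : 'I_m) : y0 i = (cap i)^-1.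
Proof. by rewrite /y0 valK. Qed.

Lemma dot_price y x : dot (price y) x = \sum_(i < m) y i * load x i.
Proof.
rewrite /dot /load; under eq_bigr do rewrite mxE mulr_suml.
rewrite exchange_big; apply: eq_bigr => i _; rewrite mulr_sumr.
by apply: eq_bigr => j _; ring.
Qed.

Lemma loadD x x' i : load (x + x') i = load x i + load x' i.
Proof. by rewrite /load -big_split; apply: eq_bigr => j _; rewrite mxE mulrDr. Qed.

Lemma loadZ t x i : load (t *: x) i = t * load x i.
Proof. by rewrite /load mulr_sumr; apply: eq_bigr => j _; rewrite mxE mulrCA. Qed.

Lemma load0 i : load 0 i = 0.
Proof. by rewrite /load big1 // => j _; rewrite mxE mulr0. Qed.

Lemma feasibleE x : feasible A b S x <-> cone S x /\ forall i, load x i <= cap i.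
Proof.
suff E i : (map_mx (GRing.natmul 1) A *m x) i 0 = load x i.
  by split=> -[cx h]; split=> // i; have := h i; rewrite E.
by rewrite mxE; apply: eq_bigr => j _; rewrite mxE.
Qed.

Lemma load_ge0 x i : x \in S -> 0 <= load x i.
Proof. by move=> /S_ge0[x0 _]; apply: sumr_ge0 => j _; rewrite mulr_ge0. Qed.

(** Every column of [A] has a positive entry, so a generator cannot be added without limit: the step
    length of a push is finite. *)
Lemma load_gt0 x : x \in S -> exists i, 0 < load x i.
Proof.
move=> xS; have [x_ge0 xn0] := S_ge0 xS.
have [j xj] : exists j, 0 < x j 0.
  apply/existsP; apply: contraNT xn0; rewrite negb_exists => /forallP h.
  apply/eqP/matrixP => j k; rewrite ord1 mxE; apply/eqP.
  by rewrite eq_le x_ge0 leNgt h.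
have [_ /(_ j)[i Aij] _] := Ab; exists i.
rewrite /load (bigD1 j) //= ltr_pwDl ?mulr_gt0 ?ltr0n //.
by apply: sumr_ge0 => k _; rewrite mulr_ge0.
Qed.

Lemma dot_price_gt0 (y : nat -> R) x : (forall i : 'I_m, 0 < y i) -> x \in S ->
  0 < dot (price y) x.
Proof.
move=> y_gt0 xS; rewrite dot_price; have [i xi] := load_gt0 xS.
rewrite (bigD1 i) //= ltr_pwDl ?mulr_gt0 //.
by apply: sumr_ge0 => k _; rewrite mulr_ge0 ?load_ge0 // ltW.
Qed.

Lemma weak_duality (y : nat -> R) mu x : (forall i : 'I_m, 0 <= y i) ->
  (forall g, g \in S -> mu * dot cvec g <= dot (price y) g) ->
  feasible A b S x -> mu * objective c x <= \sum_(i < m) cap i * y i.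
Proof.
move=> y_ge0 dual /feasibleE[cx capx].
rewrite /objective -dotZl -/cvec.
apply: (le_trans (cone_dot_le (d' := price y) _ cx)) => [g gS|].
  by rewrite dotZl dual.
rewrite dot_price ler_sum // => i _.
by rewrite mulrC ler_wpM2r.
Qed.

Variables (eps L mu0 : R) (g0 : 'cV[R]_n).
Hypothesis eps_gt0 : 0 < eps.
(** Ensures [1 - 3 * eps >= 0] in the final comparison and [1 - eps >= 2^-1] in the count of
    raises. *)
Hypothesis eps_le : eps <= 3^-1.
Hypothesis L_ge0 : 0 <= L.
Hypothesis mu0_gt0 : 0 < mu0.
Hypothesis g0S : g0 \in S.
Hypothesis cg0_gt0 : 0 < dot cvec g0.
Hypothesis mu0P : dot (price y0) g0 = mu0 * dot cvec g0.

(* [y] are the weights, [z] the relative loads of the current point [out],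
   [mu] a lower bound on the minimum ratio [y^T A g / c^T g]; there have been
   [np] pushes and [nr] increases of [mu]. *)
Record weights_inv (np nr : nat) (y z : nat -> R) (out : 'cV[R]_n) (mu zmax : R)
    : Prop := WeightsInv {
  wi_y : forall i : 'I_m,
    expR (eps * (1 - eps) * z i) <= cap i * y i <= expR (eps * z i);
  wi_z : forall i : 'I_m, cap i * z i = load out i;
  wi_zmax : forall i : 'I_m, 0 <= z i <= zmax;
  wi_L : zmax <= L + 1;
  wi_arg : zmax = 0 \/ exists i : 'I_m, z i = zmax;
  wi_cone : cone S out;
  wi_out : 0 <= dot cvec out;
  wi_mu : mu = mu0 * (1 + eps) ^+ nr;
  wi_dual : forall g, g \in S -> mu * dot cvec g <= dot (price y) g;
  wi_np : np%:R <= \sum_(i < m) z i;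
  wi_pot : forall x, feasible A b S x -> 0 < objective c x ->
    \sum_(i < m) cap i * y i <=
      m%:R * expR (eps * (1 + eps) * (dot cvec out / objective c x)) }.

Lemma wi_y_gt0 np nr y z out mu zmax : weights_inv np nr y z out mu zmax ->
  forall i : 'I_m, 0 < y i.
Proof.
move=> w i; have /andP[h _] := wi_y w i.
have := lt_le_trans (expR_gt0 _) h; by rewrite pmulr_rgt0 ?cap_gt0.
Qed.

Lemma wi_mu_gt0 np nr y z out mu zmax : weights_inv np nr y z out mu zmax -> 0 < mu.
Proof.
move=> w; rewrite (wi_mu w) mulr_gt0 // exprn_gt0 //.
by move: eps_gt0; lra.
Qed.

Lemma weights_init (y z : nat -> R) :
  (forall i : 'I_m, y i = y0 i) -> (forall i : 'I_m, z i = 0) ->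
  (forall g, g \in S -> mu0 * dot cvec g <= dot (price y0) g) ->
  weights_inv 0 0 y z 0 mu0 0.
Proof.
move=> yE zE dual; split=> //.
- by move=> i; rewrite yE zE y0E mulfV ?gt_eqF ?cap_gt0 // !mulr0 expR0 lexx.
- by move=> i; rewrite zE mulr0 load0.
- by move=> i; rewrite zE lexx.
- by rewrite addr_ge0.
- by left.
- exact: cone0.
- by rewrite dot0r.
- by rewrite expr0 mulr1.
- move=> g /dual; rewrite !dot_price => h; apply: le_trans h _.
  by under [leRHS]eq_bigr do rewrite yE.
- by rewrite big1.
- move=> x _ _; rewrite dot0r mul0r mulr0 expR0 mulr1.
  rewrite (eq_bigr (fun=> 1)) ?sumr_const ?card_ord // => i _.
  by rewrite yE y0E mulfV ?gt_eqF ?cap_gt0.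
Qed.

Lemma weights_raise np nr y z out mu zmax : weights_inv np nr y z out mu zmax ->
  (forall g, g \in S -> mu * (1 + eps) * dot cvec g <= dot (price y) g) ->
  weights_inv np nr.+1 y z out (mu * (1 + eps)) zmax.
Proof.
by case=> *; split=> //; rewrite exprSr mulrA; congr (_ * _).
Qed.

Lemma weights_push np nr y z out mu zmax g rho zmax' (y' z' : nat -> R) :
  weights_inv np nr y z out mu zmax -> zmax < L -> g \in S ->
  dot (price y) g < mu * (1 + eps) * dot cvec g ->
  (forall i, load g i / cap i <= rho) -> (exists i, load g i / cap i = rho) ->
  (forall i : 'I_m, y' i = y i * (1 + eps * (load g i / cap i / rho))) ->
  (forall i : 'I_m, z' i = z i + load g i / cap i / rho) ->
  (forall i : 'I_m, z' i <= zmax') -> (exists i : 'I_m, z' i = zmax') ->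
  0 < rho /\ weights_inv np.+1 nr y' z' (out + rho^-1 *: g) mu zmax'.
Proof.
move=> w zL gS g_cheap rho_ge [im rho_im] y'E z'E z'_le [jm z'_jm].
have rho_gt0 : 0 < rho.
  have [i gi] := load_gt0 gS; apply: lt_le_trans (rho_ge i).
  by rewrite divr_gt0 ?cap_gt0.
split=> //.
pose dl i := load g i / cap i / rho.
have dl_ge0 i : 0 <= dl i by rewrite !divr_ge0 ?load_ge0 // ltW ?cap_gt0.
have dl_le1 i : dl i <= 1 by rewrite ler_pdivrMr // mul1r.
have mu_gt0 := wi_mu_gt0 w; have y_gt0 := wi_y_gt0 w.
have cg_gt0 : 0 < dot cvec g.
  have := lt_trans (dot_price_gt0 y_gt0 gS) g_cheap.
  by rewrite pmulr_rgt0 // mulr_gt0 //; move: eps_gt0; lra.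
have y_le_y' (i : 'I_m) : y i <= y' i.
  rewrite y'E -/(dl i) ler_peMr ?(ltW (y_gt0 i)) // lerDl.
  by rewrite mulr_ge0 ?dl_ge0 // ltW.
have ioutE : dot cvec (out + rho^-1 *: g) = dot cvec out + rho^-1 * dot cvec g.
  by rewrite dotDr dotZr.
split.
- move=> i; have /andP[h1 h2] := wi_y w i; rewrite y'E z'E -/(dl i) mulrA.
  rewrite (mulrDr (eps * (1 - eps))) (mulrDr eps (z i)) !expRD.
  have capy : 0 <= cap i * y i by rewrite mulr_ge0 // ltW ?cap_gt0.
  apply/andP; split; apply: ler_pM; rewrite ?expR_ge0 //; last first.
  + exact: expR_ge1Dx.
  + by rewrite addr_ge0 // mulr_ge0 // ltW.
  have u0 : 0 <= eps * dl i by rewrite mulr_ge0 // ltW.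
  apply: le_trans (expR_sub_sqr_le u0); rewrite ler_expR exprMn.
  (* Since [dl i <= 1], the quadratic loss is dominated by a linear one, and the exponent stays a
     multiple of the accumulated load. *)
  have : eps ^+ 2 * dl i ^+ 2 <= eps ^+ 2 * dl i.
    by rewrite ler_wpM2l ?sqr_ge0 // expr2 ler_piMr.
  by rewrite mulrBr mulr1 mulrBl -expr2; lra.
- move=> i; rewrite z'E mulrDr (wi_z w) loadD loadZ; congr (_ + _).
  rewrite mulrA (mulrC (load g i)) mulrA mulfV ?gt_eqF ?cap_gt0 //.
  by rewrite mul1r mulrC.
- move=> i; rewrite z'_le andbT z'E -/(dl i) addr_ge0 ?dl_ge0 //.
  by have /andP[] := wi_zmax w i.
- rewrite -z'_jm z'E -/(dl jm) lerD ?dl_le1 //.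
  by have /andP[_ h] := wi_zmax w jm; apply: le_trans h (ltW zL).
- by right; exists jm.
- by apply: cone_addZ => //; [rewrite invr_ge0 ltW | exact: wi_cone w].
- by rewrite ioutE addr_ge0 ?(wi_out w) // mulr_ge0 ?invr_ge0 // ltW.
- exact: wi_mu w.
- move=> h hS; apply: le_trans (wi_dual w hS) _; rewrite !dot_price ler_sum // => i _.
  by rewrite ler_wpM2r ?load_ge0.
- under eq_bigr do rewrite z'E; rewrite big_split /= -natr1 lerD ?(wi_np w) //.
  rewrite (bigD1 im) //= rho_im divff ?gt_eqF // lerDl sumr_ge0 // => i _.
  exact: dl_ge0.
(* An arbitrary feasible point of positive value stands in for the optimum, so the argument never
   uses that the optimum is attained. *)
move=> x fx vx; have pot := wi_pot w fx vx.
set V := objective c x in vx pot *.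
set Phi := \sum_(i < m) _ in pot.
have muV : mu * V <= Phi.
  by apply: weak_duality => //; [move=> i; apply: ltW | exact: wi_dual w].
have Phi' : \sum_(i < m) cap i * y' i = Phi + eps * (rho^-1 * dot (price y) g).
  rewrite dot_price !mulr_sumr -big_split; apply: eq_bigr => i _ /=.
  rewrite y'E; have := cap_gt0 i; move: rho_gt0 => *.
  by field; rewrite !gt_eqF.
(* By weak duality [mu <= Phi / V], so a cheap generator raises the potential by at most the factor
   [1 + eps * (1 + eps) * gain / V], where [gain] is the increase of the objective. *)
have step : eps * (rho^-1 * dot (price y) g) <=
    Phi * (eps * (1 + eps) * (rho^-1 * dot cvec g / V)).
  have h1 : mu <= Phi / V by rewrite ler_pdivlMr.
  have h2 : dot (price y) g <= Phi / V * (1 + eps) * dot cvec g.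
    apply: le_trans (ltW g_cheap) _; rewrite ler_pM2r // ler_pM2r //.
    by move: eps_gt0; lra.
  apply: (@le_trans _ _ (eps * (rho^-1 * (Phi / V * (1 + eps) * dot cvec g)))).
    by rewrite ler_pM2l // ler_pM2l ?invr_gt0.
  by rewrite le_eqVlt; apply/orP; left; apply/eqP; ring.
have Phi_ge0 : 0 <= Phi.
  by apply: sumr_ge0 => i _; rewrite mulr_ge0 ?ltW ?cap_gt0.
rewrite Phi' ioutE mulrDl mulrDr expRD mulrA.
apply: (@le_trans _ _ (Phi * expR (eps * (1 + eps) * (rho^-1 * dot cvec g / V)))).
  apply: (@le_trans _ _ (Phi * (1 + eps * (1 + eps) * (rho^-1 * dot cvec g / V)))).
    by rewrite mulrDr mulr1 lerD2l.
  by rewrite ler_wpM2l // expR_ge1Dx.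
by rewrite ler_wpM2r ?expR_ge0.
Qed.

(** Pushes give the summand [m], raises the summand 2: [mu] stays below the ratio of [g0], which
    grows at most by [expR (eps * (L + 1))], while each raise contributes at least
    [expR (eps * (1 - eps))] with [1 - eps >= 2^-1]. *)
Lemma weights_count np nr y z out mu zmax : weights_inv np nr y z out mu zmax ->
  (np + nr)%:R <= (m%:R + 2) * (L + 1).
Proof.
move=> w; rewrite natrD mulrDl lerD //.
  apply: le_trans (wi_np w) _.
  apply: (@le_trans _ _ (\sum_(i < m) (L + 1))); last first.
    by rewrite sumr_const card_ord mulr_natl.
  apply: ler_sum => i _; have /andP[_ h] := wi_zmax w i.
  exact: le_trans h (wi_L w).
have grow : (1 + eps) ^+ nr <= expR (eps * (L + 1)).
  have := wi_dual w g0S; rewrite (wi_mu w) => h.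
  rewrite -(ler_pM2l (mulr_gt0 mu0_gt0 cg0_gt0)).
  have -> : mu0 * dot cvec g0 * (1 + eps) ^+ nr =
      mu0 * (1 + eps) ^+ nr * dot cvec g0 by ring.
  apply: le_trans h _; rewrite -mu0P !dot_price mulr_suml ler_sum // => i _.
  rewrite mulrAC ler_wpM2r ?load_ge0 // y0E ler_pdivlMl ?cap_gt0 //.
  have /andP[_ h] := wi_y w i; apply: le_trans h _; rewrite ler_expR ler_pM2l //.
  by have /andP[_ h] := wi_zmax w i; apply: le_trans h (wi_L w).
have low : expR (nr%:R * (eps - eps ^+ 2)) <= (1 + eps) ^+ nr.
  rewrite expRM_natl; apply: lerXn2r; rewrite ?nnegrE ?expR_ge0 //.
    by move: eps_gt0; lra.
  by apply: expR_sub_sqr_le; apply: ltW.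
have := le_trans low grow; rewrite ler_expR.
have -> : nr%:R * (eps - eps ^+ 2) = eps * (nr%:R * (1 - eps)) by ring.
rewrite ler_pM2l // => h.
have : nr%:R * 2^-1 <= nr%:R * (1 - eps).
  by rewrite ler_wpM2l //; move: eps_le; lra.
by move: h; lra.
Qed.

(** The most loaded row alone bounds the potential from below. Comparing exponents gives [(1 - 2 *
    eps) * zmax <= (1 + eps) * value / V], and [(1 + eps) * (1 - 3 * eps) <= 1 - 2 * eps]. The
    summand 1 in [L] keeps the divisor [zmax] positive when [k = 0]. *)
Lemma weights_final np nr y z out mu zmax k : weights_inv np nr y z out mu zmax ->
  L = k%:R / eps / eps + 1 -> (m <= 2 ^ k)%N -> L <= zmax ->
  feasible A b S (zmax^-1 *: out) /\
  forall x, feasible A b S x ->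
    (1 - 3 * eps) * objective c x <= objective c (zmax^-1 *: out).
Proof.
move=> w LE mk Lz.
have L1 : 1 <= L.
  by rewrite LE lerDr !divr_ge0 // ltW.
have z0 : 0 < zmax by apply: lt_le_trans Lz; apply: lt_le_trans L1.
split.
  apply/feasibleE; split; first by apply: coneZ (wi_cone w); rewrite invr_ge0 ltW.
  move=> i; rewrite loadZ -(wi_z w) mulrCA ler_piMr ?(ltW (cap_gt0 i)) //.
  by rewrite ler_pdivrMl // mulr1; have /andP[] := wi_zmax w i.
move=> x fx; set V := objective c x.
rewrite /objective -/cvec dotZr.
have [V0|V0] := leP V 0.
  apply: (@le_trans _ _ 0).
    by rewrite mulr_ge0_le0 //; move: eps_le; lra.
  by rewrite mulr_ge0 ?(wi_out w) // invr_ge0 ltW.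
have pot := wi_pot w fx V0; rewrite -/V in pot.
have [zz|[i zi]] := wi_arg w; first by move: z0; rewrite zz ltxx.
have e1 : expR (eps * (1 - eps) * zmax) <=
    expR (k%:R + eps * (1 + eps) * (dot cvec out / V)).
  have /andP[h _] := wi_y w i; rewrite zi in h; apply: le_trans h _.
  apply: (@le_trans _ _ (\sum_(i < m) cap i * y i)).
    rewrite (bigD1 i) //= lerDl sumr_ge0 // => j _.
    by rewrite mulr_ge0 ?ltW ?cap_gt0 ?(wi_y_gt0 w).
  apply: le_trans pot _; rewrite expRD ler_wpM2r ?expR_ge0 //.
  (* [m <= 2 ^ k <= expR k], because [2 <= expR 1]. *)
  rewrite -[k%:R]mulr1 expRM_natl; apply: (@le_trans _ _ (2 ^+ k)).
    by rewrite -natrX ler_nat.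
  apply: lerXn2r; rewrite ?nnegrE ?expR_ge0 //.
  by apply: le_trans (expR_ge1Dx _); lra.
rewrite ler_expR in e1.
(* This is what the stopping level is chosen for: the initial potential costs only an [eps] fraction
   of the exponent. *)
have kz : k%:R <= eps ^+ 2 * zmax.
  have : k%:R / eps / eps <= zmax by apply: le_trans Lz; rewrite LE lerDl.
  by rewrite -mulrA -invfM ler_pdivrMr ?mulr_gt0 // mulrC expr2.
have e2 : (1 - 2 * eps) * zmax <= (1 + eps) * (dot cvec out / V).
  rewrite -(ler_pM2l eps_gt0); move: e1 kz; rewrite expr2; lra.
rewrite mulrA ler_pdivlMr // in e2; rewrite ler_pdivlMl //.
have e1_gt0 : 0 < 1 + eps by move: eps_gt0; lra.
rewrite -(ler_pM2l e1_gt0); apply: le_trans e2.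
have zV : 0 <= zmax * V by rewrite mulr_ge0 // ltW.
have -> : (1 + eps) * (zmax * ((1 - 3 * eps) * V)) =
    ((1 + eps) * (1 - 3 * eps)) * (zmax * V) by ring.
rewrite -[leRHS]mulrA ler_wpM2r //.
by have := sqr_ge0 eps; lra.
Qed.

End Packing.
(** * The packing algorithm *)

Definition i_m := 9%N.
Definition i_N := 12%N.
Definition i_k := 15%N.
Definition i_t := 18%N.
Definition i_s := 21%N.
Definition i_res := 24%N.
Definition i_pw := 27%N.

Definition r_one := 3%N.
Definition r_eps := 6%N.
Definition r_th := 9%N.
Definition r_dx := 12%N.
Definition r_a := 15%N.
Definition r_b := 18%N.
Definition r_c := 21%N.
Definition r_mu := 24%N.
Definition r_rho := 27%N.
Definition r_zmax := 30%N.
Definition r_L := 33%N.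
Definition r_e1 := 36%N.

(* [a_zero] is never written. *)
Definition a_out := 0%N.
Definition a_price := 3%N.
Definition a_negc := 6%N.
Definition a_dir := 9%N.
Definition a_zero := 12%N.
Definition a_gen := 15%N.
Definition a_y := 18%N.
Definition a_z := 21%N.
Definition a_load := 24%N.

Definition loop bnd body := For i_k bnd i_one body.

Definition direction_loop := loop i_n (blk
  [:: RLoad r_a a_price i_k; RLoad r_b a_negc i_k; RArith Mul r_b r_b r_th;
      RArith Add r_a r_a r_b; RStore a_dir i_k r_a]).

Definition copy_loop o := loop i_n (blk
  [:: IAdd i_t (base o) i_k; RLoad r_a (pa o 0) i_t; RStore a_gen i_k r_a]).

Definition dot_loop := loop i_n (blk
  [:: RLoad r_a a_dir i_k; RLoad r_b a_gen i_k; RArith Mul r_a r_a r_b;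
      RArith Add r_dx r_dx r_a]).

Definition set_flag t i := If t (blk [:: ILit i 1]) (blk [:: ILit i 0]).

(* Calls the oracle on [price - th * c], leaves its answer in [a_gen], and
   [I[i_res] = 1] iff the answer has a negative product with this direction. *)
Definition ask B orc :=
  Seq direction_loop (Seq (call 1 a_dir a_zero (set_flag (RLt 0 (dv 1)) (flag 1)) B orc)
    (Seq (copy_loop 1) (Seq (blk [:: RLit r_dx 0]) (Seq dot_loop
      (set_flag (RLt r_dx 0) i_res))))).

(* Decides whether the minimum ratio is less than [V[dv 2] / V[du 2]]. *)
Definition ask_quotient B orc :=
  Seq (blk [:: RArith Div r_th (dv 2) (du 2)])
      (If (RLt 0 r_th) (ask B orc) (blk [:: ILit i_res 0])).

Definition compare_right B orc :=
  If (RLt 0 (du 2))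
    (Seq (ask_quotient B orc) (blk [:: IAdd (flag 2) i_res 0]))
    (If (RLt (du 2) 0)
      (Seq (ask_quotient B orc) (blk [:: ISub (flag 2) i_one i_res]))
      (set_flag (RLt 0 (dv 2)) (flag 2))).

Definition min_ratio_call B orc :=
  Seq (call 2 a_price a_negc (compare_right B orc) B orc) (copy_loop 2).

Definition price_loops :=
  Seq (loop i_n (blk [:: RStore a_price i_k 0]))
    (loop i_N (blk [:: IInp i_t 1 i_k; IInp i_s 2 i_k; RInp r_a 0 i_k;
      RLoad r_b a_y i_t; RArith Mul r_a r_a r_b; RLoad r_b a_price i_s;
      RArith Add r_b r_b r_a; RStore a_price i_s r_b])).

Definition load_loops :=
  Seq (loop i_m (blk [:: RStore a_load i_k 0]))
    (loop i_N (blk [:: IInp i_t 1 i_k; IInp i_s 2 i_k; RInp r_a 0 i_k;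
      RLoad r_b a_gen i_s; RArith Mul r_a r_a r_b; RLoad r_b a_load i_t;
      RArith Add r_b r_b r_a; RStore a_load i_t r_b])).

Definition update_max i j := If (RLt i j) (blk [:: RArith Add i j 0]) Skip.

Definition ratio_code :=
  Seq (blk [:: RLit r_rho 0]) (loop i_m (Seq
    (blk [:: RLoad r_a a_load i_k; RInp r_b 1 i_k; RArith Div r_a r_a r_b;
             RStore a_load i_k r_a])
    (update_max r_rho r_a))).

Definition weight_loop := loop i_m (Seq
  (blk [:: RLoad r_a a_load i_k; RArith Div r_a r_a r_rho;
           RLoad r_b a_z i_k; RArith Add r_b r_b r_a; RStore a_z i_k r_b;
           RArith Mul r_a r_eps r_a; RArith Add r_a r_one r_a;
           RLoad r_c a_y i_k; RArith Mul r_c r_c r_a; RStore a_y i_k r_c])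
  (update_max r_zmax r_b)).

Definition out_loop := loop i_n (blk
  [:: RLoad r_a a_gen i_k; RArith Div r_a r_a r_rho; RLoad r_b a_out i_k;
      RArith Add r_b r_b r_a; RStore a_out i_k r_b]).

Definition push :=
  Seq load_loops (Seq ratio_code (Seq weight_loop (Seq out_loop price_loops))).

Definition main_body B orc :=
  Seq (blk [:: RArith Mul r_th r_mu r_e1]) (Seq (ask B orc)
    (If (ILt 0 i_res) push (blk [:: RArith Mul r_mu r_mu r_e1]))).

Definition scale_loop := loop i_n (blk
  [:: RLoad r_a a_out i_k; RArith Div r_a r_a r_zmax; RStore a_out i_k r_a]).

Definition mu_code :=
  Seq (blk [:: RLit r_dx 0; RLit r_c 0]) (Seq (loop i_n (blk
    [:: RLoad r_a a_price i_k; RLoad r_b a_gen i_k; RArith Mul r_a r_a r_b;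
        RArith Add r_c r_c r_a; RLoad r_a a_negc i_k; RArith Mul r_a r_a r_b;
        RArith Add r_dx r_dx r_a]))
    (blk [:: RArith Div r_mu r_c r_dx; RArith Sub r_mu 0 r_mu])).

(** The machine has no logarithm and cannot turn a natural number into a value, so the exponent is
    counted in a value register while a natural register doubles up to [m]. *)
Definition level_code :=
  Seq (blk [:: ILit i_pw 1; RLit r_L 0])
    (Seq (While (ILt i_pw i_m)
            (blk [:: IAdd i_pw i_pw i_pw; RArith Add r_L r_L r_one]))
      (blk [:: RArith Div r_L r_L r_eps; RArith Div r_L r_L r_eps;
               RArith Add r_L r_L r_one])).

Definition setup_code :=
  Seq (blk [:: ILit i_one 1; IInp i_m 0 0; IInp i_n 0 i_one; ILit i_t 2;
      IInp i_N 0 i_t; RLit r_one 1; RInp r_eps 3 0; RLit r_a 3;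
      RArith Div r_eps r_eps r_a; RArith Add r_e1 r_one r_eps])
    (loop i_n (blk [:: RInp r_a 2 i_k; RArith Sub r_a 0 r_a; RStore a_negc i_k r_a])).

Definition weight_init_loop := loop i_m (blk
  [:: RInp r_a 1 i_k; RArith Div r_a r_one r_a; RStore a_y i_k r_a]).

(** The first [ask] takes place while [a_price] is still zero, hence in direction [- c]. If its
    answer is not negative, no generator has positive objective and the zero vector already present
    in [a_out] is optimal. *)
Definition packing_code B orc :=
  Seq setup_code (Seq weight_init_loop (Seq (blk [:: RLit r_th 1]) (Seq (ask B orc)
    (If (ILt 0 i_res)
      (Seq price_loops (Seq (min_ratio_call B orc) (Seq mu_code (Seq level_code
        (Seq (While (RLt r_zmax r_L) (main_body B orc)) scale_loop)))))
      Skip)))).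

Section Data.
Variables (R : realType) (I : instance R) (m : nat) (A : 'M[nat]_(m, dim I)).
Variables (b : 'cV[nat]_m) (c : 'cV[int]_(dim I)) (eps : R).

Local Notation n := (dim I).
Local Notation N := (nnz A).
Local Notation inp := (packing_input A b c eps).
Local Notation row e := (inp_i inp 1 e).
Local Notation col e := (inp_i inp 2 e).
Local Notation entry e := (inp_r inp 0 e).

Lemma nnzE : N = size (enum (support A)).
Proof. exact: cardE. Qed.

Lemma big_entries (H : nat -> R) (G : 'I_m * 'I_n -> R) :
  (forall (e : 'I_m * 'I_n) k, (k < N)%N -> row k = e.1 -> col k = e.2 ->
     entry k = (A e.1 e.2)%:R -> H k = G e) ->
  (forall e, A e.1 e.2 = 0%N -> G e = 0) ->
  \sum_(k < N) H k = \sum_e G e.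
Proof.
move=> HG G0; transitivity (\sum_(e in support A) G e); last first.
  rewrite big_mkcond; apply: eq_bigr => e _; case: ifP => // /negbT.
  by rewrite inE negbK => /eqP/G0.
rewrite nnzE -[RHS]big_enum [RHS]big_tnth /=.
apply: eq_bigr => k _; set e := tnth _ _.
have eE : nth e (enum (support A)) k = e by rewrite {2}/e (tnth_nth e).
by apply: HG; rewrite ?nnzE //= /arrays /= (nth_map e) // eE.
Qed.

Lemma col_lt k : (k < N)%N -> (col k < n)%N.
Proof.
rewrite nnzE => kN; rewrite /= /arrays /=.
case: (enum (support A)) kN => // e l kN.
by rewrite (nth_map e).
Qed.

Lemma col_entries (y : nat -> R) (j : 'I_n) :
  \sum_(k < N) (if col k == j then entry k * y (row k) else 0) =
  \sum_(i < m) (A i j)%:R * y i.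
Proof.
rewrite (@big_entries (fun k => if col k == j then entry k * y (row k) else 0)
  (fun e => if e.2 == j then (A e.1 e.2)%:R * y e.1 else 0)).
- rewrite -(pair_big xpredT xpredT
    (fun i j' => if j' == j then (A i j')%:R * y i else 0)) /=.
  by apply: eq_bigr => i _; rewrite -big_mkcond big_pred1_eq.
- by move=> e k _ -> -> ->.
- by move=> e ->; rewrite mul0r if_same.
Qed.

Lemma row_entries (x : nat -> R) (i : 'I_m) :
  \sum_(k < N) (if row k == i then entry k * x (col k) else 0) =
  \sum_(j < n) (A i j)%:R * x j.
Proof.
rewrite (@big_entries (fun k => if row k == i then entry k * x (col k) else 0)
  (fun e => if e.1 == i then (A e.1 e.2)%:R * x e.2 else 0)).
- rewrite -(pair_big xpredT xpredT
    (fun i' j => if i' == i then (A i' j)%:R * x j else 0)) /= exchange_big.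
  by apply: eq_bigr => j _; rewrite -big_mkcond big_pred1_eq.
- by move=> e k _ -> -> ->.
- by move=> e ->; rewrite mul0r if_same.
Qed.

Lemma inp_cap (i : 'I_m) : inp_r inp 1 i = cap R b i.
Proof. by rewrite /= /arrays /= (nth_map 0%N) ?size_vec_seq // nth_vec_seq. Qed.

Lemma inp_cvec (j : 'I_n) : inp_r inp 2 j = cvec R c j 0.
Proof. by rewrite /= /arrays /= (nth_map 0) ?size_vec_seq // nth_vec_seq mxE. Qed.

(** The support projects onto all rows and onto all columns. Loops over rows or columns are thereby
    charged to [N]. *)
Lemma dims_le_nnz : packing_data A b -> (m <= N)%N /\ (n <= N)%N.
Proof.
case=> rowA colA _; split.
  rewrite -[X in (X <= _)%N](card_ord m) -cardsT.
  suff -> : [set: 'I_m] = [set e.1 | e in support A] by exact: leq_imset_card.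
  apply/setP => i; rewrite inE; apply/esym/imsetP.
  by have [j Aij] := rowA i; exists (i, j); rewrite // inE -lt0n.
rewrite -[X in (X <= _)%N](card_ord n) -cardsT.
suff -> : [set: 'I_n] = [set e.2 | e in support A] by exact: leq_imset_card.
apply/setP => j; rewrite inE; apply/esym/imsetP.
by have [i Aij] := colA j; exists (i, j); rewrite // inE -lt0n.
Qed.

Lemma nnz_le : (N <= m * n)%N.
Proof. by apply: leq_trans (max_card _) _; rewrite card_prod !card_ord. Qed.

End Data.

Arguments packing_input : simpl never.

(** * Frame manipulations and numerical estimates *)

Lemma writes_inP fi fr fia fra p : writes_in fi fr fia fra p ->
  [/\ forall i, writes_ireg p i -> fi i, forall i, writes_rreg p i -> fr i,
      forall i, writes_iarr p i -> fia i & forall i, writes_rarr p i -> fra i].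
Proof.
elim: p => //=; try by move=> *; split=> // j /eqP->.
- move=> p IHp q IHq /andP[/IHp[a1 a2 a3 a4] /IHq[b1 b2 b3 b4]].
  by split=> i /orP[]; auto.
- move=> b p IHp q IHq /andP[/IHp[a1 a2 a3 a4] /IHq[b1 b2 b3 b4]].
  by split=> i /orP[]; auto.
Qed.

Lemma same_outside_sub (V : Type) (fi fr fia fra gi gr gia gra : pred nat)
    (s s' : state V) :
  (forall i, fi i -> gi i) -> (forall i, fr i -> gr i) ->
  (forall i, fia i -> gia i) -> (forall i, fra i -> gra i) ->
  same_outside fi fr fia fra s s' -> same_outside gi gr gia gra s s'.
Proof.
move=> hi hr hia hra [f1 f2 f3 f4]; split=> i h.
- by apply: f1; apply: contraNN h; apply: hi.
- by apply: f2; apply: contraNN h; apply: hr.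
- by apply: f3; apply: contraNN h; apply: hia.
- by apply: f4; apply: contraNN h; apply: hra.
Qed.

Lemma writes_in_mono (fi fr fia fra gi gr gia gra : pred nat) p :
  (forall i, fi i -> gi i) -> (forall i, fr i -> gr i) ->
  (forall i, fia i -> gia i) -> (forall i, fra i -> gra i) ->
  writes_in fi fr fia fra p -> writes_in gi gr gia gra p.
Proof.
by move=> hi hr hia hra /writes_inP[w1 w2 w3 w4]; apply: writes_in_sub; auto.
Qed.

Lemma updE (V : Type) (f : nat -> V) i v : upd f i v i = v.
Proof. by rewrite /upd eqxx. Qed.

Lemma exists_argmin (R : realType) (X : eqType) (P : pred X) (f : X -> R) (l : seq X) x :
  x \in l -> P x ->
  exists2 xm, xm \in l /\ P xm & forall z, z \in l -> P z -> f xm <= f z.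
Proof.
elim: l x => // a l IH x xl Px.
have [/hasP[x' x'l Px']|/hasPn nP] := boolP (has P l); last first.
  move: xl; rewrite inE => /orP[/eqP xa|/nP]; last by rewrite Px.
  exists a; first by rewrite inE eqxx -xa.
  by move=> z; rewrite inE => /orP[/eqP->//|/nP/negP].
have [xm [xml Pxm] xm_min] := IH _ x'l Px'.
have [/andP[Pa le]|h] := boolP (P a && (f a <= f xm)).
  exists a; first by rewrite inE eqxx.
  move=> z; rewrite inE => /orP[/eqP->//|zl Pz].
  exact: le_trans le (xm_min _ zl Pz).
exists xm; first by rewrite inE xml orbT.
move=> z; rewrite inE => /orP[/eqP->|/xm_min h']; last exact: h'.
by move=> Pa; move: h; rewrite Pa /= -ltNge => /ltW.
Qed.

(** Invert [expR (- 2^-1) >= 1 - 2^-1]. *)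
Lemma ln2_ge (R : realType) : 2^-1 <= ln 2 :> R.
Proof.
rewrite -[X in X <= _]expRK ler_ln ?posrE ?expR_gt0 //.
have := expR_ge1Dx (- 2^-1 : R); rewrite expRN => h.
have e0 := expR_gt0 (2^-1 : R).
rewrite -[X in X <= _]invrK invf_ple ?posrE ?invr_gt0 //.
by apply: le_trans h; lra.
Qed.

(** Here [tt] is the oracle time, [Br] the number of oracle registers, [Kr] the number of rounds,
    [a] the cost of one [ask] and [bt] that of one round. [nr <= ka * tt] is the lower bound on the
    oracle time. *)
Lemma time_poly_le (R : realType) (ka Br tt Nr Kr nr mr a bt : R) :
  0 <= ka -> 0 <= Br -> 1 <= tt -> 0 <= Kr -> 0 <= nr -> 0 <= mr ->
  nr <= Nr -> mr <= Nr -> nr <= ka * tt ->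
  a = 21 * nr + 4 * Br + 10 * tt + 13 ->
  bt = 20 + a + 30 * mr + 12 * nr + 22 * Nr ->
  45 + 32 * nr + 10 * mr + 11 * Nr + a + 4 * Br + (14 + a) * tt + Kr * bt <=
  (27 * ka + 8 * Br + 300) * ((1 + Kr) * (Nr + tt) + tt ^+ 2).
Proof.
move=> ka0 B0 T1 K0 n0 m0 nN mN nT aE btE.
have T0 : 0 <= tt by lra.
have N0 : 0 <= Nr by lra.
pose Ca := 21 * ka + 4 * Br + 23.
have BT : Br <= Br * tt by rewrite ler_peMr.
have h1 : a <= Ca * tt by rewrite /Ca; lra.
have h2 : a * tt <= Ca * tt * tt by rewrite ler_wpM2r.
have kN : 0 <= ka * Nr by rewrite mulr_ge0.
have BN : 0 <= Br * Nr by rewrite mulr_ge0.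
have kT : 0 <= ka * tt by rewrite mulr_ge0.
have BT0 : 0 <= Br * tt by rewrite mulr_ge0.
have h3 : bt <= (Ca + 64) * (Nr + tt) by move: h1; rewrite btE /Ca; lra.
have h4 : Kr * bt <= Kr * ((Ca + 64) * (Nr + tt)) by rewrite ler_wpM2l.
have tt2 : tt <= tt * tt by rewrite ler_peMr.
(* Signs of the monomials, which [lra] treats as atoms. *)
have := (mulr_ge0 K0 kN, mulr_ge0 K0 kT, mulr_ge0 K0 BN, mulr_ge0 K0 BT0,
  mulr_ge0 K0 N0, mulr_ge0 K0 T0, mulr_ge0 kT T0, mulr_ge0 BT0 T0).
move=> [[[[[[[? ?] ?] ?] ?] ?] ?] ?].
by move: h1 h2 h4; rewrite /Ca; lra.
Qed.

(** * Correctness of the packing program on one instance *)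

Section Run.
Variables (R : realType) (F : set (instance R)) (orc : cmd) (T : instance R -> nat).
Hypothesis hS : forall I, F I -> nonneg_nonzero I.
Hypothesis horc : sign_oracle F orc T.
Hypothesis hcomb : strongly_combinatorial F orc.
Variables (B : nat) (orcB : regs_below B orc).
Variables (I : instance R) (FI : F I) (m : nat) (A : 'M[nat]_(m, dim I)).
Variables (b : 'cV[nat]_m) (c : 'cV[int]_(dim I)) (eps : R).
Hypothesis Ab : packing_data A b.
Hypothesis eps01 : 0 < eps < 1.

Local Notation n := (dim I).
Local Notation N := (nnz A).
Local Notation S := (gens I).
Local Notation inp := (packing_input A b c eps : input (realD R)).
Local Notation vec := (@vec R I).

Local Notation seti := (@set_ireg (realD R)).

Definition negc (j : nat) : R := - inp_r inp 2 j.

Lemma negc_out j : (n <= j)%N -> negc j = 0.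
Proof.
by move=> nj; rewrite /negc /packing_input /= /arrays /= nth_default ?oppr0 // size_map size_vec_seq.
Qed.

Lemma vec_negc : vec negc = - cvec R c.
Proof. by apply/matrixP => j k; rewrite !mxE ord1 /negc inp_cvec !mxE. Qed.

(** Facts established by the setup and preserved from then on. Copy 1 is called repeatedly, so its
    freshness belongs here; copy 2 is called once, and its freshness is carried up to that call by
    [wp_fresh2]. *)
Record core (s : state R) : Prop := Core {
  co_zero : ireg s 0 = 0%N;
  co_one : ireg s i_one = 1%N;
  co_n : ireg s i_n = n;
  co_m : ireg s i_m = m;
  co_N : ireg s i_N = N;
  co_rzero : rreg s 0 = 0;
  co_rone : rreg s r_one = 1;
  co_eps : rreg s r_eps = eps / 3;
  co_e1 : rreg s r_e1 = 1 + eps / 3;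
  co_azero : forall j, rarr s a_zero j = 0;
  co_negc : forall j, rarr s a_negc j = negc j;
  co_fresh : fresh 1 s }.

Definition nc_i : pred nat :=
  fun i => (i %% 3 != 1)%N && (i \notin [:: 0; i_one; i_n; i_m; i_N])%N.
Definition nc_r : pred nat :=
  fun i => (i %% 3 != 1)%N && (i \notin [:: 0; r_one; r_eps; r_e1])%N.
Definition nc_ia : pred nat := fun i => (i %% 3 != 1)%N.
Definition nc_ra : pred nat :=
  fun i => (i %% 3 != 1)%N && (i \notin [:: a_zero; a_negc])%N.

Local Notation core_safe := (writes_in nc_i nc_r nc_ia nc_ra).

Lemma fresh1_same s s' : ireg s' (hi 1) = ireg s (hi 1) ->
  (forall a, iarr s' (ia 1 a) = iarr s (ia 1 a)) ->
  (forall a, rarr s' (pa 1 a) = rarr s (pa 1 a)) ->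
  (forall a, rarr s' (qa 1 a) = rarr s (qa 1 a)) ->
  fresh (R := R) 1 s -> fresh 1 s'.
Proof. by move=> e1 e2 e3 e4 f a j; rewrite e1 e2 e3 e4; apply: f. Qed.

Lemma core_same s s' : same_outside nc_i nc_r nc_ia nc_ra s s' -> core s -> core s'.
Proof.
move=> [f1 f2 f3 f4] cs; constructor; rewrite ?f1 ?f2 //; try by case: cs.
- by move=> j; rewrite f4 // (co_azero cs).
- by move=> j; rewrite f4 // (co_negc cs).
apply: fresh1_same (co_fresh cs); rewrite ?f1 // => a; rewrite ?f3 ?f4 // /nc_ia /nc_ra.
all: by rewrite class_modE.
Qed.

Lemma core_frame p s s' : core_safe p -> frame p s s' -> core s -> core s'.
Proof.
move=> /writes_inP[w1 w2 w3 w4] fr; apply: core_same.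
exact: same_outside_sub fr.
Qed.

Lemma core_class0 s s' : agree_but 1 s s' -> fresh 1 s' -> core s -> core s'.
Proof.
move=> [f1 f2 f3 f4] fr cs; constructor; rewrite ?f1 ?f2 //; try by case: cs.
- by move=> j; rewrite f4 // (co_azero cs).
- by move=> j; rewrite f4 // (co_negc cs).
Qed.

Lemma wp_loop bnd nb body cb (Inv : nat -> state R -> Prop) s :
  let p := loop bnd body in
  core_safe body -> ~~ writes_ireg body i_k ->
  ~~ writes_ireg p bnd -> ~~ writes_ireg p i_one ->
  ireg s bnd = nb -> core s -> Inv 0%N (seti s i_k 0) ->
  (forall k s', (k < nb)%N -> Inv k s' -> core s' -> frame p s s' -> ireg s' i_k = k ->
     wp inp body cb (fun s'' => Inv k.+1 (seti s'' i_k k.+1)) s') ->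
  wp inp p (2 + nb * cb.+2) (fun s' => [/\ core s', frame p s s' & Inv nb s']) s.
Proof.
move=> p sb wk wb w1 snb cs inv0 hb.
have sp : core_safe p by rewrite /= sb.
apply: (@wp_weaken (realD R) _ _ (2 + nb * cb.+2) _ (fun s' => Inv nb s' /\ frame p s s')) => //.
  by move=> s' [inv fr]; split=> //; apply: core_frame fr cs.
apply: wp_for => //; first exact: co_one.
move=> k s' kn inv fr sk; apply: hb => //; exact: core_frame fr cs.
Qed.

Lemma wp_loop_blk bnd nb l (Inv : nat -> state R -> Prop) s :
  let p := loop bnd (blk l) in
  all straight l -> core_safe (blk l) -> ~~ writes_ireg (blk l) i_k ->
  ~~ writes_ireg p bnd -> ~~ writes_ireg p i_one ->
  ireg s bnd = nb -> core s -> Inv 0%N (seti s i_k 0) ->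
  (forall k s', (k < nb)%N -> Inv k s' -> core s' -> frame p s s' -> ireg s' i_k = k ->
     Inv k.+1 (seti (run inp s' l) i_k k.+1)) ->
  wp inp p (2 + nb * (size l).+3) (fun s' => [/\ core s', frame p s s' & Inv nb s']) s.
Proof.
move=> p sl sb wk wb w1 snb cs inv0 hb; apply: wp_loop => // k s' kn inv cs' fr sk.
by apply: wp_blk => //; apply: hb.
Qed.

Lemma direction_loopP s : core s ->
  (forall j, (n <= j)%N -> rarr s a_price j = 0 /\ rarr s a_dir j = 0) ->
  wp inp direction_loop (2 + n * 8) (fun s' => [/\ core s', frame direction_loop s s' &
    forall j, rarr s' a_dir j = rarr s a_price j + negc j * rreg s r_th]) s.
Proof.
move=> cs out.
pose Inv k (s' : state R) := forall j, rarr s' a_dir j =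
  if (j < k)%N then rarr s a_price j + negc j * rreg s r_th else rarr s a_dir j.
apply: wp_weaken (@wp_loop_blk i_n n _ Inv s _ _ _ _ _ (co_n cs) cs _ _) => //.
  move=> s' [cs' fr inv]; split=> // j; rewrite inv; case: ltnP => // nj.
  by have [-> ->] := out j nj; rewrite negc_out // mul0r addr0.
move=> k s' kn inv cs' [f1 f2 f3 f4] sk j; rewrite /= /upd /= sk.
rewrite f2 // f4 // (co_negc cs').
by case: (j =P k) => [->|/eqP jk]; rewrite ?ltnSn // inv ltnS [(j <= k)%N]leq_eqVlt (negbTE jk).
Qed.

Lemma copy_loopP o s : (0 < o < 3)%N -> core s ->
  wp inp (copy_loop o) (2 + n * 6) (fun s' => [/\ core s', frame (copy_loop o) s s' &
    forall j, (j < n)%N -> rarr s' a_gen j = rarr s (pa o 0) (ireg s (base o) + j)]) s.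
Proof.
move=> o3 cs.
have [wb wp0] : base o \notin [:: i_t; i_k] /\ pa o 0 != a_gen.
  by rewrite /base /pa !inE; move: o3; rewrite /i_t /i_k /a_gen; clear; lia.
pose Inv k (s' : state R) := forall j, (j < k)%N ->
  rarr s' a_gen j = rarr s (pa o 0) (ireg s (base o) + j).
apply: (@wp_loop_blk i_n n _ Inv s _ _ _ _ _ (co_n cs) cs) => //.
move=> k s' kn inv cs' [f1 f2 f3 f4] sk j; rewrite /= /upd /= sk.
have -> : ireg s' (base o) = ireg s (base o).
  apply: f1; rewrite /= !orbF orbC; move: wb; rewrite !inE.
  by rewrite !negb_or => /andP[-> ->].
rewrite f4 //=; last by rewrite !orbF.
case: (j =P k) => [->|/eqP jk] // jk1; apply: inv.
by move: jk1; rewrite ltnS leq_eqVlt (negbTE jk).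
Qed.

Lemma dot_loopP s : core s -> rreg s r_dx = 0 ->
  wp inp dot_loop (2 + n * 7) (fun s' => [/\ core s', frame dot_loop s s' &
    rreg s' r_dx = \sum_(j < n) rarr s a_dir j * rarr s a_gen j]) s.
Proof.
move=> cs dx0.
pose Inv k (s' : state R) :=
  rreg s' r_dx = \sum_(j < k) rarr s a_dir j * rarr s a_gen j.
apply: (@wp_loop_blk i_n n _ Inv s _ _ _ _ _ (co_n cs) cs) => //.
  by rewrite /Inv /= dx0 big_ord0.
move=> k s' kn inv cs' [f1 f2 f3 f4] sk; rewrite /Inv /= /upd /= sk inv.
by rewrite big_ord_recr !f4.
Qed.

Lemma set_flagP t i s :
  wp inp (set_flag t i) 3 (fun s' => s' = seti s i (holds (V := realD R) s t)) s.
Proof.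
apply: wp_if; case: (holds _ _);
by apply: wp_blk.
Qed.

(** Class 2 is allowed to change as well, although [ask] runs copy 1, so that the same relation
    describes the states inside a call of copy 2 that asks. *)
Definition asked_i : pred nat :=
  fun i => (i %% 3 != 0)%N || (i \in [:: i_k; i_t; i_res])%N.
Definition asked_r : pred nat :=
  fun i => (i %% 3 != 0)%N || (i \in [:: r_th; r_dx; r_a; r_b])%N.
Definition asked_ia : pred nat := fun i => (i %% 3 != 0)%N.
Definition asked_ra : pred nat :=
  fun i => (i %% 3 != 0)%N || (i \in [:: a_dir; a_gen])%N.

Local Notation asked := (same_outside asked_i asked_r asked_ia asked_ra).
Local Notation ask_safe := (writes_in asked_i asked_r asked_ia asked_ra).

Lemma ask_safeP : ask_safe (ask B orc).
Proof.
rewrite /= andbT.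
apply: writes_in_mono (call_confined _ _ _ _ _) => //; rewrite /class => i /eqP e.
- by rewrite /asked_i e.
- by rewrite /asked_r e.
- by rewrite /asked_ia e.
- by rewrite /asked_ra e.
Qed.

Definition ask_time := (n * 21 + (4 * B + 2 + 10 * T I) + 11)%N.

(** The oracle returns a vector, not a sign, so the sign is recomputed by a dot product. A
    non-negative one is informative about all generators, since it is also the sign of the
    minimum. *)
Lemma askP s : core s ->
  (forall j, (n <= j)%N -> rarr s a_price j = 0 /\ rarr s a_dir j = 0) ->
  let d := vec (rarr s a_price) + rreg s r_th *: vec negc in
  wp inp (ask B orc) ask_time (fun s' => [/\ core s', asked s s',
    forall j, (n <= j)%N -> rarr s' a_dir j = 0 &
    exists x, [/\ x \in S, forall j : 'I_n, rarr s' a_gen j = x j 0,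
      ireg s' i_res = (dot d x < 0) &
      0 <= dot d x -> forall g, g \in S -> 0 <= dot d g]]) s.
Proof.
move=> cs out d.
suff: wp inp (ask B orc) ask_time (fun s' => [/\ core s',
    forall j, (n <= j)%N -> rarr s' a_dir j = 0 &
    exists x, [/\ x \in S, forall j : 'I_n, rarr s' a_gen j = x j 0,
      ireg s' i_res = (dot d x < 0) &
      0 <= dot d x -> forall g, g \in S -> 0 <= dot d g]]) s.
  move=> [s' [u [e le [h1 h2 h3]]]]; exists s', u; split=> //; split=> //.
  exact: exec_writes_in ask_safeP e.
pose D1 j := rarr s a_price j + negc j * rreg s r_th.
have D1_out j : (n <= j)%N -> D1 j = 0.
  by move=> nj; rewrite /D1 negc_out // mul0r addr0; have [] := out j nj.
have dE : vec D1 = d by apply/matrixP => j k; rewrite !mxE mulrC.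
have [S1 [t1 [x [e1 le1 [xS [xm [xmS xm_min sgx]]] xE]]]] :=
  plain_oracle horc hcomb FI D1_out.
rewrite dE in xm_min sgx.
apply: (@wp_le _ _ _ ((2 + n * 8) + ((4 * B + 2 + (3 + 7) * t1) +
  ((2 + n * 6) + (2 + ((2 + n * 7) + 3)))))); first by rewrite /ask_time; lia.
apply: wp_seq; apply: wp_weaken (direction_loopP cs out) => // s1 [cs1 _ s1d].
apply: wp_seq.
pose Env (s' : state R) := agree_but 1 s1 s'.
have inp_dim j : inp_i (pair_input I (@tst0 R) D1 (fun=> 0)) 0 j = if j is 0 then n else 0%N.
  by case: j => //= j; rewrite /arrays /= nth_nil.
have Env0 s' : Env s' -> [/\ ireg s' 0 = 0%N, ireg s' i_one = 1%N, ireg s' i_n = n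
    & forall j, (rarr s' a_dir j, rarr s' a_zero j) =
       inp_r (pair_input I (@tst0 R) D1 (fun=> 0)) 0 j].
  move=> [f1 f2 f3 f4]; rewrite !f1 // (co_zero cs1) (co_one cs1) (co_n cs1).
  by split=> // j; rewrite !f4 //= s1d (co_azero cs1).
have Env1 s' s'' : agree_but 1 s' s'' -> Env s' -> Env s''.
  by move=> h1 h2; apply: same_outside_trans h2 h1.
have cmpP s' : Env s' -> wp inp (set_flag (RLt 0 (dv 1)) (flag 1)) 3 (fun s'' =>
    [/\ Env s'', own 1 s' s'' &
     ireg s'' (flag 1) = tst0 (rreg s' (du 1)) (rreg s' (dv 1))]) s'.
  move=> E'; apply: wp_weaken (set_flagP _ _ _) => // s'' ->; split.
  - apply: Env1 E'; split=> // i ni; rewrite /= /upd.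
    by case: (i =P flag 1) ni => // ->.
  - by split=> //= i _ /negbTE h; rewrite /upd h.
  - rewrite /= updE /tst0; case: E' => _ f2 _ _; rewrite [rreg s' 0]f2 //.
    by rewrite (co_rzero cs1).
apply: wp_weaken (callP _ inp_dim _ _ Env0 Env1 cmpP e1 orcB _ (co_fresh cs1)) => //.
move=> s2 [E2 fr2 s2x]; have cs2 := core_class0 E2 fr2 cs1.
apply: wp_seq; apply: wp_weaken (@copy_loopP 1 s2 isT cs2) => // s3 [cs3 [_ _ _ f3] s3x].
apply: wp_seq; apply: wp_blk => //=; set s4 := run1 _ _ _.
have cs4 : core s4 by apply: core_same cs3; split=> // i ni; rewrite /= /upd; case: (i =P _) ni => // ->.
apply: wp_seq; apply: wp_weaken (dot_loopP cs4 _) => //.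
move=> s5 [cs5 [_ _ _ f5] s5x].
have s3d : rarr s3 a_dir = rarr s1 a_dir.
  by rewrite f3 //; case: E2 => _ _ _ ->.
have s3g (j : 'I_n) : rarr s3 a_gen j = x j 0 by rewrite s3x // s2x xE.
have s5dx : rreg s5 r_dx = dot d x.
  rewrite s5x /dot; apply: eq_bigr => j _; rewrite /= s3d s1d s3g -dE.
  by rewrite mxE.
apply: wp_weaken (set_flagP _ _ _) => // s6 ->; split.
- by apply: core_same cs5; split=> // i ni; rewrite /= /upd; case: (i =P _) ni => // ->.
- by move=> j nj; rewrite /= f5 //= s3d s1d; apply: D1_out.
exists x; split=> //.
- by move=> j; rewrite /= f5 //= s3g.
- by rewrite /= updE s5dx (co_rzero cs5).
move=> dx_ge0 g gS; apply: le_trans (xm_min g gS).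
by rewrite -sgr_ge0 -sgx sgr_ge0.
Qed.

(** * The parametric search for the minimum ratio *)

Section MinRatio.
Variables (s0 : state R) (l0 : R) (xm : 'cV[R]_n).
Hypothesis cs0 : core s0.
Hypothesis s0_out : forall j, (n <= j)%N -> rarr s0 a_price j = 0 /\ rarr s0 a_dir j = 0.
Hypothesis l0_gt0 : 0 < l0.
Hypothesis xmS : xm \in S.

Local Notation p0 := (vec (rarr s0 a_price)).

Hypothesis p0_gt0 : forall x, x \in S -> 0 < dot p0 x.
Hypothesis xm_neg : dot (vec negc) xm < 0.
Hypothesis xm_zero : dot p0 xm + l0 * dot (vec negc) xm = 0.
Hypothesis xm_min : forall x, x \in S -> 0 <= dot p0 x + l0 * dot (vec negc) x.

Definition searching (s : state R) : Prop :=
  [/\ core s, asked s0 s & forall j, (n <= j)%N -> rarr s a_dir j = 0].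

Lemma searching_same s s' : same_outside (fun i => asked_i i && nc_i i)
    (fun i => asked_r i && nc_r i) (fun i => asked_ia i && nc_ia i)
    (fun i => [&& asked_ra i, nc_ra i & i != a_dir]) s s' ->
  searching s -> searching s'.
Proof.
move=> ss [cs as_ d]; split.
- by apply: core_same cs; apply: same_outside_sub ss => i /= => [/andP[]|/andP[]|/andP[]|/and3P[]].
- apply: same_outside_trans as_ _.
  by apply: same_outside_sub ss => i /= => [/andP[]|/andP[]|/andP[]|/and3P[]].
- by move=> j nj; have [_ _ _ ->] := ss; rewrite ?d // !negb_and orbT.
Qed.

Lemma searching_agree s s' : agree_but 2 s s' -> searching s -> searching s'.
Proof.
move=> ss; apply: searching_same; apply: same_outside_sub ss => i /eqP e;
  rewrite /asked_i /asked_r /asked_ia /asked_ra /nc_i /nc_r /nc_ia /nc_ra e //=.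
all: rewrite !inE /i_one /i_n /i_m /i_N /r_one /r_eps /r_e1 /a_zero /a_negc /a_dir.
all: by move: e; clear; lia.
Qed.

(** Prices being positive, a negative answer has positive objective and a ratio below the threshold,
    while [l0] is at most that ratio. Conversely, if the threshold exceeds [l0], then [xm] witnesses
    that the answer must be negative. *)
Lemma ask_quotientP s : searching s ->
  wp inp (ask_quotient B orc) (3 + ask_time) (fun s' => searching s' /\
    ireg s' i_res = (l0 < rreg s (dv 2) / rreg s (du 2))) s.
Proof.
move=> se; rewrite -[(3 + _)%N]/(2 + ask_time.+1)%N.
apply: wp_seq; apply: wp_blk => //; set s1 := run _ _ _.
have se1 : searching s1.
  apply: searching_same se; split=> // i ni; rewrite /= /upd.
  by case: (i =P _) ni => // ->.
have thE : rreg s1 r_th = rreg s (dv 2) / rreg s (du 2) by [].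
rewrite -thE; move: se1; move: s1 {thE se} => s1 [cs1 as1 d1].
have [f1 f2 f3 f4] := as1.
(* A threshold that is not positive lies below [l0]. It is not submitted to the oracle, because for
   a negative threshold a negative answer could come from a generator of negative objective. *)
apply: wp_if; rewrite /= (co_rzero cs1); case: ltP => th0; last first.
  apply: wp_blk => //; first by rewrite /ask_time /=; lia.
  split; last by rewrite /= updE ltNge (le_trans th0 (ltW l0_gt0)).
  apply: (@searching_same s1); first by split=> // i ni; rewrite /= /upd; case: (i =P _) ni => // ->.
  by split.
have e_p : rarr s1 a_price = rarr s0 a_price by apply: f4.
have [|s2 [u [e2 le2 [cs2 as2 d2 [x [xS _ res pos]]]]]] := askP cs1.
  by move=> j nj; rewrite e_p d1 //; have [] := s0_out nj.
exists s2, u; split=> //; split.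
  by split=> //; apply: same_outside_trans as1 as2.
rewrite res; congr (nat_of_bool _); rewrite e_p in pos *.
rewrite dotDl dotZl in pos *; apply/idP/idP => [neg|lt].
  have px := p0_gt0 xS; have mx := xm_min xS.
  have kx : dot (vec negc) x < 0.
    rewrite ltNge; apply/negP => k0; have := mulr_ge0 (ltW th0) k0.
    by move: neg px; lra.
  by rewrite -(ltr_nM2r kx); move: neg mx; lra.
rewrite ltNge; apply/negP => /pos /(_ _ xmS); rewrite dotDl dotZl.
by apply/negP; rewrite -ltNge -xm_zero ltrD2l ltr_nM2r.
Qed.

Lemma compare_rightP s : searching s -> wp inp (compare_right B orc) (7 + ask_time)
  (fun s' => [/\ searching s', own 2 s s' &
     ireg s' (flag 2) = tst_right l0 (rreg s (du 2)) (rreg s (dv 2))]) s.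
Proof.
move=> se; have [cs as_ d] := se.
suff: wp inp (compare_right B orc) (7 + ask_time) (fun s' => searching s' /\
     ireg s' (flag 2) = tst_right l0 (rreg s (du 2)) (rreg s (dv 2))) s.
  move=> [s' [u [e le [h1 h2]]]]; exists s', u; split=> //; split=> //.
  pose gi i := (i %% 3 != 2)%N || (i == flag 2); pose gr i := (i %% 3 != 2)%N.
  have w : writes_in gi gr gr gr (compare_right B orc).
    have cc : writes_in gi gr gr gr (call 1 a_dir a_zero (set_flag (RLt 0 (dv 1)) (flag 1)) B orc).
      apply: writes_in_mono (call_confined _ _ _ _ _) => //;
      by rewrite /class => i /eqP; rewrite /gi /gr => ->.
    by move: cc => /= ->.
  have [f1 f2 f3 f4] := exec_writes_in w e.
  split=> [i i2 fl|i i2|i i2|i i2].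
  - by rewrite f1 // /gi i2 negb_or fl.
  - by rewrite f2 // /gr i2.
  - by rewrite f3 // /gr i2.
  - by rewrite f4 // /gr i2.
have cz : rreg s 0 = 0 := co_rzero cs.
have done_ s1 k l : searching s1 -> straight l -> confined 2 l ->
    (step inp l s1 = Some (seti s1 (flag 2) k)) ->
    wp inp (blk [:: l]) 2 (fun s' => searching s' /\ ireg s' (flag 2) = k) s1.
  move=> se1 sl cl st; apply: wp_blk => //; first by rewrite /= sl.
  rewrite /= /run1 st /=; split; last by rewrite updE.
  by apply: searching_agree se1; apply: exec_writes_in cl (ExecStep st).
apply: wp_if; rewrite /= cz /tst_right; case: ifP => u0.
  apply: (@wp_le _ _ _ ((3 + ask_time) + 2)%N); first by lia.
  apply: wp_seq; apply: wp_weaken (ask_quotientP se) => // s1 [se1 res].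
  apply: done_ => //=; have [cs1 _ _] := se1.
  by rewrite (co_zero cs1) addn0 res.
apply: (@wp_le _ _ _ (5 + ask_time).+1); first by lia.
apply: wp_if; rewrite /= cz; case: ifP => u1.
  apply: (@wp_le _ _ _ ((3 + ask_time) + 2)%N); first by lia.
  apply: wp_seq; apply: wp_weaken (ask_quotientP se) => // s1 [se1 res].
  apply: done_ => //=; have [cs1 _ _] := se1.
  by rewrite (co_one cs1) res; case: (_ < _).
apply: (@wp_le _ _ _ 3); first by lia.
by apply: wp_if; rewrite /= cz; case: ifP => _; apply: done_.
Qed.

(** Each of the at most [T I] oracle steps may trigger one [ask], whose cost is linear in [T I]: the
    origin of the squared term. *)
Definition min_ratio_time := (4 * B + 2 + (14 + ask_time) * T I + (2 + n * 6))%N.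

(** [l0] and [xm] live only in the specification. The code learns [l0] afterwards, as the ratio of
    the generator found. *)
Lemma min_ratioP : fresh 2 s0 ->
  wp inp (min_ratio_call B orc) min_ratio_time (fun s' => searching s' /\
    exists x, [/\ x \in S, forall j : 'I_n, rarr s' a_gen j = x j 0
      & dot p0 x + l0 * dot (vec negc) x = 0]) s0.
Proof.
move=> fr2.
have [||S1 [t1 [x [e1 le1 xS xE x0]]]] := right_oracle horc hcomb FI _ _ xmS xm_zero xm_neg xm_min.
- by move=> j /s0_out[].
- exact: negc_out.
apply: (@wp_le _ _ _ (4 * B + 2 + (7 + ask_time + 7) * t1 + (2 + n * 6))%N).
  rewrite /min_ratio_time !leq_add2r leq_add2l leq_mul //; lia.
apply: wp_seq.
have inp_dim j : inp_i (pair_input I (tst_right l0) (rarr s0 a_price) negc) 0 j =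
    if j is 0 then n else 0%N.
  by case: j => //= j; rewrite /arrays /= nth_nil.
have Env0 s' : searching s' -> [/\ ireg s' 0 = 0%N, ireg s' i_one = 1%N, ireg s' i_n = n
    & forall j, (rarr s' a_price j, rarr s' a_negc j) =
       inp_r (pair_input I (tst_right l0) (rarr s0 a_price) negc) 0 j].
  move=> [cs [_ _ _ f4] _]; rewrite (co_zero cs) (co_one cs) (co_n cs); split=> // j.
  by rewrite (co_negc cs) f4.
have se0 : searching s0 by split=> // j /s0_out[].
apply: wp_weaken (callP _ inp_dim _ _ Env0 searching_agree compare_rightP e1 orcB se0 fr2) => //.
move=> s1 [se1 _ s1x]; have [cs1 as1 d1] := se1.
apply: wp_weaken (@copy_loopP 2 s1 isT cs1) => // s2 [cs2 fr s2x].
split.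
  apply: searching_same se1.
  apply: same_outside_sub fr => i /=; rewrite ?orbF.
  - by move=> /or3P[] /eqP ->.
  - by move=> /eqP ->.
  - by [].
  - by move=> /eqP ->.
by exists x; split=> // j; rewrite s2x // s1x xE.
Qed.

End MinRatio.

Lemma wp_safe p t Q s : core_safe p -> core s -> wp inp p t Q s ->
  wp inp p t (fun s' => [/\ core s', frame p s s' & Q s']) s.
Proof.
move=> sp cs /wp_frame; apply: wp_weaken => // s' [q fr].
by split=> //; apply: core_frame fr cs.
Qed.

Lemma wp_skip t (Q : state R -> Prop) s : (0 < t)%N -> Q s -> wp inp Skip t Q s.
Proof. by move=> t0 q; exists s, 1%N; split=> //; apply: ExecStep. Qed.

Local Notation row e := (inp_i inp 1 e).
Local Notation col e := (inp_i inp 2 e).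
Local Notation entry e := (inp_r inp 0 e).
Local Notation bq i := (inp_r inp 1 i).

(** * The individual loops of the algorithm *)

Lemma zero_loopP bnd nb a s : a \notin [:: a_zero; a_negc] -> (a %% 3 = 0)%N ->
  bnd \in [:: i_n; i_m] -> ireg s bnd = nb -> core s ->
  wp inp (loop bnd (blk [:: RStore a i_k 0])) (2 + nb * 4) (fun s' =>
    [/\ core s', frame (loop bnd (blk [:: RStore a i_k 0])) s s' &
      forall j, rarr s' a j = if (j < nb)%N then 0 else rarr s a j]) s.
Proof.
move=> na a3 hb snb cs.
pose Inv k (s' : state R) := forall j, rarr s' a j = if (j < k)%N then 0 else rarr s a j.
apply: (@wp_loop_blk bnd nb _ Inv s _ _ _ _ _ snb cs) => //.
- by rewrite /blk /= /nc_ra a3 na.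
- by move: hb; rewrite !inE => /orP[] /eqP->.
move=> k s' kn inv cs' _ sk j; rewrite /= /upd /= !eqxx sk (co_rzero cs').
by case: (j =P k) => [->|/eqP jk]; rewrite ?ltnSn // inv ltnS [(j <= k)%N]leq_eqVlt (negbTE jk).
Qed.

Lemma price_loopsP s : core s -> (forall j, (n <= j)%N -> rarr s a_price j = 0) ->
  wp inp price_loops ((2 + n * 4) + (2 + N * 11)) (fun s' =>
    [/\ core s', frame price_loops s s', vec (rarr s' a_price) = price A (rarr s a_y) &
      forall j, (n <= j)%N -> rarr s' a_price j = 0]) s.
Proof.
move=> cs out; suff: wp inp price_loops ((2 + n * 4) + (2 + N * 11)) (fun s' =>
    forall j, rarr s' a_price j =
      \sum_(e < N) (if col e == j then entry e * rarr s a_y (row e) else 0)) s.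
  move=> /(wp_safe (p := price_loops) isT cs); apply: wp_weaken => // s' [cs' fr h].
  split=> //.
    by apply/matrixP => j k; rewrite !mxE h; exact: col_entries.
  move=> j nj; rewrite h big1 // => e _; case: eqP => // ej.
  by have := col_lt b c eps (ltn_ord e); rewrite ej ltnNge nj.
apply: wp_seq; apply: wp_weaken (@zero_loopP i_n n a_price s _ _ _ (co_n cs) cs) => //.
move=> s1 [cs1 [_ _ _ fr1] z1].
pose Inv k (s' : state R) := forall j, rarr s' a_price j =
  \sum_(e < k) (if col e == j then entry e * rarr s a_y (row e) else 0).
apply: wp_weaken (@wp_loop_blk i_N N _ Inv s1 _ _ _ _ _ (co_N cs1) cs1 _ _) => //.
- by move=> s' [].
- by move=> j; rewrite /= z1 big_ord0; case: ltnP => // /out.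
move=> k s' kn inv cs' [_ _ _ f4] sk j.
have fy : rarr s' a_y = rarr s a_y by rewrite f4 // fr1.
rewrite big_ord_recr /= /upd /= sk -inv fy; case: (j =P col k) => [->|/eqP jk].
  by rewrite eqxx.
by rewrite eq_sym (negbTE jk) addr0.
Qed.

Lemma load_loopsP s (g : 'cV[R]_n) : core s -> (forall j : 'I_n, rarr s a_gen j = g j 0) ->
  wp inp load_loops ((2 + m * 4) + (2 + N * 11)) (fun s' =>
    [/\ core s', frame load_loops s s' & forall i : 'I_m, rarr s' a_load i = load A g i]) s.
Proof.
move=> cs sg; apply: wp_safe => //.
apply: wp_seq; apply: wp_weaken (@zero_loopP i_m m a_load s _ _ _ (co_m cs) cs) => //.
move=> s1 [cs1 [_ _ _ fr1] z1].
pose Inv k (s' : state R) := forall i, (i < m)%N -> rarr s' a_load i =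
  \sum_(e < k) (if row e == i then entry e * rarr s a_gen (col e) else 0).
apply: wp_weaken (@wp_loop_blk i_N N _ Inv s1 _ _ _ _ _ (co_N cs1) cs1 _ _) => //.
- move=> s' [_ _ inv] i; rewrite inv //; rewrite row_entries /load.
  by apply: eq_bigr => j _; rewrite sg.
- by move=> i im; rewrite /= z1 big_ord0 im.
move=> k s' kn inv cs' [_ _ _ f4] sk i im.
have fg : rarr s' a_gen = rarr s a_gen by rewrite f4 // fr1.
rewrite big_ord_recr /= /upd /= sk -inv // fg; case: (i =P row k) => [->|/eqP ik].
  by rewrite eqxx.
by rewrite eq_sym (negbTE ik) addr0.
Qed.

(** The alternative [r_rho = 0] comes from the initial value of the running maximum; [pushP]
    excludes it by [load_gt0]. *)
Lemma ratio_codeP s : core s ->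
  wp inp ratio_code (2 + (2 + m * 10)) (fun s' =>
    [/\ core s', frame ratio_code s s' &
    [/\ forall i, (i < m)%N -> rarr s' a_load i = rarr s a_load i / bq i,
        forall i, (i < m)%N -> rarr s' a_load i <= rreg s' r_rho &
        rreg s' r_rho = 0 \/ exists2 i, (i < m)%N & rarr s' a_load i = rreg s' r_rho]]) s.
Proof.
move=> cs; apply: wp_safe => //; apply: wp_seq; apply: wp_blk => //; set s1 := run _ _ _.
have cs1 : core s1.
  by apply: core_same cs; split=> // i ni; rewrite /= /upd; case: (i =P _) ni => // ->.
pose Inv k (s' : state R) :=
  [/\ forall j, rarr s' a_load j = if (j < k)%N then rarr s a_load j / bq j else rarr s a_load j,
      forall j, (j < k)%N -> rarr s a_load j / bq j <= rreg s' r_rho &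
      rreg s' r_rho = 0 \/ exists2 j, (j < k)%N & rarr s a_load j / bq j = rreg s' r_rho].
apply: wp_weaken (@wp_loop i_m m _ 8 Inv s1 _ _ _ _ (co_m cs1) cs1 _ _) => //.
- move=> s' [_ _ [h1 h2 h3]]; split.
  + by move=> i im; rewrite h1 im.
  + by move=> i im; rewrite h1 im; apply: h2.
  + by case: h3 => [|[j jm e]]; [left | right; exists j; rewrite // h1 jm].
- by split=> //; left.
move=> k s' km [h1 h2 h3] cs' _ sk.
rewrite -[8%N]/(5 + 3)%N; apply: wp_seq; apply: wp_blk => //; set s2 := run _ _ _.
have kk : rarr s' a_load k = rarr s a_load k by rewrite h1 ltnn.
have s2a : rreg s2 r_a = rarr s a_load k / bq k by rewrite /s2 /= /upd /= sk kk.
have s2rho : rreg s2 r_rho = rreg s' r_rho by [].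
have s2l j : rarr s2 a_load j =
    if (j < k.+1)%N then rarr s a_load j / bq j else rarr s a_load j.
  rewrite /s2 /= /upd /= sk kk.
  by case: (j =P k) => [->|/eqP jk]; rewrite ?ltnSn // h1 ltnS [(j <= k)%N]leq_eqVlt (negbTE jk).
have s20 : rreg s2 0 = 0 by rewrite -(co_rzero cs').
move: s2 s2a s2rho s2l s20 => s2 s2a s2rho s2l s20.
apply: wp_if; rewrite /= s2a s2rho; case: ltP => hlt.
  apply: wp_blk => //; split=> //=; rewrite /upd /= s2a s20 addr0.
    move=> j; rewrite ltnS leq_eqVlt => /orP[/eqP->//|/h2 le].
    exact: le_trans le (ltW hlt).
  by right; exists k.
apply: wp_skip => //; split=> //=; rewrite s2rho.
  by move=> j; rewrite ltnS leq_eqVlt => /orP[/eqP->//|/h2 le].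
case: h3 => [|[j jk e]]; [by left | right; exists j => //].
exact: ltnW.
Qed.

Lemma weight_loopP s : core s ->
  let y' i := rarr s a_y i * (1 + eps / 3 * (rarr s a_load i / rreg s r_rho)) in
  let z' i := rarr s a_z i + rarr s a_load i / rreg s r_rho in
  wp inp weight_loop (2 + m * 16) (fun s' => [/\ core s', frame weight_loop s s',
    forall i, (i < m)%N -> rarr s' a_y i = y' i /\ rarr s' a_z i = z' i,
    forall i, (i < m)%N -> z' i <= rreg s' r_zmax &
    rreg s r_zmax <= rreg s' r_zmax /\ (rreg s' r_zmax = rreg s r_zmax \/
      exists2 i, (i < m)%N & z' i = rreg s' r_zmax)]) s.
Proof.
move=> cs y' z'.
pose Inv k (s' : state R) :=
  [/\ forall j, rarr s' a_y j = if (j < k)%N then y' j else rarr s a_y j,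
      forall j, rarr s' a_z j = if (j < k)%N then z' j else rarr s a_z j,
      forall j, (j < k)%N -> z' j <= rreg s' r_zmax &
      rreg s r_zmax <= rreg s' r_zmax /\ (rreg s' r_zmax = rreg s r_zmax \/
        exists2 j, (j < k)%N & z' j = rreg s' r_zmax)].
apply: wp_weaken (@wp_loop i_m m _ 14 Inv s _ _ _ _ (co_m cs) cs _ _) => //.
- move=> s' [cs' fr [h1 h2 h3 h4]]; split=> // i im.
  by rewrite h1 h2 im.
- by split=> //; split=> //; left.
move=> k s' km [h1 h2 h3 [h4 h5]] cs' [_ f2 _ f4] sk.
rewrite -[14%N]/(11 + 3)%N; apply: wp_seq; apply: wp_blk => //; set s2 := run _ _ _.
have fw : rarr s' a_load = rarr s a_load by apply: f4.
have frho : rreg s' r_rho = rreg s r_rho by apply: f2.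
have s2z : rreg s2 r_b = z' k.
  by rewrite /s2 /= /upd /= sk h2 ltnn fw frho.
have s2zm : rreg s2 r_zmax = rreg s' r_zmax by [].
have s2za j : rarr s2 a_z j = if (j < k.+1)%N then z' j else rarr s a_z j.
  rewrite /s2 /= /upd /= sk fw frho.
  case: (j =P k) => [->|/eqP jk]; first by rewrite ltnSn h2 ltnn.
  by rewrite h2 ltnS [(j <= k)%N]leq_eqVlt (negbTE jk).
have s2ya j : rarr s2 a_y j = if (j < k.+1)%N then y' j else rarr s a_y j.
  rewrite /s2 /= /upd /= sk fw frho (co_eps cs') (co_rone cs').
  case: (j =P k) => [->|/eqP jk]; first by rewrite ltnSn h1 ltnn.
  by rewrite h1 ltnS [(j <= k)%N]leq_eqVlt (negbTE jk).
have s20 : rreg s2 0 = 0 by rewrite -(co_rzero cs').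
move: s2 s2z s2zm s2za s2ya s20 => s2 s2z s2zm s2za s2ya s20.
apply: wp_if; rewrite /= s2z s2zm; case: ltP => hlt.
  apply: wp_blk => //; split=> //=; rewrite /upd /= s2z s20 addr0.
    move=> j; rewrite ltnS leq_eqVlt => /orP[/eqP->//|/h3 le].
    exact: le_trans le (ltW hlt).
  by split; [exact: le_trans h4 (ltW hlt) | right; exists k].
apply: wp_skip => //; split=> //=; rewrite s2zm.
  by move=> j; rewrite ltnS leq_eqVlt => /orP[/eqP->//|/h3 le].
split=> //; case: h5 => [|[j jk e]]; [by left | right; exists j => //].
exact: ltnW.
Qed.

Lemma out_loopP s : core s -> wp inp out_loop (2 + n * 8) (fun s' =>
  [/\ core s', frame out_loop s s' & forall j, (j < n)%N ->
     rarr s' a_out j = rarr s a_out j + rarr s a_gen j / rreg s r_rho]) s.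
Proof.
move=> cs.
pose Inv k (s' : state R) := forall j, rarr s' a_out j =
  if (j < k)%N then rarr s a_out j + rarr s a_gen j / rreg s r_rho else rarr s a_out j.
apply: wp_weaken (@wp_loop_blk i_n n _ Inv s _ _ _ _ _ (co_n cs) cs _ _) => //.
  by move=> s' [cs' fr inv]; split=> // j jn; rewrite inv jn.
move=> k s' kn inv cs' [_ f2 _ f4] sk j; rewrite /= /upd /= sk inv ltnn.
rewrite f2 // f4 //.
by case: (j =P k) => [->|/eqP jk]; rewrite ?ltnSn // inv ltnS [(j <= k)%N]leq_eqVlt (negbTE jk).
Qed.

Lemma scale_loopP s : core s -> wp inp scale_loop (2 + n * 6) (fun s' =>
  [/\ core s', frame scale_loop s s' & forall j, (j < n)%N ->
     rarr s' a_out j = rarr s a_out j / rreg s r_zmax]) s.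
Proof.
move=> cs.
pose Inv k (s' : state R) := forall j, rarr s' a_out j =
  if (j < k)%N then rarr s a_out j / rreg s r_zmax else rarr s a_out j.
apply: wp_weaken (@wp_loop_blk i_n n _ Inv s _ _ _ _ _ (co_n cs) cs _ _) => //.
  by move=> s' [cs' fr inv]; split=> // j jn; rewrite inv jn.
move=> k s' kn inv cs' [_ f2 _ f4] sk j; rewrite /= /upd /= sk inv ltnn.
rewrite f2 //.
by case: (j =P k) => [->|/eqP jk]; rewrite ?ltnSn // inv ltnS [(j <= k)%N]leq_eqVlt (negbTE jk).
Qed.

Lemma mu_codeP s (x : 'cV[R]_n) : core s -> (forall j : 'I_n, rarr s a_gen j = x j 0) ->
  wp inp mu_code (3 + ((2 + n * 10) + 3)) (fun s' =>
    [/\ core s', frame mu_code s s' &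
     rreg s' r_mu = - (dot (vec (rarr s a_price)) x / dot (vec negc) x)]) s.
Proof.
move=> cs sx; apply: wp_safe => //; apply: wp_seq; apply: wp_blk => //; set s1 := run _ _ _.
have cs1 : core s1.
  apply: core_same cs; split=> // i ni; rewrite /= /upd.
  by case: (i =P _) ni => // [->//|_ ni]; case: (i =P _) ni => // ->.
pose Inv k (s' : state R) :=
  rreg s' r_c = \sum_(j < k) rarr s a_price j * rarr s a_gen j /\
  rreg s' r_dx = \sum_(j < k) negc j * rarr s a_gen j.
apply: wp_seq.
apply: wp_weaken (@wp_loop_blk i_n n _ Inv s1 _ _ _ _ _ (co_n cs1) cs1 _ _) => //.
- move=> s' [cs' _ [h1 h2]]; apply: wp_blk => //=.
  rewrite /upd /= (co_rzero cs') sub0r h1 h2; congr (- (_ / _)).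
  + by apply: eq_bigr => j _; rewrite sx mxE.
  + by apply: eq_bigr => j _; rewrite sx mxE.
- by split; rewrite /= big_ord0.
move=> k s' kn [h1 h2] cs' [_ f2 _ f4] sk; rewrite /Inv /= /upd /= sk h1 h2.
by rewrite !big_ord_recr /= (co_negc cs') !f4.
Qed.

(** At most [m] doublings is a crude bound but suffices for the time. The inequality [2 ^ k.-1 < m]
    is kept to compare [k] with [ln m] later. *)
Lemma level_codeP s : core s ->
  wp inp level_code (3 + ((m * 4).+1 + 4)) (fun s' =>
    [/\ core s', frame level_code s s' & exists k,
     [/\ (m <= 2 ^ k)%N, k = 0%N \/ (2 ^ k.-1 < m)%N &
      rreg s' r_L = k%:R / (eps / 3) / (eps / 3) + 1]]) s.
Proof.
move=> cs; apply: wp_safe => //; apply: wp_seq; apply: wp_blk => //; set s1 := run _ _ _.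
pose Inv k (s' : state R) := [/\ ireg s' i_pw = (2 ^ k)%N, rreg s' r_L = k%:R,
  k = 0%N \/ (2 ^ k.-1 < m)%N & [/\ ireg s' i_m = m, rreg s' r_one = 1 & rreg s' r_eps = eps / 3]].
apply: wp_seq.
apply: wp_weaken (@wp_while _ inp (ILt i_pw i_m) _ 3 m Inv s1 _ _ _) => //.
- move=> s' [h [k [h1 h2 h3 [h4 h5 h6]]]]; apply: wp_blk => //; exists k; split=> //.
    by move: h; rewrite /= h1 h4 -leqNgt.
  by rewrite /= /upd /= h2 h5 h6.
- move=> k s' [_ _ [->//|lt] _]; apply: leq_trans lt.
  by case: k => // k; rewrite ltnS ltnW // ltn_expl.
- move=> k s' [h1 h2 h3 [h4 h5 h6]]; rewrite /= h1 h4 => lt.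
  apply: wp_blk => //; split=> //=; rewrite /upd /=.
  + by rewrite h1 addnn expnS mul2n.
  + by rewrite h2 h5 natr1.
  + by right.
- split=> //; first by left.
  by split=> //=; [exact: co_m | exact: co_rone | exact: co_eps].
Qed.

Lemma eps3_gt0 : 0 < eps / 3.
Proof. by move: eps01; lra. Qed.

Lemma eps3_le : eps / 3 <= 3^-1.
Proof. by move: eps01; lra. Qed.

Definition price_time := ((2 + n * 4) + (2 + N * 11))%N.

Definition push_time := (((2 + m * 4) + (2 + N * 11)) + ((2 + (2 + m * 10)) +
  ((2 + m * 16) + ((2 + n * 8) + price_time))))%N.

Definition body_time := (2 + (ask_time + push_time.+1))%N.

(** * The main loop of pushes and raises *)

Section MainLoop.
Variables (L mu0 : R).
Hypothesis mu0_gt0 : 0 < mu0.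

Local Notation winv := (weights_inv A b c S (eps / 3) L mu0).

(** The round counter is split into pushes and raises, so that [weights_count] is the bound required
    by [wp_while]. *)
Definition loop_inv (k : nat) (s : state R) : Prop :=
  [/\ core s, rreg s r_L = L,
      forall j, (n <= j)%N -> rarr s a_price j = 0 /\ rarr s a_dir j = 0,
      vec (rarr s a_price) = price A (rarr s a_y) &
      exists np nr, k = (np + nr)%N /\
        winv np nr (rarr s a_y) (rarr s a_z) (vec (rarr s a_out)) (rreg s r_mu) (rreg s r_zmax)].

Lemma pushP s np nr g : core s -> rreg s r_L = L ->
  (forall j, (n <= j)%N -> rarr s a_price j = 0 /\ rarr s a_dir j = 0) ->
  winv np nr (rarr s a_y) (rarr s a_z) (vec (rarr s a_out)) (rreg s r_mu) (rreg s r_zmax) ->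
  rreg s r_zmax < L -> g \in S -> (forall j : 'I_n, rarr s a_gen j = g j 0) ->
  dot (price A (rarr s a_y)) g < rreg s r_mu * (1 + eps / 3) * dot (cvec R c) g ->
  wp inp push push_time (loop_inv (np + nr).+1) s.
Proof.
move=> cs sL out w zL gS sg cheap.
apply: wp_seq; apply: wp_weaken (load_loopsP cs sg) => // s1 [cs1 [_ a2 _ a4] s1l].
apply: wp_seq; apply: wp_weaken (ratio_codeP cs1) => // s2 [cs2 [_ b2 _ b4] [s2l s2le s2arg]].
apply: wp_seq; apply: wp_weaken (weight_loopP cs2) => // s3.
move=> [cs3 [_ c2 _ c4] s3yz s3le [s3z s3arg]].
apply: wp_seq; apply: wp_weaken (out_loopP cs3) => // s4 [cs4 [_ d2 _ d4] s4o].
have s4p : rarr s4 a_price = rarr s a_price by rewrite d4 // c4 // b4 // a4.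
apply: wp_weaken (price_loopsP cs4 _) => //; last first.
  by move=> j /out[h _]; rewrite s4p.
move=> s5 [cs5 [_ e2 _ e4] s5p s5out].
have load_eq (i : 'I_m) : rarr s2 a_load i = load A g i / cap R b i.
  by rewrite s2l // s1l inp_cap.
have Sg x : x \in S -> (forall j, 0 <= x j 0) /\ x != 0 by apply: hS.
have rho_eq : rreg s3 r_rho = rreg s2 r_rho by apply: c2.
have rho_ge i : load A g i / cap R b i <= rreg s2 r_rho by rewrite -load_eq s2le.
have rho_arg : exists i, load A g i / cap R b i = rreg s2 r_rho.
  case: s2arg => [rho0|[i im e]]; last first.
    by exists (Ordinal im); rewrite -load_eq.
  have [i gi] := load_gt0 Ab Sg gS; have := rho_ge i; rewrite rho0 leNgt.
  by rewrite divr_gt0 ?(cap_gt0 R Ab).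
have s2y : rarr s2 a_y = rarr s a_y by rewrite b4 // a4.
have s2z : rarr s2 a_z = rarr s a_z by rewrite b4 // a4.
have s2zm : rreg s2 r_zmax = rreg s r_zmax by rewrite b2 // a2.
have y'E (i : 'I_m) : rarr s3 a_y i = rarr s a_y i * (1 + eps / 3 * (load A g i / cap R b i / rreg s2 r_rho)).
  by have [-> _] := s3yz i (ltn_ord i); rewrite s2y load_eq.
have z'E (i : 'I_m) : rarr s3 a_z i = rarr s a_z i + load A g i / cap R b i / rreg s2 r_rho.
  by have [_ ->] := s3yz i (ltn_ord i); rewrite s2z load_eq.
have z'_le (i : 'I_m) : rarr s3 a_z i <= rreg s3 r_zmax.
  by have [_ ->] := s3yz i (ltn_ord i); apply: s3le.
have rho_gt0 : 0 < rreg s2 r_rho.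
  have [i gi] := load_gt0 Ab Sg gS; apply: lt_le_trans (rho_ge i).
  by rewrite divr_gt0 ?(cap_gt0 R Ab).
have z'_arg : exists i : 'I_m, rarr s3 a_z i = rreg s3 r_zmax.
  (* If the running maximum did not move, either it was zero, which the row gaining a full unit
     contradicts, or a row attaining it before still attains it. *)
  case: s3arg => [zz|[i im e]]; last first.
    by exists (Ordinal im); have [_ ->] := s3yz i im.
  rewrite s2zm in zz; case: (wi_arg w) => [z0|[i zi]].
    have [i ri] := rho_arg; have := z'_le i; rewrite z'E ri zz z0 divff ?gt_eqF //.
    have /andP[zi0 _] := wi_zmax w i.
    by move=> h; exfalso; move: h zi0; lra.
  exists i; apply/eqP; rewrite eq_le z'_le zz -zi z'E lerDl.
  rewrite divr_ge0 ?(ltW rho_gt0) // divr_ge0 ?(ltW (cap_gt0 R Ab i)) //.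
  exact: (load_ge0 A Sg i gS).
have [_ w'] := weights_push Ab Sg eps3_gt0 mu0_gt0 w zL gS cheap rho_ge rho_arg
  y'E z'E z'_le z'_arg.
have f_y : rarr s5 a_y = rarr s3 a_y by rewrite e4 // d4.
split=> //.
- by rewrite e2 // d2 // c2 // b2 // a2.
- move=> j nj; split; first exact: s5out.
  by rewrite e4 // d4 // c4 // b4 // a4 //; have [] := out j nj.
- by rewrite s5p f_y; congr (price A _); apply: d4.
exists np.+1, nr; split; first by rewrite addSn.
have -> : vec (rarr s5 a_out) = vec (rarr s a_out) + (rreg s2 r_rho)^-1 *: g.
  apply/matrixP => j k; rewrite !mxE ord1 e4 // s4o // rho_eq mulrC; congr (_ + _ * _).
    by rewrite c4 // b4 // a4.
  by rewrite -sg c4 // b4 // a4.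
have -> : rreg s5 r_mu = rreg s r_mu by rewrite e2 // d2 // c2 // b2 // a2.
have -> : rreg s5 r_zmax = rreg s3 r_zmax by rewrite e2 // d2.
have -> : rarr s5 a_z = rarr s3 a_z by rewrite e4 // d4.
by rewrite f_y.
Qed.

Lemma main_bodyP k s : loop_inv k s -> rreg s r_zmax < L ->
  wp inp (main_body B orc) body_time (loop_inv k.+1) s.
Proof.
move=> [cs sL out sp [np [nr [-> w]]]] zL.
apply: wp_seq; apply: wp_blk => //; set s1 := run _ _ _.
have cs1 : core s1.
  by apply: core_same cs; split=> // i ni; rewrite /= /upd; case: (i =P _) ni => // ->.
have th1 : rreg s1 r_th = rreg s r_mu * (1 + eps / 3) by rewrite /= /upd /= (co_e1 cs).
have out1 j : (n <= j)%N -> rarr s1 a_price j = 0 /\ rarr s1 a_dir j = 0 by apply: out.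
apply: wp_seq; apply: wp_weaken (askP cs1 out1) => //.
rewrite th1 [rarr s1 _]/(rarr s a_price) sp => s2 [cs2 [_ f2 _ f4] out2 [x [xS sx res pos]]].
have dE g : dot (price A (rarr s a_y) + (rreg s r_mu * (1 + eps / 3)) *: vec negc) g =
    dot (price A (rarr s a_y)) g - rreg s r_mu * (1 + eps / 3) * dot (cvec R c) g.
  by rewrite dotDl dotZl vec_negc -scaleN1r dotZl mulN1r mulrN.
rewrite dE in res pos.
have e_y : rarr s2 a_y = rarr s a_y by rewrite f4.
have e_z : rarr s2 a_z = rarr s a_z by rewrite f4.
have e_p : rarr s2 a_price = rarr s a_price by rewrite f4.
have e_o : rarr s2 a_out = rarr s a_out by rewrite f4.
have e_mu : rreg s2 r_mu = rreg s r_mu by rewrite f2.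
have e_zm : rreg s2 r_zmax = rreg s r_zmax by rewrite f2.
have e_L : rreg s2 r_L = L by rewrite f2.
have out2' j : (n <= j)%N -> rarr s2 a_price j = 0 /\ rarr s2 a_dir j = 0.
  by move=> nj; rewrite e_p out2 //; have [] := out j nj.
apply: wp_if; rewrite /= (co_zero cs2) res lt0b; case: ltP => neg.
  apply: (pushP (g := x)) => //; rewrite ?e_y ?e_z ?e_o ?e_mu ?e_zm //.
  by move: neg; lra.
apply: wp_blk => //.
split=> //=; try by rewrite ?e_y ?e_p.
  apply: core_same cs2; split=> // i ni; rewrite /= /upd.
  by case: (i =P _) ni => // ->.
exists np, nr.+1; split; first by rewrite addnS.
rewrite /upd /= e_mu (co_e1 cs2) e_y e_z e_o e_zm.
apply: weights_raise w _ => g gS; rewrite -subr_ge0 -dE; exact: pos.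
Qed.

End MainLoop.

(** * Initialisation and the whole program *)

Lemma setup_codeP : wp inp setup_code (11 + (2 + n * 6)) (fun s =>
  core s /\ frame setup_code (init (realD R)) s) (init (realD R)).
Proof.
apply: wp_frame; apply: wp_seq; apply: wp_blk => //; set s1 := run _ _ _.
pose Inv k (s : state R) := forall j, rarr s a_negc j = if (j < k)%N then negc j else 0.
have := @wp_for (realD R) inp i_k i_n i_one (blk [:: RInp r_a 2 i_k; RArith Sub r_a 0 r_a; RStore a_negc i_k r_a])
  n 4 Inv s1 isT isT isT.
move=> H; apply: wp_weaken (H _ _ _ _) => // {H}.
- move=> s [inv [f1 f2 f3 f4]]; constructor; rewrite ?f1 ?f2 //.
  + by move=> j; rewrite f4.
  + by move=> j; rewrite inv; case: ltnP => // nj; rewrite negc_out.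
  + have class1 x : x = 1 %[mod 3] -> rarr s x = rarr s1 x.
      move=> x1; apply: f4; apply/negP; rewrite /= !orbF => /eqP xE.
      by rewrite xE in x1.
    by move=> a j; rewrite f3 // !class1 ?class_modE.
- move=> k s kn inv [f1 f2 f3 f4] sk; apply: wp_blk => // j.
  rewrite /= /upd /= sk [rreg s 0]f2 //= sub0r.
  by case: (j =P k) => [->|/eqP jk]; rewrite ?ltnSn // inv ltnS [(j <= k)%N]leq_eqVlt (negbTE jk).
Qed.

Lemma weight_init_loopP s : core s ->
  wp inp weight_init_loop (2 + m * 6) (fun s' =>
    [/\ core s', frame weight_init_loop s s' &
        forall i : 'I_m, rarr s' a_y i = y0 R b i]) s.
Proof.
move=> cs.
pose Inv k (s' : state R) := forall j, (j < k)%N -> rarr s' a_y j = (bq j)^-1.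
apply: wp_weaken (@wp_loop_blk i_m m _ Inv s _ _ _ _ _ (co_m cs) cs _ _) => //.
  move=> s' [cs' fr inv]; split=> // i; rewrite inv // inp_cap.
  by rewrite y0E.
move=> k s' kn inv cs' _ sk j; rewrite /= /upd /= sk (co_rone cs') mul1r.
by case: (j =P k) => [->|/eqP jk] //; rewrite ltnS leq_eqVlt (negbTE jk) => /inv.
Qed.

Definition no2 : pred nat := fun i => (i %% 3 != 2)%N.

Lemma wp_fresh2 p t Q s : writes_in no2 no2 no2 no2 p -> fresh (R := R) 2 s ->
  wp inp p t Q s -> wp inp p t (fun s' => fresh 2 s' /\ Q s') s.
Proof.
move=> wr fr [s' [u [e ut q]]]; exists s', u; split=> //; split=> //.
have [f1 f2 f3 f4] := exec_writes_in wr e.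
by move=> a j; rewrite f1 // f3 ?f4 /no2 ?class_modE //; apply: fr.
Qed.

Definition prep_time := ((11 + (2 + n * 6)) + ((2 + m * 6) + 2))%N.

Definition search_time := (price_time + (min_ratio_time + ((3 + ((2 + n * 10) + 3)) +
  (3 + ((m * 4).+1 + 4)))))%N.

Lemma packing_codeP : exists s x t k K,
  [/\ exec inp (packing_code B orc) (init (realD R)) s t,
      output s x,
      feasible A b S x,
      forall z, feasible A b S z -> (1 - eps) * objective c z <= objective c x &
  [/\ k = 0%N \/ (2 ^ k.-1 < m)%N,
      K%:R <= (m%:R + 2) * (k%:R / (eps / 3) / (eps / 3) + 2) :> R &
      (t <= prep_time + (ask_time + (search_time + ((K * body_time.+1).+1 + (2 + n * 6))).+1))%N]].
Proof.
have Sg x : x \in S -> (forall j, 0 <= x j 0) /\ x != 0 by apply: hS.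
have fr0 : fresh (R := R) 2 (init (realD R)) by [].
have [s1 [u1 [e1 le1 [fr1 [cs1 [g1 g2 g3 g4]]]]]] :=
  wp_fresh2 (p := setup_code) isT fr0 setup_codeP.
have [s2 [u2 [e2 le2 [fr2 [cs2 [h1 h2 h3 h4] s2y]]]]] :=
  wp_fresh2 (p := weight_init_loop) isT fr1 (weight_init_loopP cs1).
pose s3 := run inp s2 [:: RLit r_th 1].
have [s3' [u3 [e3 le3 s3E]]] := @wp_blk _ inp [:: RLit r_th 1] 2 (eq s3) s2 isT isT erefl.
rewrite -{}s3E {s3'} in e3.
have cs3 : core s3.
  by apply: core_same cs2; split=> // i ni; rewrite /= /upd; case: (i =P _) ni => // ->.
have s3p j : rarr s3 a_price j = 0 by rewrite /= h4 // g4.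
have s3d j : rarr s3 a_dir j = 0 by rewrite /= h4 // g4.
have ask_no2 : writes_in no2 no2 no2 no2 (ask B orc).
  rewrite /= andbT; apply: writes_in_mono (call_confined _ _ _ _ _) => //;
  by rewrite /class /no2 => i /eqP ->.
have out3 j : (n <= j)%N -> rarr s3 a_price j = 0 /\ rarr s3 a_dir j = 0 by split.
have [s4 [u4 [e4 le4 [fr4 [cs4 [k1 k2 _ k4] s4d [x [xS sx res pos]]]]]]] :=
  wp_fresh2 (s := s3) ask_no2 fr2 (askP cs3 out3).
have dE g : dot (vec (rarr s3 a_price) + rreg s3 r_th *: vec negc) g = - dot (cvec R c) g.
  have -> : vec (rarr s3 a_price) = 0 by apply/matrixP => j k; rewrite !mxE s3p.
  by rewrite add0r /= /upd /= scale1r vec_negc -scaleN1r dotZl mulN1r.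
rewrite dE oppr_lt0 oppr_ge0 in res pos.
have s4o j : rarr s4 a_out j = 0 by rewrite k4 // /= h4 // g4.
have prefix p q s t : exec inp (if 0 < dot (cvec R c) x then p else q) s4 s t ->
    exec inp (Seq setup_code (Seq weight_init_loop (Seq (blk [:: RLit r_th 1])
      (Seq (ask B orc) (If (ILt 0 i_res) p q))))) (init (realD R)) s
      (u1 + (u2 + (u3 + (u4 + t.+1)))).
  move=> e; apply: ExecSeq e1 _; apply: ExecSeq e2 _; apply: ExecSeq e3 _.
  apply: ExecSeq e4 _; apply: ExecIf; rewrite /= (co_zero cs4) res lt0b.
  by case: ifP e.
have [cx|cx] := ltP 0 (dot (cvec R c) x); last first.
  exists s4, 0, (u1 + (u2 + (u3 + (u4 + 2))))%N, 0%N, 0%N; split.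
  - by apply: prefix; rewrite ltNge cx; apply: ExecStep.
  - by move=> j; rewrite mxE; apply: s4o.
  - apply/feasibleE; split; first exact: cone0.
    by move=> i; rewrite load0 ltW // (cap_gt0 R Ab).
  - move=> z /feasibleE[cz _]; rewrite /objective dot0r.
    rewrite mulr_ge0_le0 //; first by move: eps01; lra.
    rewrite -/(cvec R c) -[leRHS](mul0r (dot (cvec R c) z)) -dotZl.
    apply: cone_dot_le cz => g gS; rewrite dotZl mul0r -oppr_ge0 -dE.
    exact: pos.
  - split; [by left | | by rewrite /prep_time; lia].
    by rewrite !mul0r add0r mulr_ge0 // addr_ge0.
have y_gt0 (i : 'I_m) : 0 < y0 R b i by rewrite y0E invr_gt0 (cap_gt0 R Ab).
(* The ratio is minimised over generators of positive objective only; [x] shows that there are some.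
   For the others the dual inequality holds because prices are positive. *)
have [xm [xmS cxm] xm_min] := exists_argmin
  (P := fun g => 0 < dot (cvec R c) g)
  (fun g => dot (price A (y0 R b)) g / dot (cvec R c) g) xS cx.
set l0 := dot (price A (y0 R b)) xm / dot (cvec R c) xm in xm_min.
have l0_gt0 : 0 < l0 by rewrite divr_gt0 // (dot_price_gt0 Ab Sg y_gt0).
have l0E : dot (price A (y0 R b)) xm = l0 * dot (cvec R c) xm.
  by rewrite divfK // gt_eqF.
have dual g : g \in S -> l0 * dot (cvec R c) g <= dot (price A (y0 R b)) g.
  move=> gS; have [cg|cg] := ltP 0 (dot (cvec R c) g).
    by rewrite -ler_pdivlMr //; apply: xm_min.
  apply: (@le_trans _ _ 0); first by rewrite mulr_ge0_le0 // ltW.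
  by rewrite ltW // (dot_price_gt0 Ab Sg y_gt0).
have negcE g : dot (vec negc) g = - dot (cvec R c) g.
  by rewrite vec_negc -scaleN1r dotZl mulN1r.
have s4y (i : 'I_m) : rarr s4 a_y i = y0 R b i by rewrite k4 // /= s2y.
have [|s5 [u5 [e5 le5 [fr5 [cs5 [_ a2 _ a4] s5p s5out]]]]] :=
  wp_fresh2 (p := price_loops) isT fr4 (price_loopsP cs4 _).
  by move=> j _; rewrite k4.
have {}s5p : vec (rarr s5 a_price) = price A (y0 R b).
  rewrite s5p; apply/matrixP => j k; rewrite !mxE.
  by apply: eq_bigr => i _; rewrite s4y.
have out5 j : (n <= j)%N -> rarr s5 a_price j = 0 /\ rarr s5 a_dir j = 0.
  by move=> nj; rewrite s5out // a4 // s4d.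
have [||||s6 [u6 [e6 le6 [[cs6 [_ b2 _ b4] s6d] [g [gS sg g0]]]]]] :=
  @min_ratioP s5 l0 xm cs5 out5 l0_gt0 xmS _ _ _ _ fr5.
- by move=> z zS; rewrite s5p (dot_price_gt0 Ab Sg y_gt0).
- by rewrite negcE oppr_lt0.
- by rewrite s5p negcE l0E mulrN subrr.
- by move=> z /dual; rewrite s5p negcE mulrN subr_ge0.
have [s7 [u7 [e7 le7 [cs7 [_ c2 _ c4] s7mu]]]] := mu_codeP cs6 sg.
have s6p : rarr s6 a_price = rarr s5 a_price by apply: b4.
have {}s7mu : rreg s7 r_mu = l0.
  rewrite s7mu s6p s5p; rewrite s5p negcE in g0 *.
  have pg := dot_price_gt0 Ab Sg y_gt0 gS.
  have cg : dot (cvec R c) g != 0.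
    by apply: contraTneq pg => cg; move: g0; rewrite cg oppr0 mulr0 addr0 => ->; rewrite ltxx.
  move/eqP: g0; rewrite mulrN subr_eq0 => /eqP ->.
  by rewrite invrN mulrN opprK mulfK.
have [s8 [u8 [e8 le8 [cs8 [_ d2 _ d4] [k [mk kP sL]]]]]] := level_codeP cs7.
set L := _ + 1 in sL.
have e3_gt0 := eps3_gt0.
have L_ge0 : 0 <= L by rewrite /L addr_ge0 // divr_ge0 ?(ltW e3_gt0) // divr_ge0 ?(ltW e3_gt0).
have arr8 a : a \in [:: a_price; a_y; a_z; a_out] -> rarr s8 a = rarr s5 a.
  by rewrite !inE => /or4P[] /eqP->; rewrite d4 // c4 // b4.
have inv0 : loop_inv L l0 0 s8.
  split=> //.
  - move=> j nj; rewrite arr8 // d4 // c4 // s6d //.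
    by have [-> _] := out5 j nj.
  - rewrite !arr8 // s5p; apply/matrixP => j i'; rewrite !mxE.
    by apply: eq_bigr => i _; rewrite a4 // s4y.
  exists 0%N, 0%N; split=> //.
  have -> : vec (rarr s8 a_out) = 0.
    by apply/matrixP => j i'; rewrite !mxE arr8 // a4.
  have -> : rreg s8 r_mu = l0 by rewrite d2.
  have -> : rreg s8 r_zmax = 0.
    by rewrite d2 // c2 // b2 // a2 // k2 // /= /upd /= h2 // g2.
  apply: weights_init => //.
  - by move=> i; rewrite arr8 // a4 // s4y.
  - by move=> i; rewrite arr8 // a4 // k4 // /= h4 // g4.
pose X := (m%:R + 2) * (L + 1) : R.
have X_ge0 : 0 <= X by rewrite mulr_ge0 // addr_ge0.
pose K := Num.truncn X.
have [||s9 [u9 [e9 le9 [nh [k' [cs9 s9L _ _ [np [nr [_ w]]]]]]]]] :=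
  @wp_while (realD R) inp (RLt r_zmax r_L) (main_body B orc) body_time K
    (loop_inv L l0) s8 _ _ inv0.
- move=> i s [_ _ _ _ [np [nr [-> w]]]]; rewrite /K truncn_ge_nat //.
  exact: (weights_count Ab Sg e3_gt0 eps3_le l0_gt0 xmS cxm l0E w).
- move=> i s inv; rewrite /= => h; apply: main_bodyP => //.
  by have [_ <- _ _ _] := inv.
have zL : L <= rreg s9 r_zmax by move: nh; rewrite /= -leNgt s9L.
have [feas opt] := weights_final Ab e3_gt0 eps3_le w erefl mk zL.
have [s10 [u10 [e10 le10 [_ _ s10o]]]] := scale_loopP cs9.
exists s10, ((rreg s9 r_zmax)^-1 *: vec (rarr s9 a_out)),
  (u1 + (u2 + (u3 + (u4 + (u5 + (u6 + (u7 + (u8 + (u9 + u10))))).+1))))%N, k, K.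
split=> //.
- apply: prefix; rewrite cx; apply: ExecSeq e5 _; apply: ExecSeq e6 _.
  by apply: ExecSeq e7 _; apply: ExecSeq e8 _; apply: ExecSeq e9 _.
- by move=> j; rewrite s10o // !mxE mulrC.
- move=> z fz; apply: le_trans (opt z fz).
  by have -> : 3 * (eps / 3) = eps by lra.
split=> //.
  rewrite /K; apply: (@le_trans _ _ X); first by rewrite truncn_le.
  by rewrite /X /L -addrA.
move: le1 le2 le3 le4 le5 le6 le7 le8 le9 le10; rewrite /prep_time /search_time.
by rewrite -/price_time; clear; lia.
Qed.

(** * Running time *)

Lemma oracle_time_gt0 : (0 < T I)%N.
Proof.
have [s [x [t [e tT _ _]]]] := horc FI 0.
exact: leq_trans (exec_gt0 e) tT.
Qed.

(** The oracle must return some generator, and every generator loads a row. *)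
Lemma rows_gt0 : (0 < m)%N.
Proof.
have [_ [x [_ [_ _ _ [xS _]]]]] := horc FI 0.
have Sg z : z \in S -> (forall j, 0 <= z j 0) /\ z != 0 by apply: hS.
by have [i _] := load_gt0 Ab Sg xS; apply: leq_ltn_trans (ltn_ord i).
Qed.

Lemma code_time_le (kappa : R) (K t : nat) : 0 <= kappa -> n%:R <= kappa * (T I)%:R ->
  (t <= prep_time + (ask_time + (search_time + ((K * body_time.+1).+1 + (2 + n * 6))).+1))%N ->
  t%:R <= (27 * kappa + 8 * B%:R + 300) *
    ((1 + K%:R) * (N%:R + (T I)%:R) + (T I)%:R ^+ 2) :> R.
Proof.
move=> ka0 nT le_t.
have [mN nN] := dims_le_nnz Ab.
have /(_ R) mNr : forall R' : numDomainType, m%:R <= N%:R :> R' by move=> R'; rewrite ler_nat.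
have /(_ R) nNr : forall R' : numDomainType, n%:R <= N%:R :> R' by move=> R'; rewrite ler_nat.
have T1 : 1 <= (T I)%:R :> R by rewrite ler1n oracle_time_gt0.
have B0 : 0 <= B%:R :> R by [].
have K0 : 0 <= K%:R :> R by [].
have n0 : 0 <= n%:R :> R by [].
have m0 : 0 <= m%:R :> R by [].
have : t%:R <= (prep_time + (ask_time + (search_time +
   ((K * body_time.+1).+1 + (2 + n * 6))).+1))%:R :> R by rewrite ler_nat.
set bt := body_time.+1; set at_ := ask_time.
rewrite /prep_time /search_time /min_ratio_time /price_time -/at_.
have askE : at_%:R = 21 * n%:R + 4 * B%:R + 10 * (T I)%:R + 13 :> R.
  by rewrite /at_ /ask_time; ring.
have bodyE : bt%:R = 20 + at_%:R + 30 * m%:R + 12 * n%:R + 22 * N%:R :> R.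
  by rewrite /bt /body_time /push_time /price_time -/at_; ring.
move=> le_tr; apply: le_trans le_tr _.
apply: le_trans (time_poly_le ka0 B0 T1 K0 n0 m0 nNr mNr nT askE bodyE).
by rewrite le_eqVlt; apply/orP; left; apply/eqP; ring.
Qed.

(** Both [k.-1] and the rounding error 1 are at most [2 * ln m], as [2^-1 <= ln 2 <= ln m]. *)
Lemma level_le k : (1 < m)%N -> k = 0%N \/ (2 ^ k.-1 < m)%N -> k%:R <= 4 * ln m%:R :> R.
Proof.
move=> m1 kP.
have lnm : ln 2 <= ln m%:R :> R.
  by rewrite ler_ln ?posrE ?ltr0n ?(ltnW m1) // ler_nat.
have l2 := ln2_ge R.
case: kP => [->|lt]; first by lra.
have : k.-1%:R * 2^-1 <= ln m%:R :> R.
  apply: (@le_trans _ _ (ln (2 ^+ k.-1))); last first.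
    by rewrite ler_ln ?posrE ?exprn_gt0 ?ltr0n ?(ltnW m1) // -natrX ler_nat ltnW.
  by rewrite lnXn // -[leRHS]mulr_natl ler_wpM2l.
have : k%:R <= k.-1%:R + 1 :> R by rewrite natr1 ler_nat leqSpred.
by move: lnm l2; lra.
Qed.

Lemma iterations_le (kappa : R) (k K : nat) : 0 <= kappa -> n%:R <= kappa * (T I)%:R ->
  k = 0%N \/ (2 ^ k.-1 < m)%N ->
  K%:R <= (m%:R + 2) * (k%:R / (eps / 3) / (eps / 3) + 2) :> R ->
  (1 + K%:R) * (N%:R + (T I)%:R) + (T I)%:R ^+ 2 <=
  (7 * kappa + 90) * (eps ^- 2 * (m%:R * ln m%:R) * (N%:R + (T I)%:R) + (T I)%:R ^+ 2).
Proof.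
move=> ka0 nT kP; have [e0 e1] := andP eps01.
pose q := eps ^- 2; rewrite -/q.
have -> : k%:R / (eps / 3) / (eps / 3) = 9 * k%:R * q.
  by rewrite /q; field; rewrite gt_eqF.
have q1 : 1 <= q by rewrite /q invf_ge1 ?exprn_gt0 // exprn_ile1 // ltW.
have T1 : 1 <= (T I)%:R :> R by rewrite ler1n oracle_time_gt0.
have N0 : 0 <= N%:R :> R by [].
move: (T I)%:R T1 nT => tt T1 nT KX.
have tt2 : tt <= tt ^+ 2 by rewrite expr2 ler_peMr // (le_trans ler01).
(* For [m = 1] the logarithm is zero and only the squared oracle time remains. There [k = 0], at
   most six rounds occur, and [N <= n <= kappa * T]. *)
have [m1|m1] := ltnP 1 m; last first.
  have m_1 : m = 1%N by apply/eqP; rewrite eqn_leq m1 rows_gt0.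
  have k0 : k = 0%N by case: kP => //; rewrite m_1 ltnS leqn0 expn_eq0.
  have Nn : N%:R <= n%:R :> R.
    by rewrite ler_nat; apply: leq_trans (nnz_le A) _; rewrite m_1 mul1n.
  move: N%:R N0 Nn => Nr N0 Nn; rewrite m_1 k0 in KX *; rewrite ln1 !mulr0 mul0r add0r.
  have K6 : 1 + K%:R <= 7 :> R by move: KX; lra.
  have P0 : 0 <= Nr + tt by lra.
  have h1 : (1 + K%:R) * (Nr + tt) <= 7 * (Nr + tt) by rewrite ler_wpM2r.
  have h2 : kappa * tt <= kappa * tt ^+ 2 by rewrite ler_wpM2l.
  by move: h1 h2 nT tt2 Nn; lra.
have kl := level_le m1 kP; have l2 := ln2_ge R.
have l_ge : 2^-1 <= ln m%:R :> R.
  by apply: le_trans l2 _; rewrite ler_ln ?posrE ?ltr0n ?(ltnW m1) // ler_nat.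
have m2 : 2 <= m%:R :> R by rewrite ler_nat.
move: (ln m%:R) kl l_ge => l kl l_ge.
move: m%:R m2 KX => mr m2 KX.
have ql : l <= q * l by rewrite ler_peMl //; lra.
have kq : k%:R * q <= 4 * l * q by rewrite ler_wpM2r // (le_trans ler01).
(* [k <= 4 * l] contributes 36, and [2 <= 4 * (q * l)] the rest. With [mr + 2 <= 2 * mr] this gives
   80, and the initial 1 makes it 81. *)
have h1 : 9 * k%:R * q + 2 <= 40 * (q * l) by move: kq ql; lra.
have h2 : (mr + 2) * (9 * k%:R * q + 2) <= (2 * mr) * (40 * (q * l)).
  have kq0 : 0 <= k%:R * q by rewrite mulr_ge0 // (le_trans ler01).
  by apply: ler_pM => //; lra.
have ql0 : 0 <= q * l by lra.
have h3 : 1 <= mr * (q * l).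
  apply: (@le_trans _ _ (2 * (q * l))); first by lra.
  by rewrite ler_wpM2r.
have h4 : 1 + K%:R <= 81 * (q * (mr * l)) by move: KX h2 h3; lra.
have P0 : 0 <= N%:R + tt by lra.
have h5 : (1 + K%:R) * (N%:R + tt) <= 81 * (q * (mr * l)) * (N%:R + tt).
  by rewrite ler_wpM2r.
have G0 : 0 <= q * (mr * l) * (N%:R + tt).
  by rewrite mulr_ge0 // mulrCA mulr_ge0 //; lra.
have := (mulr_ge0 ka0 G0, sqr_ge0 tt, mulr_ge0 ka0 (sqr_ge0 tt)).
by move=> [[? ?] ?]; move: h5 G0; lra.
Qed.

End Run.

(** Each of [eps^-1], [m], [ln m] and [N] is at most [z], which accounts for the exponent 5, and [t]
    is at most [k0 * z ^+ k0]. [kk] has to serve both as factor and as exponent, hence the sum. *)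
Lemma poly_time_le (R : realType) (C eps : R) (m N D t k0 : nat) (z : R) (kk : nat) :
  0 <= C -> 0 < eps -> (0 < m)%N -> (t <= k0 * D ^ k0)%N ->
  z = (m + N + D)%:R + eps^-1 ->
  kk = (Num.bound C * (1 + k0 + k0 * k0) + (k0 + k0) + 5)%N ->
  C * (eps ^- 2 * (m%:R * ln m%:R) * (N%:R + t%:R) + t%:R ^+ 2) <= kk%:R * z ^+ kk.
Proof.
move=> C0 e0 m0 tD zE kkE.
have ei0 : 0 < eps^-1 by rewrite invr_gt0.
have le_z i : (i <= m + N + D)%N -> i%:R <= z.
  move=> h; rewrite zE; apply: (@le_trans _ _ (m + N + D)%:R); first by rewrite ler_nat.
  by rewrite lerDl ltW.
have mz : m%:R <= z by apply: le_z; clear; lia.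
have Nz : N%:R <= z by apply: le_z; clear; lia.
have Dz : D%:R <= z by apply: le_z; clear; lia.
have ez : eps^-1 <= z by rewrite zE lerDr.
have z1 : 1 <= z by apply: le_trans mz; rewrite ler1n.
have z0 : 0 <= z by apply: le_trans z1.
have lz : ln m%:R <= z.
  by apply: le_trans mz; apply: ltW; apply: ln_sublinear; rewrite ltr0n.
have l0 : 0 <= ln m%:R :> R by rewrite ln_ge0 // ler1n.
have tz : t%:R <= k0%:R * z ^+ k0.
  apply: (@le_trans _ _ (k0 * D ^ k0)%:R); first by rewrite ler_nat.
  by rewrite natrM natrX ler_wpM2l // lerXn2r ?nnegrE.
pose M := (k0 + k0 + 5)%N.
have zM i : (i <= M)%N -> z ^+ i <= z ^+ M by move=> iM; rewrite ler_weXn2l.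
have zz0 i : 0 <= z ^+ i by rewrite exprn_ge0.
have g1 : eps ^- 2 * (m%:R * ln m%:R) * (N%:R + t%:R) <= (1 + k0%:R) * z ^+ M.
  apply: (@le_trans _ _ (z ^+ 2 * (z * z) * (z + k0%:R * z ^+ k0))).
    rewrite -exprVn; apply: ler_pM => //.
    - by rewrite mulr_ge0 ?mulr_ge0 ?exprn_ge0 // ltW.
    - by rewrite addr_ge0.
    - apply: ler_pM => //; rewrite ?exprn_ge0 ?mulr_ge0 ?(ltW ei0) //.
        by rewrite lerXn2r ?nnegrE // ltW.
      by apply: ler_pM.
    - exact: lerD.
  have -> : z ^+ 2 * (z * z) * (z + k0%:R * z ^+ k0) = z ^+ 5 + k0%:R * z ^+ (k0 + 4).
    by rewrite exprD; ring.
  rewrite mulrDl mul1r; apply: lerD; first by apply: zM; rewrite /M; clear; lia.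
  by rewrite ler_wpM2l //; apply: zM; rewrite /M; clear; lia.
have g2 : t%:R ^+ 2 <= (k0 * k0)%:R * z ^+ M.
  apply: (@le_trans _ _ ((k0%:R * z ^+ k0) ^+ 2)).
    by rewrite lerXn2r ?nnegrE // mulr_ge0.
  rewrite exprMn -exprM expr2 -natrM ler_wpM2l //; apply: zM; rewrite /M; clear; lia.
have Cb : C <= (Num.bound C)%:R by rewrite ltW // archi_boundP.
apply: (@le_trans _ _ (C * ((1 + k0 + k0 * k0)%:R * z ^+ M))).
  rewrite ler_wpM2l // natrD mulrDl lerD // natrD; exact: g1.
apply: (@le_trans _ _ ((Num.bound C)%:R * ((1 + k0 + k0 * k0)%:R * z ^+ M))).
  by rewrite ler_wpM2r // mulr_ge0.
rewrite mulrA -natrM; apply: ler_pM => //.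
  by rewrite ler_nat kkE; clear; lia.
by rewrite ler_weXn2l // kkE /M; clear; lia.
Qed.

Theorem theorem4 (R : realType) (F : set (instance R))
    (hS : forall I, F I -> nonneg_nonzero I)
    (orc : cmd) (T : instance R -> nat)
    (horc : sign_oracle F orc T)
    (hcomb : strongly_combinatorial F orc)
    (hpoly : strongly_polynomial F T)
    (hOmega : Omega_dim F T) :
  exists p : cmd,
    strongly_polynomial_fptas F p /\
    fptas_runs_in F p (fun I m A eps =>
      eps ^- 2 * (m%:R * ln m%:R) * ((nnz A)%:R + (T I)%:R) + (T I)%:R ^+ 2).
Proof.
(* [B] depends on [orc] alone, so one program and one constant serve all instances in [F]. *)
have [B orcB] := regs_below_ex orc.
have [kO kO0 dimT] := hOmega; have [k0 polyT] := hpoly.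
pose C := (27 * kO^-1 + 8 * B%:R + 300) * (7 * kO^-1 + 90).
have kV0 : 0 <= kO^-1 by rewrite invr_ge0 ltW.
have C0 : 0 <= C by rewrite mulr_ge0 ?addr_ge0 ?mulr_ge0.
have run I (FI : F I) m (A : 'M[nat]_(m, dim I)) (b : 'cV[nat]_m) (c : 'cV[int]_(dim I)) eps :
    packing_data A b -> 0 < eps < 1 -> exists s x t,
    [/\ exec (V := realD R) (packing_input A b c eps) (packing_code B orc) (init (realD R)) s t,
        output s x, feasible A b (gens I) x,
        forall z, feasible A b (gens I) z -> (1 - eps) * objective c z <= objective c x &
        t%:R <= C * (eps ^- 2 * (m%:R * ln m%:R) * ((nnz A)%:R + (T I)%:R) + (T I)%:R ^+ 2)].
  move=> Ab eps01.
  have [s [x [t [k [K [e out feas opt [kP KP tP]]]]]]] :=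
    packing_codeP hS horc hcomb orcB FI c Ab eps01.
  have nT : (dim I)%:R <= kO^-1 * (T I)%:R by rewrite ler_pdivlMl //; apply: dimT.
  exists s, x, t; split=> //.
  apply: le_trans (code_time_le horc FI Ab kV0 nT tP) _; rewrite /C -[leRHS]mulrA ler_wpM2l //.
    by rewrite !addr_ge0 ?mulr_ge0.
  exact: (iterations_le hS horc FI Ab eps01 kV0 nT kP KP).
exists (packing_code B orc); split; last first.
  exists C => I FI m A b c eps Ab eps01.
  by have [s [x [t [e _ _ _ tC]]]] := run I FI m A b c eps Ab eps01; exists s, t.
exists (Num.bound C * (1 + k0 + k0 * k0) + (k0 + k0) + 5)%N.
move=> I FI m A b c eps Ab eps01.
have [s [x [t [e out feas opt tC]]]] := run I FI m A b c eps Ab eps01.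
have /andP[e0 e1] := eps01.
exists s, x, t; split=> //.
  (* It is enough that the value found, divided by [1 - eps], bounds every feasible value;
     attainment of the supremum does not enter. *)
  rewrite mulrC -ler_pdivlMr ?subr_gt0 //; apply: ge_sup.
    by exists (objective c x), x.
  by move=> _ [z fz <-]; rewrite ler_pdivlMr ?subr_gt0 // mulrC; apply: opt.
apply: le_trans tC _.
apply: (@poly_time_le R C eps m (nnz A) (desc_size I) (T I) k0) => //.
  exact: (rows_gt0 hS horc FI Ab).
exact: polyT.
Qed.
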